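(* Let $s=1+\rho$ with $\rho\in(0,1]$, let $\delta>0$, and let $\Theta\subset E$ be such that $\Theta_\delta\subset T$. There are constants $c_1>0$ (sufficiently small) and $c_s\in(0,1)$ depending only on $s$ such that if $\mathfrak v_\xi(\Theta)\le c_1 n$, then: (i) for all $\psi\in\Psi$, $$\sup_{\|f\|_{C^s(\Theta_\delta)}\le1}\sup_{\theta\in\Theta}\Big|\|f(\hat\theta)-f(\theta)\|_{L_\psi(\mathbb P_\theta)}-n^{-1/2}\sigma_f(\theta)\|Z\|_{L_\psi(\mathbb P)}\Big|\lesssim_{s,\psi}\Big(\sqrt{\tfrac{\mathfrak v_\xi(\Theta)}{n}}\Big)^s+\frac{\|\Sigma\|^{1/2}_{L_\infty(\Theta)}}{n^{1/2}}\Big(\sqrt{\tfrac{\mathfrak v_\xi(\Theta)}{n}}\Big)^{\rho}+\Delta^+_{\mathcal H,\psi,\Theta_\delta}(\hat\theta,\tilde\theta)+\sup_{\theta\in\Theta}\tilde\psi^{1/2}\big(\mathbb P\{\|\xi(\theta)\|\ge c_s\delta\sqrt n\}\big),$$ where $\mathcal H=\{g:\|g\|_{C^s(\Theta_{c_s\delta})}\le1\}$; (ii) for all $s'\in[1,s]$, $$\sup_{\|f\|_{C^s(\Theta_\delta)}\le1}\sup_{\theta\in\Theta}\Delta_{s'}\big(\sqrt n(f(\hat\theta)-f(\theta)),\sigma_f(\theta)Z\big)\lesssim_s \sqrt n\Big(\sqrt{\tfrac{\mathfrak v_\xi(\Theta)}{n}}\Big)^s+\|\Sigma\|^{1/2}_{L_\infty(E)}\Big(\sqrt{\tfrac{\mathfrak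 v_\xi(\Theta)}{n}}\Big)^{\rho}+\Delta_{\mathcal F,\Theta_\delta}\big(\sqrt n(\hat\theta-\theta),\xi(\theta)\big)+\sqrt n\sup_{\theta\in\Theta}\mathbb P^{1/4}\{\|\xi(\theta)\|\ge c_s\delta\sqrt n\},$$ where $\mathcal F=\{g:\|g\|_{C^{0,s'}(U_{c_s\delta\sqrt n})}\le1\}$.
   Context: Setting: $E$ is a separable Banach space with norm $\|\cdot\|$, $T\subset E$ is open. For each $\theta\in T$ an observation $X^{(n)}$ is sampled from a distribution $P^{(n)}_\theta$ (probability and expectation $\mathbb P_\theta,\mathbb E_\theta$), and $\hat\theta=\hat\theta(X^{(n)})\in T$ is an estimator of $\theta$. Functionals $f$ are bounded Borel functions on $E$; a constraint $\|f\|_{C^s(U)}\le 1$ refers to the restriction of $f$ to $U$, and it is understood that also $\sup_E|f|\le 1$. $\xi=\{\xi(\theta)\}$ is a mean zero Gaussian stochastic process with values in $E$; $\Sigma(\theta)$ is the covariance operator of $\xi(\theta)$. For $\Theta\subset T$ and $\delta>0$, $\Theta_\delta=\{\theta\in E:\mathrm{dist}(\theta,\Theta)<\delta\}$; whenever $\Theta,\delta$ with $\Theta_\delta\subset T$ are given, the convention $\xi(\theta)=0$ for $\theta\notin\Theta_\delta$ is used. The Gaussian approximation of $\hat\theta$ is $\tilde\theta=\theta+n^{-1/2}\xi(\theta)$. $\|\Sigma\|_{L_\infty(U)}=\sup_{\theta\in U}\|\Sigma(\theta)\|$ (operator norm), $\|\xi\|_{L_\infty(E)}=\sup_{\theta\in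 E}\|\xi(\theta)\|$, $\mathfrak v_\xi(\Theta)=\sup_{\theta\in\Theta}\mathbb E\|\xi(\theta)\|^2$. For Fréchet differentiable $f$, $\sigma_f^2(\theta)=\langle\Sigma(\theta)f'(\theta),f'(\theta)\rangle$. $Z\sim N(0,1)$. $U_r=\{x\in E:\|x\|<r\}$. Hölder norms: for Banach spaces $E,F$, open $U\subset E$ and $g:U\to F$, $\|g\|_{L_\infty(U)}=\sup_{x\in U}\|g(x)\|$, $\|g\|_{\mathrm{Lip}_\rho(U)}=\sup_{x\neq x'\in U}\|g(x)-g(x')\|/\|x-x'\|^\rho$ for $\rho\in(0,1]$, $\mathrm{Lip}=\mathrm{Lip}_1$. $g^{(j)}$ denotes the $j$-th Fréchet derivative, viewed as a map into symmetric bounded $j$-linear forms with the operator norm. For $s=m+\rho$, $m\ge 0$ an integer, $\rho\in(0,1]$, and $m$ times Fréchet differentiable $g$: $\|g\|_{C^s(U)}=\max(\|g\|_{L_\infty(U)},\max_{0\le j\le m-1}\|g^{(j)}\|_{\mathrm{Lip}(U)},\|g^{(m)}\|_{\mathrm{Lip}_\rho(U)})$, and for $0\le l\le m$, $\|g\|_{C^{l,s}(U)}=\max(\max_{l\le j\le m-1}\|g^{(j)}\|_{\mathrm{Lip}(U)},\|g^{(m)}\|_{\mathrm{Lip}_\rho(U)})$. Loss functions: $\Psi$ is the set of even convex functions $\psi:\mathbb R\to\mathbb R_+$ with $\psi(0)=0$, increasing on $\mathbb R_+$, and such that $c'u\le\psi(u)\le c''(e^u-1)$ for $u\ge 0$ for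 some constants $c',c''>0$. $\|\zeta\|_{L_\psi(\mathbb P)}=\inf\{c>0:\mathbb E\psi(|\zeta|/c)\le 1\}$, and $\tilde\psi(u)=1/\psi^{-1}(1/u)$, $u\ge 0$. Distances: for a class $\mathcal F$ of functions and random variables $\eta_1,\eta_2$ whose laws depend on $\theta$, $\Delta_{\mathcal F,\Theta}(\eta_1,\eta_2)=\sup_{\theta\in\Theta}\sup_{g\in\mathcal F}|\mathbb E_\theta g(\eta_1)-\mathbb E_\theta g(\eta_2)|$, $\Delta_{\mathcal F,\psi,\Theta}(\eta_1,\eta_2)=\sup_{\theta\in\Theta}\sup_{g\in\mathcal F}\big|\|g(\eta_1)\|_{L_\psi(\mathbb P_\theta)}-\|g(\eta_2)\|_{L_\psi(\mathbb P_\theta)}\big|$, and $\Delta^{+}_{\mathcal F,\psi,\Theta}=\Delta_{\mathcal F,\Theta}+\Delta_{\mathcal F,\psi,\Theta}$. For real random variables $\eta_1,\eta_2$ and $s'>0$, $\Delta_{s'}(\eta_1,\eta_2)=\sup\{|\mathbb E\varphi(\eta_1)-\mathbb E\varphi(\eta_2)|:\|\varphi\|_{C^{s'}(\mathbb R)}\le1\}$ (expectations under $\mathbb P_\theta$ when the laws depend on $\theta$). $A\lesssim_{a}B$ means $A\le CB$ with $C$ depending only on $a$. *)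

(* Defs.v *)
From HB Require Import structures.
From mathcomp Require Import all_boot all_order all_algebra.
From mathcomp Require Import all_classical all_reals all_analysis.
Set Implicit Arguments. Unset Strict Implicit. Unset Printing Implicit Defensive.
Import Order.TTheory GRing.Theory Num.Theory numFieldNormedType.Exports.
Local Open Scope classical_set_scope.
Local Open Scope ring_scope.

Section Defs.
Context {R : realType}.

Definition borel_sets (E : topologicalType) : set (set E) :=
  <<s [set U : set E | open U] >>.

Definition borel_fun (E : topologicalType) (g : E -> R) : Prop :=
  forall A : set R, measurable A -> borel_sets (g @^-1` A).

Definition random_element d (Om : measurableType d) (E : topologicalType)
  (X : Om -> E) : Prop :=
  forall B, borel_sets B -> measurable (X @^-1` B).

Definition separable (E : topologicalType) : Prop :=
  exists D : set E, countable D /\ dense D.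

Definition enlarge (E : normedModType R) (A : set E) (d : R) : set E :=
  [set x | exists2 t, A t & `|x - t| < d].

Definition origin_ball (E : normedModType R) (r : R) : set E := [set x | `|x| < r].

(** Hoelder-type conditions for s in (0,2] (only such s occur here).
    lip_on U r g :  ||g||_{Lip_r(U)} <= 1
    dlip_on U r g : ||g'||_{Lip_r(U)} <= 1 (operator norm of the Frechet
                    derivative, written out). *)
Definition lip_on (E : normedModType R) (U : set E) (r : R) (g : E -> R) :=
  forall x y, U x -> U y -> `|g x - g y| <= `|x - y| `^ r.

Definition diff_on (E : normedModType R) (U : set E) (g : E -> R) :=
  forall x, U x -> differentiable g x.

Definition dlip_on (E : normedModType R) (U : set E) (r : R) (g : E -> R) :=
  forall x y, U x -> U y -> forall h : E,
    `|'d g x h - 'd g y h| <= `|x - y| `^ r * `|h|.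

(** ||g||_{C^{0,s}(U)} <= 1, for s in (0,2]  (m = 0 if s <= 1, m = 1 else) *)
Definition C0s_le1 (E : normedModType R) (U : set E) (s : R) (g : E -> R) :=
  if s <= 1 then lip_on U s g
  else diff_on U g /\ lip_on U 1 g /\ dlip_on U (s - 1) g.

Definition Cs_le1 (E : normedModType R) (U : set E) (s : R) (g : E -> R) :=
  (forall x, U x -> `|g x| <= 1) /\ C0s_le1 U s g.

(** Admissible functionals: bounded Borel on E with sup_E |g| <= 1
    (the standing convention) and the given Hoelder constraint. *)
Definition functional (E : normedModType R) (g : E -> R) :=
  borel_fun g /\ forall x, `|g x| <= 1.

Definition Cs_ball (E : normedModType R) (U : set E) (s : R) (g : E -> R) :=
  functional g /\ Cs_le1 U s g.

Definition C0s_ball (E : normedModType R) (U : set E) (s : R) (g : E -> R) :=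
  functional g /\ C0s_le1 U s g.

Definition Ex d (Om : measurableType d) (P : probability Om R) (h : Om -> R) : R :=
  fine (\int[P]_w (h w)%:E)%E.

Definition Psi_class (psi : R -> R) : Prop :=
  (forall u, psi (- u) = psi u) /\
  (forall x y t, 0 <= t <= 1 ->
      psi (t * x + (1 - t) * y) <= t * psi x + (1 - t) * psi y) /\
  (forall u, 0 <= psi u) /\ psi 0 = 0 /\
  (forall x y, 0 <= x -> x <= y -> psi x <= psi y) /\
  exists c' c'' : R, 0 < c' /\ 0 < c'' /\
    forall u, 0 <= u -> c' * u <= psi u /\ psi u <= c'' * (expR u - 1).

Definition Lpsi (psi : R -> R) d (Om : measurableType d) (P : probability Om R)
  (h : Om -> R) : R :=
  inf [set c : R | 0 < c /\ (\int[P]_w (psi (`|h w| / c))%:E <= 1)%E].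

(** psi^{-1} on R_+ and tilde psi(u) = 1 / psi^{-1}(1/u) (with 1/0 = 0). *)
Definition psi_inv (psi : R -> R) (v : R) : R :=
  sup [set u : R | 0 <= u /\ psi u <= v].

Definition psi_tilde (psi : R -> R) (u : R) : R := (psi_inv psi u^-1)^-1.

Definition N01 := normal_prob (0 : R) 1.

Definition centered_gaussian d (Om : measurableType d) (Q : probability Om R)
  (X : Om -> R) : Prop :=
  measurable_fun setT X /\
  exists sigma : R, 0 <= sigma /\
    forall A : set R, measurable A ->
      Q (X @^-1` A) = (if sigma == 0 then \d_(0 : R) A else normal_prob 0 sigma A).

Definition bounded_linear (E : normedModType R) (u : E -> R) : Prop :=
  (forall (a : R) (x y : E), u (a *: x + y) = a * u x + u y) /\
  exists M : R, forall x, `|u x| <= M * `|x|.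

Definition dual_ball (E : normedModType R) (u : E -> R) : Prop :=
  (forall (a : R) (x y : E), u (a *: x + y) = a * u x + u y) /\
  forall x, `|u x| <= `|x|.

Definition gaussian_process (E : normedModType R) (T : set E)
  d (Om : measurableType d) (Q : probability Om R) (xi : E -> Om -> E) : Prop :=
  (forall t, random_element (xi t)) /\
  forall (k : nat) (ts : 'I_k -> E) (us : 'I_k -> E -> R),
    (forall i, T (ts i)) -> (forall i, bounded_linear (us i)) ->
    centered_gaussian Q (fun w => \sum_(i < k) us i (xi (ts i) w)).

Definition xi_conv (E : normedModType R) (Theta : set E) (delta : R)
  d (Om : measurableType d) (xi : E -> Om -> E) : E -> Om -> E :=
  fun t w => if `[< enlarge Theta delta t >] then xi t w else 0.

(** ||Sigma(theta)|| (operator norm of the covariance operator, i.e. norm of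
    the bilinear form <Sigma u, v> = E u(X) v(X) on the product of dual unit balls). *)
Definition Sigma_norm (E : normedModType R) d (Om : measurableType d)
  (Q : probability Om R) (X : Om -> E) : \bar R :=
  ereal_sup [set z | exists u v, dual_ball u /\ dual_ball v /\
                 z = (\int[Q]_w (u (X w) * v (X w))%:E)%E].

Definition Sigma_sup (E : normedModType R) d (Om : measurableType d)
  (Q : probability Om R) (xi : E -> Om -> E) (U : set E) : \bar R :=
  ereal_sup [set Sigma_norm Q (xi t) | t in U].

Definition v_xi (E : normedModType R) d (Om : measurableType d)
  (Q : probability Om R) (xi : E -> Om -> E) (Theta : set E) : \bar R :=
  ereal_sup [set (\int[Q]_w (`|xi t w| ^+ 2)%:E)%E | t in Theta].

(** sigma_f(theta) = <Sigma(theta) f'(theta), f'(theta)>^{1/2} *)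
Definition sigma_f (E : normedModType R) d (Om : measurableType d)
  (Q : probability Om R) (xi : E -> Om -> E) (f : E -> R) (t : E) : R :=
  Num.sqrt (Ex Q (fun w => ('d f t (xi t w)) ^+ 2)).

Definition esqrt (x : \bar R) : \bar R :=
  match x with
  | EFin r => (Num.sqrt r)%:E
  | EPInf => +oo%E
  | ENInf => 0%E
  end.

Definition setting (E : completeNormedModType R) (T Theta : set E) (delta : R)
  (n : nat) d (Om : measurableType d) (P : E -> probability Om R)
  (thetahat : Om -> E) d' (Om' : measurableType d') (Q : probability Om' R)
  (xi : E -> Om' -> E) : Prop :=
  separable E /\ open T /\ 0 < delta /\ enlarge Theta delta `<=` T /\
  (0 < n)%N /\ random_element thetahat /\ (forall w, T (thetahat w)) /\
  gaussian_process T Q xi.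

End Defs.

(* Main.v *)
Require Import Defs.
From HB Require Import structures.
From mathcomp Require Import all_boot all_order all_algebra.
From mathcomp Require Import all_classical all_reals all_analysis.
From mathcomp Require Import measurable_realfun.
From mathcomp Require Import ring lra.
Import Order.TTheory GRing.Theory Num.Theory numFieldNormedType.Exports.
Set Implicit Arguments. Unset Strict Implicit. Unset Printing Implicit Defensive.
Local Open Scope classical_set_scope.
Local Open Scope ring_scope.

(* Fix [f] and [t] in Theta, and put [X = xi t] and [L = 'd f t X], a centred Gaussian variable of
   standard deviation [sigma_f t].

   (i) The function [(f - f t) / 2] belongs to H, so up to the two distances over H one may replace
   the estimator by [t + X / sqrt n]. By Taylor's formula, or by the trivial bounds on [f] when
   [X / sqrt n] leaves the ball of radius [delta], the increment of [f] differs from [L / sqrt n]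
   by at most [3 * 1_{|X| >= cs * delta * sqrt n} + (|X| / sqrt n) `^ s]. The Orlicz norm of the
   indicator is a value of [psi_tilde], and that of the power is of the order of [rate `^ s]
   because [psi] grows at most exponentially and [|X| ^+ 2] has an exponential moment.

   (ii) For [phi] in the unit ball of C^s', the function
   [x |-> phi (sqrt n * (f (t + x / sqrt n) - f t)) / 3] belongs to F, and the rest is the same
   with expectations in place of Orlicz norms.

   The exponential moment is Fernique's theorem with explicit constants: if [E |X|^2 <= r^2] then
   [E exp (|X|^2 / (512 r^2)) <= 5]. By Hahn-Banach and separability [|X|] is a supremum of
   countably many [|u_k X|] with [u_k] in the dual ball. For independent copies [X], [X'] the pairs
   [(X, X')] and [((X - X') / sqrt 2, (X + X') / sqrt 2)] have the same cosine moments, hence give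
   the same mass to products of boxes; this yields Fernique's inequality
   [P (|X| <= s) P (|X| > t) <= P (|X| > (t - s) / sqrt 2)^2], which is then iterated. *)

(** * Norming functionals in separable spaces *)

(** The constants may depend on [rho] and [psi] only, never on [E], [T] or [xi]. Hence the
    exponential moment must be explicit: once the norm is scaled by a bound of its second moment,
    the estimate is the same for every Gaussian element of every separable space. Since
    [1 + rho <= 2], the power of the norm in the Taylor remainder is dominated by 1 plus the square,
    so that an exponential moment of the square controls its Orlicz norm.

    The first-order term causes no error: ['d f t] is a bounded functional, and its value at the
    Gaussian element is exactly normal. Only the Taylor remainder, the exit from the ball and the
    replacement of the estimator have to be paid for.

    Two degenerate situations shape the statements. The rate can be 0, so bounds are first proved
    for every [r] above it. And [Lpsi] is 0 when no constant is admissible, so Orlicz estimates come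
    with an admissible constant. *)

Section sublinear.
Context {R : realType} {E : normedModType R}.
Implicit Types (p q : E -> R) (x y : E).

Definition sublinear p : Prop :=
  (forall x y, p (x + y) <= p x + p y) /\
  (forall (a : R) x, 0 <= a -> p (a *: x) = a * p x).

Lemma sublinear0 p : sublinear p -> p 0 = 0.
Proof. by move=> [_ h]; rewrite -(scale0r (0 : E)) h// mul0r. Qed.

Lemma sublinear_geN p x : sublinear p -> - p (- x) <= p x.
Proof.
move=> sp; have := sp.1 x (- x); rewrite subrr sublinear0//; lra.
Qed.

(* A sublinear minorant of [p] whose value at [- y] is at most [- p y]; a minimal sublinear [p]
   therefore equals all its slides and satisfies [p (- y) = - p y]. *)
Definition slide p y x : R := inf [set p (x + a *: y) - a * p y | a in [set a | 0 <= a]].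

Lemma slide_has_inf p y x : sublinear p ->
  has_inf [set p (x + a *: y) - a * p y | a in [set a | 0 <= a]].
Proof.
move=> sp; split; first by exists (p (x + 0 *: y) - 0 * p y), 0 => //=.
exists (- p (- x)) => _ [a /= a0 <-].
have := sp.1 (x + a *: y) (- x); rewrite addrAC subrr add0r sp.2//; lra.
Qed.

Lemma slide_le p y x a : sublinear p -> 0 <= a -> slide p y x <= p (x + a *: y) - a * p y.
Proof.
move=> sp a0; apply: ge_inf; first by have [] := slide_has_inf y x sp.
by exists a.
Qed.

Lemma slide_ge p y x (r : R) : sublinear p ->
  (forall a, 0 <= a -> r <= p (x + a *: y) - a * p y) -> r <= slide p y x.
Proof.
move=> sp h; apply: lb_le_inf; first by have [] := slide_has_inf y x sp.
by move=> _ [a /= a0 <-]; exact: h.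
Qed.

Lemma slide_le_id p y x : sublinear p -> slide p y x <= p x.
Proof. by move=> sp; have := slide_le y x sp (lexx 0); rewrite scale0r addr0 mul0r subr0. Qed.

Lemma sublinear_slide p y : sublinear p -> sublinear (slide p y).
Proof.
move=> sp; split => [x z|a x a0].
  rewrite -lerBlDr; apply: slide_ge => // a a0.
  rewrite lerBlDr -lerBlDl; apply: slide_ge => // b b0.
  rewrite lerBlDl; apply: le_trans (slide_le y _ sp (addr_ge0 b0 a0)) _.
  have := sp.1 (x + a *: y) (z + b *: y).
  rewrite addrACA -scalerDl (addrC a b); lra.
move: a0; rewrite le_eqVlt => /orP[/eqP<-|a0].
  rewrite scale0r mul0r; apply/eqP; rewrite eq_le; apply/andP; split.
    by rewrite -(sublinear0 sp) slide_le_id.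
  by apply: slide_ge => // b b0; rewrite add0r sp.2// subrr.
(* Only one inequality; the other is the same one for [c^-1] at the point [c *: z]. *)
have key (c : R) (z : E) : 0 < c -> slide p y (c *: z) <= c * slide p y z.
  move=> c0; rewrite -ler_pdivrMl//; apply: slide_ge => // b b0.
  rewrite ler_pdivrMl//; apply: le_trans (slide_le y _ sp (mulr_ge0 (ltW c0) b0)) _.
  by rewrite -scalerA -scalerDr sp.2 ?(ltW c0)// mulrBr mulrA.
apply/eqP; rewrite eq_le key//=.
have := @key a^-1 (a *: x); rewrite invr_gt0 => /(_ a0).
by rewrite scalerA mulVf ?gt_eqF// scale1r ler_pdivlMl.
Qed.

Lemma minimal_sublinear_linear p : sublinear p ->
  (forall q, sublinear q -> (forall x, q x <= p x) -> q = p) ->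
  forall (a : R) x y, p (a *: x + y) = a * p x + p y.
Proof.
move=> sp pmin.
have pN y : p (- y) = - p y.
  have h : slide p y = p.
    apply: pmin => [|x]; [exact: sublinear_slide|exact: slide_le_id].
  have := slide_le y (- y) sp ler01.
  rewrite h scale1r addNr sublinear0// mul1r; have := sublinear_geN y sp; lra.
have pD x y : p (x + y) = p x + p y.
  have := sp.1 (- x) (- y); rewrite -opprD !pN; have := sp.1 x y; lra.
move=> a x y; rewrite pD; congr (_ + _).
have [a0|/ltW a0] := leP 0 a; first exact: sp.2.
rewrite -[in LHS](opprK a) scaleNr pN sp.2 ?oppr_ge0//; ring.
Qed.

(** Hahn-Banach by Zorn's lemma: a minimal sublinear function below [p] is linear. The lower bound
    of a chain is the pointwise infimum, finite because a sublinear minorant [s] satisfies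
    [- p (- x) <= - s (- x) <= s x]. *)
Lemma sublinear_minorant p : sublinear p ->
  exists2 u : E -> R, (forall x, u x <= p x) &
    forall (a : R) x y, u (a *: x + y) = a * u x + u y.
Proof.
move=> sp.
pose S := {q : E -> R | sublinear q /\ forall x, q x <= p x}.
(* The order is reversed, so that a maximal element for [le] is a minimal function. *)
pose le (q r : S) := `[< forall x, sval r x <= sval q x >].
have [||||[q [sq qp]] qmin] := @Zorn S le _ _ _ _.
- by move=> q; apply/asboolP.
- move=> r s t /asboolP rs /asboolP st; apply/asboolP => x.
  exact: le_trans (st x) (rs x).
- move=> [r rP] [s sP] /asboolP rs /asboolP sr.
  apply: eq_exist => /=; apply/funext => x; apply/eqP.
  by rewrite eq_le; rewrite (sr x) (rs x).
- move=> A Atot.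
  have [[r0 Ar0]|A0] := pselect (exists r, A r); last first.
    exists (exist _ p (conj sp (fun x => lexx _))) => s As.
    by case: A0; exists s.
  pose V x := [set sval r x | r in A].
  pose m x := inf (V x).
  have infV x : has_inf (V x).
    split; first by exists (sval r0 x), r0.
    exists (- p (- x)) => _ [[s [ss sp']] As <-] /=.
    have := sublinear_geN x ss; have := sp' (- x); lra.
  have m_le r x : A r -> m x <= sval r x.
    by move=> Ar; apply: ge_inf; [exact: (infV x).2|exists r].
  have m_ge x (c : R) : (forall r, A r -> c <= sval r x) -> c <= m x.
    move=> h; apply: lb_le_inf; first exact: (infV x).1.
    by move=> _ [r Ar <-]; exact: h.
  have sm : sublinear m.
    split => [x y|a x a0].
      rewrite -lerBlDr; apply: (m_ge) => r Ar.
      rewrite lerBlDr -lerBlDl; apply: (m_ge) => s As.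
      rewrite lerBlDl.
      (* Of the two members of the chain chosen at [x] and at [y], the smaller one serves at both
         points. *)
      have [/asboolP rs|/asboolP sr] := Atot _ _ Ar As.
        apply: le_trans (m_le _ _ As) _; apply: le_trans ((svalP s).1.1 _ _) _.
        by rewrite lerD2r// rs.
      apply: le_trans (m_le _ _ Ar) _; apply: le_trans ((svalP r).1.1 _ _) _.
      by rewrite lerD2l// sr.
    move: a0; rewrite le_eqVlt => /orP[/eqP<-|a0].
      rewrite scale0r mul0r; apply/eqP; rewrite eq_le; apply/andP; split.
        by rewrite -(sublinear0 (svalP r0).1) m_le.
      by apply: (m_ge) => r _; rewrite (sublinear0 (svalP r).1).
    apply/eqP; rewrite eq_le; apply/andP; split.
      rewrite -ler_pdivrMl//; apply: (m_ge) => r Ar.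
      by rewrite ler_pdivrMl// -((svalP r).1.2 _ _ (ltW a0)) m_le.
    apply: (m_ge) => r Ar.
    by rewrite (svalP r).1.2 ?(ltW a0)// ler_pM2l// m_le.
  have mp x : m x <= p x by apply: le_trans (m_le _ _ Ar0) _; exact: (svalP r0).2.
  exists (exist _ m (conj sm mp)) => s As; apply/asboolP => x /=; exact: m_le.
exists q => //; apply: minimal_sublinear_linear => // r sr rq.
have rp x : r x <= p x by apply: le_trans (rq x) (qp x).
have /(_ _)/(congr1 sval)/= := qmin (exist _ r (conj sr rp)).
by apply; apply/asboolP.
Qed.

(** A linear minorant of the norm need not attain it at [x], but a minorant [u] of its slide at [x]
    does: [u (- x)] is at most the norm of [- x + x] minus the norm of [x]. *)
Lemma dual_ball_norming x : exists2 u : E -> R, dual_ball u & u x = `|x|.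
Proof.
have sN : sublinear (fun x : E => `|x|).
  by split => [y z|a y a0]; [exact: ler_normD|rewrite normrZ ger0_norm].
have [u u_le u_lin] := sublinear_minorant (sublinear_slide x sN).
have uN y : u (- y) = - u y.
  have u0 : u 0 = 0 by have := u_lin (-1) 0 0; rewrite scaler0 addr0; lra.
  by have := u_lin (-1) y 0; rewrite scaleN1r addr0 u0; lra.
have u_norm y : u y <= `|y| by apply: le_trans (u_le y) _; exact: slide_le_id.
have u_ball y : `|u y| <= `|y|.
  by rewrite ler_norml u_norm andbT; have := u_norm (- y); rewrite uN normrN; lra.
exists u; first by split.
apply/eqP; rewrite eq_le u_norm/=.
have := le_trans (u_le (- x)) (slide_le x (- x) sN ler01).
by rewrite uN scale1r addNr normr0; lra.
Qed.

(** The functionals norm the points of a dense sequence. If [e k] is within [eps / 2] of [x],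
    replacing [x] by [e k] in the norm, and [e k] by [x] in [u k], costs [eps / 2] each. The
    equivalence turns a ball into a countable intersection of slabs, the limit of finite boxes. *)
Lemma separable_norming : separable E ->
  exists u : nat -> E -> R, (forall k, dual_ball (u k)) /\
    forall x (r : R), (`|x| <= r) <-> (forall k, `|u k x| <= r).
Proof.
move=> [D [cD dD]].
have [e De] : exists e : nat -> E, D `<=` range e.
  have /pfcard_geP[D0|[e]] := cD.
    by exfalso; have [x []] := dD setT (ex_intro _ 0 I) openT; rewrite D0.
  by exists e; rewrite image_eq.
have [u uP] := choice (fun k => let: ex_intro2 u u1 u2 := dual_ball_norming (e k) in
  ex_intro (fun u => dual_ball u /\ u (e k) = `|e k|) u (conj u1 u2)).
exists u; split=> [k|x r]; first exact: (uP k).1.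
split=> [xr k|h]; first exact: le_trans ((uP k).1.2 x) xr.
apply/ler_addgt0Pl => eps eps0.
have e2 : 0 < eps / 2 by rewrite divr_gt0.
have [y [yx /De[k _ eky]]] := dD (ball x (eps / 2)) (ex_intro _ x (ballxx x e2)) (ball_open x (eps / 2)).
move: yx; rewrite -eky -ball_normE /ball_/= => xe.
have [[ul ub] ue] := uP k.
have : `|u k (e k)| <= `|u k x| + `|u k (e k - x)|.
  rewrite (_ : u k (e k) = u k x + u k (e k - x)) ?ler_normD//.
  by have := ul 1 (e k - x) x; rewrite scale1r subrK mul1r addrC.
have := ub (e k - x); rewrite ue normr_id.
have := ler_normD (x - e k) (e k); rewrite subrK (distrC (e k) x); have := h k; lra.
Qed.

End sublinear.

(** * Bounded measurable functions and expectations *)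

Section bounded_measurable.
Context {R : realType} d {Om : measurableType d}.
Implicit Types (f g : Om -> R).

Definition bmeas f : Prop :=
  measurable_fun setT f /\ exists M : R, forall x, `|f x| <= M.

Lemma bmeas_cst (c : R) : bmeas (fun=> c).
Proof. by split; [exact: measurable_cst|exists `|c|]. Qed.

Lemma bmeasD f g : bmeas f -> bmeas g -> bmeas (fun x => f x + g x).
Proof.
move=> [mf [M fM]] [mg [N gN]]; split; first exact: measurable_funD.
by exists (M + N) => x; rewrite (le_trans (ler_normD _ _))// lerD.
Qed.

Lemma bmeasM f g : bmeas f -> bmeas g -> bmeas (fun x => f x * g x).
Proof.
move=> [mf [M fM]] [mg [N gN]]; split; first exact: measurable_funM.
by exists (M * N) => x; rewrite normrM ler_pM.
Qed.

Lemma bmeasZ (c : R) f : bmeas f -> bmeas (fun x => c * f x).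
Proof. by move=> bf; apply: bmeasM => //; exact: bmeas_cst. Qed.

Lemma bmeas_cos f : measurable_fun setT f -> bmeas (fun x => cos (f x)).
Proof.
move=> mf; split; last by exists 1 => x; exact: cos_max.
apply: (measurableT_comp _ mf); apply: continuous_measurable_fun; exact: continuous_cos.
Qed.

Lemma bmeas_sin f : measurable_fun setT f -> bmeas (fun x => sin (f x)).
Proof.
move=> mf; split; last by exists 1 => x; exact: sin_max.
apply: (measurableT_comp _ mf); apply: continuous_measurable_fun; exact: continuous_sin.
Qed.

Lemma bmeas_indic (A : set Om) : measurable A -> bmeas (\1_A : Om -> R).
Proof.
move=> mA; split; first exact: measurable_indic.
by exists 1 => x; rewrite indicE ger0_norm// lern1 leq_b1.
Qed.

Variable P : probability Om R.

Lemma bmeas_integrable f : bmeas f -> P.-integrable setT (EFin \o f).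
Proof.
move=> [mf [M fM]]; apply: measurable_bounded_integrable => //.
  by rewrite (le_lt_trans (@probability_le1 _ _ _ P _ measurableT))// ltry.
exists M; split; first exact: num_real.
by move=> y My x _; exact: le_trans (fM x) (ltW My).
Qed.

Lemma ExD f g : P.-integrable setT (EFin \o f) -> P.-integrable setT (EFin \o g) ->
  Ex P (fun x => f x + g x) = Ex P f + Ex P g.
Proof. by move=> bf bg; exact: RintegralD. Qed.

Lemma ExZ (c : R) f : P.-integrable setT (EFin \o f) -> Ex P (fun x => c * f x) = c * Ex P f.
Proof. by move=> bf; exact: RintegralZl. Qed.

Lemma Ex_cst (c : R) : Ex P (fun=> c) = c.
Proof. by rewrite /Ex integral_cst// [X in (_ * X)%E](@probability_setT _ _ _ P) mule1. Qed.

Lemma Ex_indic (A : set Om) : measurable A -> Ex P \1_A = fine (P A).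
Proof. by move=> mA; rewrite /Ex integral_indic// setIT. Qed.

Lemma eq_Ex f g : f =1 g -> Ex P f = Ex P g.
Proof. by move=> fg; congr Ex; exact/funext. Qed.

Lemma le_Ex f g : P.-integrable setT (EFin \o f) -> P.-integrable setT (EFin \o g) ->
  (forall x, f x <= g x) -> Ex P f <= Ex P g.
Proof. by move=> bf bg fg; exact: le_Rintegral. Qed.

Lemma Ex_ge0 f : (forall x, 0 <= f x) -> 0 <= Ex P f.
Proof. by move=> f0; apply: Rintegral_ge0. Qed.

Lemma Ex_abs_le f : P.-integrable setT (EFin \o f) -> `|Ex P f| <= Ex P (fun x => `|f x|).
Proof. by move=> bf; exact: le_normr_Rintegral. Qed.

Lemma Ex_cvg (f_ : nat -> Om -> R) f (M : R) :
  (forall n, measurable_fun setT (f_ n)) -> (forall n x, `|f_ n x| <= M) ->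
  (forall x, f_ n x @[n --> \oo] --> f x) ->
  Ex P (f_ n) @[n --> \oo] --> Ex P f.
Proof.
move=> mf fM ff.
have mf' : measurable_fun setT f.
  by apply: (@measurable_fun_cvg _ _ _ _ f_) => // x _; exact: ff.
have fM' x : `|f x| <= M.
  have : `|f_ n x| @[n --> \oo] --> `|f x| by apply: cvg_norm.
  by move=> /cvgr_to_le; apply; exact: nearW.
have bf : bmeas f by split => //; exists M.
have ifin := integrable_fin_num measurableT (bmeas_integrable bf).
have := @dominated_convergence _ _ _ P setT measurableT (fun n => EFin \o f_ n) (EFin \o f)
  (cst M%:E).
case=> //.
- by move=> n; apply/measurable_EFinP.
- exact/measurable_EFinP.
- by apply: aeW => x _; apply/cvg_EFin; [exact: nearW|exact: ff].
- exact: (bmeas_integrable (bmeas_cst M)).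
- by apply: aeW => x n _; rewrite lee_fin.
move=> _ _ h.
by have := fine_cvg (f := fun n => (\int[P]_w (f_ n w)%:E)%E) (a := Ex P f); rewrite /Ex fineK//; apply.
Qed.

End bounded_measurable.

(** * Expectations over two independent copies *)

Section product_expectation.
Context {R : realType} d {Om : measurableType d} (Q : probability Om R).

Lemma bmeas_fst f : bmeas f -> bmeas (fun w : Om * Om => f w.1 : R).
Proof.
by move=> [mf [M fM]]; split; [exact: measurableT_comp|exists M].
Qed.

Lemma bmeas_snd f : bmeas f -> bmeas (fun w : Om * Om => f w.2 : R).
Proof.
by move=> [mf [M fM]]; split; [exact: measurableT_comp|exists M].
Qed.

Lemma Ex_prod (f g : Om -> R) : bmeas f -> bmeas g ->
  Ex (Q \x Q)%E (fun w => f w.1 * g w.2) = Ex Q f * Ex Q g.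
Proof.
move=> bf bg.
have ifg := @bmeas_integrable _ _ _ (Q \x Q)%E _ (bmeasM (bmeas_fst bf) (bmeas_snd bg)).
have ig := bmeas_integrable Q bg.
have Eg : (\int[Q]_y (g y)%:E = (Ex Q g)%:E)%E.
  by rewrite /Ex fineK//; exact: integrable_fin_num.
have -> : Ex (Q \x Q)%E (fun w => f w.1 * g w.2) = Ex Q (fun x => Ex Q g * f x).
  rewrite {1}/Ex -(integral12_prod_meas1 ifg) /Ex; congr fine.
  apply: eq_integral => x _; rewrite /fubini_F /= .
  by rewrite -/(Ex Q g) EFinM -Eg muleC -integralZl.
by rewrite ExZ; [exact: mulrC|exact: bmeas_integrable].
Qed.

Lemma Ex_diag_fst (f : Om -> R) : bmeas f -> Ex (Q \x Q)%E (fun w => f w.1) = Ex Q f.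
Proof.
move=> bf; have := Ex_prod bf (bmeas_cst 1); rewrite Ex_cst mulr1 => <-.
by apply: eq_Ex => w; rewrite mulr1.
Qed.

End product_expectation.

(** * Cosine moments determine the mass of boxes *)

Section step_approximation.
Context {R : realType}.
Implicit Types (q t y : R).

(** With [q = r ^+ 2], Bernoulli's inequality for [r^-1 = 1 + h] bounds [n%:R * r ^+ n] by [h^-1],
    and the remaining factor [r ^+ n] tends to 0. *)
Lemma cvg_nat_geometric q : 0 <= q < 1 -> n%:R * q ^+ n @[n --> \oo] --> (0 : R).
Proof.
move=> /andP[q0 q1].
have [->|qn0] := eqVneq q 0.
  apply/cvgrPdist_lt => e e0; near=> n.
  have n0 : (0 < n)%N by near: n; exact: nbhs_infty_gt.
  by rewrite expr0n gtn_eqF// mulr0 subrr normr0.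
have {}q0 : 0 < q by rewrite lt_neqAle eq_sym qn0.
pose r := Num.sqrt q.
have r0 : 0 < r by rewrite sqrtr_gt0.
have r1 : r < 1 by rewrite -sqrtr1 ltr_sqrt.
pose h := r^-1 - 1.
have h0 : 0 < h by rewrite subr_gt0 invf_gt1.
have nr n : n%:R * r ^+ n <= h^-1.
  have H : 1 + n%:R * h <= (1 + h) ^+ n.
    elim: n => [|n ih]; first by rewrite mul0r addr0 expr0.
    have hh := sqr_ge0 h; have n0 : 0 <= n%:R :> R by [].
    apply: (@le_trans _ _ ((1 + n%:R * h) * (1 + h))).
      rewrite -(natr1 n); nra.
    by rewrite exprSr ler_wpM2r// addr_ge0// ltW.
  have r_h : r * (1 + h) = 1 by rewrite /h addrC subrK mulfV// gt_eqF.
  rewrite -(ler_pM2l h0) mulfV ?gt_eqF//.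
  apply: (@le_trans _ _ ((1 + h) ^+ n * r ^+ n)).
    rewrite mulrA ler_wpM2r ?exprn_ge0 ?(ltW r0)//; lra.
  by rewrite -exprMn mulrC r_h expr1n.
apply: (@squeeze_cvgr _ _ _ _ (fun=> 0) (fun n => h^-1 * r ^+ n)).
- apply: nearW => n; rewrite mulr_ge0 ?exprn_ge0 ?(ltW q0)//=.
  have -> : q = r * r by rewrite -expr2 sqr_sqrtr// ltW.
  by rewrite exprMn mulrA ler_wpM2r ?exprn_ge0 ?(ltW r0).
- exact: cvg_cst.
- rewrite -[X in _ --> X](mulr0 h^-1); apply: cvgM; first exact: cvg_cst.
  by apply: cvg_expr; rewrite ger0_norm// ltW.
Unshelve. all: by end_near. Qed.

(** Evaluated at [cos t], it approximates the indicator of [0 <= cos t]. The affine map sends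
    [[-1, 1]] to [[0, 1]] and 0 to 1/2. The power that is subtracted lies between
    [1 - n%:R * (2 * y) ^+ n] and 1, which settles [y < 1/2]; for [y >= 1/2] it is at most
    [expR (- 1) ^+ n]. *)
Definition step_poly (n : nat) : {poly R} :=
  1 - (1 - ((2^-1)%:P * (1 + 'X)) ^+ n) ^+ (n * 2 ^ n).

Definition step_fun (n : nat) y : R := 1 - (1 - y ^+ n) ^+ (n * 2 ^ n).

Lemma step_fun_bound n y : 0 <= y <= 1 -> `|step_fun n y| <= 1.
Proof.
move=> /andP[y0 y1]; rewrite /step_fun.
have h : 0 <= (1 - y ^+ n) ^+ (n * 2 ^ n) <= 1.
  have a : 0 <= y ^+ n by exact: exprn_ge0.
  have b : y ^+ n <= 1 by exact: exprn_ile1.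
  rewrite exprn_ge0 ?exprn_ile1//; lra.
by rewrite ler_norml; move/andP: h => [? ?]; apply/andP; split; lra.
Qed.

Lemma bernoulli_le (m : nat) t : 0 <= t <= 1 -> 1 - m%:R * t <= (1 - t) ^+ m.
Proof.
move=> /andP[t0 t1]; elim: m => [|m ih]; first by rewrite mul0r subr0 expr0.
apply: (@le_trans _ _ ((1 - m%:R * t) * (1 - t))).
  have m0 : 0 <= m%:R :> R by [].
  have := sqr_ge0 t; rewrite -(natr1 m); nra.
by rewrite exprSr ler_wpM2r// subr_ge0.
Qed.

(* At [y = 1/2] the exponent [n * 2 ^ n] (rather than [2 ^ n]) makes the limit 1. *)
Lemma cvg_step_fun y : 0 <= y <= 1 -> step_fun n y @[n --> \oo] --> ((2^-1 <= y)%R%:R : R).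
Proof.
move=> /andP[y0 y1]; have [y2|y2] /= := leP.
- rewrite -[X in _ --> X]subr0; apply: cvgB; first exact: cvg_cst.
  apply: (@squeeze_cvgr _ _ _ _ (fun=> 0) (fun n => expR (- 1) ^+ n)).
  + apply: nearW => n.
    have yn : 0 <= 1 - y ^+ n by rewrite subr_ge0 exprn_ile1.
    rewrite exprn_ge0//= mulnC exprM lerXn2r ?nnegrE ?exprn_ge0 ?expR_ge0//.
    apply: (@le_trans _ _ (expR (- (2^-1 : R) ^+ n) ^+ (2 ^ n)%N)).
      rewrite lerXn2r ?nnegrE ?expR_ge0//.
      have := expR_ge1Dx (- 2^-1 ^+ n :> R).
      have : (2^-1 : R) ^+ n <= y ^+ n by rewrite lerXn2r ?nnegrE// invr_ge0.
      lra.
    rewrite -expRM_natl ler_expR mulrN exprVn natrX mulfV ?expf_neq0//.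
  + exact: cvg_cst.
  + by apply: cvg_expr; rewrite ger0_norm ?expR_ge0// expR_lt1 oppr_lt0.
- apply: (@squeeze_cvgr _ _ _ _ (fun=> 0) (fun n => n%:R * (2 * y) ^+ n)).
  + apply: nearW => n; rewrite /step_fun.
    have yn : 0 <= y ^+ n <= 1 by rewrite exprn_ge0 ?exprn_ile1.
    have := bernoulli_le (n * 2 ^ n) yn; rewrite natrM natrX exprMn mulrA => h.
    move: yn => /andP[yn0 yn1].
    have : (1 - y ^+ n) ^+ (n * 2 ^ n) <= 1 by apply: exprn_ile1; lra.
    by move=> ?; apply/andP; split; lra.
  + exact: cvg_cst.
  + apply: cvg_nat_geometric; apply/andP; split; lra.
Qed.

Lemma step_poly_cos n t : (step_poly n).[cos t] = step_fun n ((1 + cos t) / 2).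
Proof. by rewrite /step_poly /step_fun !(hornerE, horner_exp) [in RHS]mulrC. Qed.

Lemma cvg_step_poly_cos t :
  (step_poly n).[cos t] @[n --> \oo] --> ((0 <= cos t)%R%:R : R).
Proof.
have c1 := cos_le1 t; have c2 := cos_geN1 t.
rewrite (_ : 0 <= cos t = (2^-1 <= (1 + cos t) / 2)).
  under eq_fun do rewrite step_poly_cos.
  by apply: cvg_step_fun; apply/andP; split; lra.
by apply/idP/idP; lra.
Qed.

Lemma step_poly_cos_bound n t : `|(step_poly n).[cos t]| <= 1.
Proof.
have c1 := cos_le1 t; have c2 := cos_geN1 t.
by rewrite step_poly_cos; apply: step_fun_bound; apply/andP; split; lra.
Qed.

Lemma cos_ge0_iff t : `|t| <= pi -> (0 <= cos t) = (`|t| <= pi / 2).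
Proof.
move=> tpi.
have -> : cos t = cos `|t|.
  by have [t0|t0] := leP 0 t; [rewrite ger0_norm|rewrite ltr0_norm// cosN].
have t0 := normr_ge0 t; move: tpi t0; move: `|t| => u upi u0.
apply/idP/idP => [|h]; last by apply: cos_ge0_pihalf; rewrite h andbT; have := @pi_gt0 R; lra.
apply: contraTT; rewrite -!ltNge => h; rewrite -(@cos_pihalf R).
by rewrite ltr_cos// in_itv/= ?upi ?u0//; have := @pi_gt0 R; move=> ?; apply/andP; split; lra.
Qed.

(** By periodicity, the sign of [cos t] tells whether [t] is within [pi / 2] of 0 only if it is
    within [pi]. The factors at the halved arguments ensure this, each for the argument before it;
    after [k] halvings the hypothesis takes over. *)
Lemma prod_cos_halving k t : `|t| <= 2 ^+ k * (pi / 2) ->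
  \prod_(j < k) ((0 <= cos (t / 2 ^+ j))%R%:R : R) = (`|t| <= pi / 2)%R%:R.
Proof.
elim: k t => [|k ih] t; first by rewrite expr0 mul1r big_ord0 => ->.
move=> ht; rewrite big_ord_recl expr0 divr1.
under eq_bigr => j _ do rewrite /= exprS invfM mulrA.
have t2 : `|t / 2| = `|t| / 2 by rewrite normrM [X in _ * X]ger0_norm// invr_ge0.
rewrite ih; last by rewrite t2 ler_pdivrMr// mulrAC -exprSr.
rewrite t2; have [h|h] := leP `|t| pi; last first.
  rewrite (_ : `|t| / 2 <= pi / 2 = false) ?mulr0; last by apply/negP; lra.
  by rewrite (_ : `|t| <= pi / 2 = false)//; apply/negP; have := @pi_gt0 R; lra.
rewrite cos_ge0_iff// (_ : `|t| / 2 <= pi / 2) ?mulr1//; lra.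
Qed.

Lemma cvg_prod_cos_halving (s t : R) : 0 < s ->
  \prod_(j < k) ((0 <= cos (pi / (2 * s) / 2 ^+ j * t))%R%:R : R) @[k --> \oo]
    --> ((`|t| <= s)%R%:R : R).
Proof.
move=> s0; have pi0 := @pi_gt0 R.
have b0 : 0 < pi / (2 * s) by rewrite divr_gt0// mulr_gt0.
pose u := pi / (2 * s) * t.
have -> : (`|t| <= s) = (`|u| <= pi / 2).
  rewrite /u normrM (gtr0_norm b0) -ler_pdivlMl//; congr (_ <= _).
  have E (p : R) : 0 < p -> s = (p / (2 * s))^-1 * (p / 2).
    move=> p0; have sn := lt0r_neq0 s0; have pn := lt0r_neq0 p0; field.
    by rewrite ?sn ?pn.
  exact: E.
apply: cvg_near_cst.
have : (2 : R)^-1 ^+ k @[k --> \oo] --> (0 : R).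
  by apply: cvg_expr; rewrite ger0_norm ?invr_ge0// invf_lt1// ltr1n.
(* Once [2^-1 ^+ k] is below this number, [prod_cos_halving] applies to [u] and the sequence is
   constant. *)
have e0 : 0 < pi / 2 / (1 + `|u|) by rewrite !divr_gt0// ltr_pwDl.
move=> /cvgrPdist_lt/(_ _ e0); apply: filterS => k.
rewrite sub0r normrN ger0_norm ?exprn_ge0 ?invr_ge0// => hk.
rewrite -(@prod_cos_halving k u).
  by apply: eq_bigr => j _; rewrite /u mulrAC.
move: hk; rewrite exprVn ltr_pdivlMr ?ltr_pwDl// -ltr_pdivlMl ?invr_gt0 ?exprn_gt0// invrK.
by have := normr_ge0 u; lra.
Qed.

End step_approximation.

(** * From cosines to boxes, one coordinate at a time *)

Section cramer_wold.
Context {R : realType} d {Z : measurableType d} (mu : probability Z R).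

Lemma bmeas_comp (g : R -> R) (x : Z -> R) : bmeas g -> measurable_fun setT x ->
  bmeas (fun z => g (x z)).
Proof. by move=> [mg [M gM]] mx; split; [exact: measurableT_comp|exists M]. Qed.

Section one_coordinate.
Variables (x y W W' : Z -> R).
Hypotheses (mx : measurable_fun setT x) (my : measurable_fun setT y).
Hypotheses (bW : bmeas W) (bW' : bmeas W').

(** Asking for equality against every cosine, and not only at [a = 0], makes the class stable under
    multiplication by cosines, since a product of two cosines is half a sum of two. If it contains
    1, it then contains the polynomials in a cosine and their bounded pointwise limits. *)
Definition cos_agree (g : R -> R) : Prop := bmeas g /\
  forall a, Ex mu (fun z => W z * g (x z) * cos (a * x z)) =
            Ex mu (fun z => W' z * g (y z) * cos (a * y z)).

Let mcos (a : R) u : measurable_fun setT u -> bmeas (fun z : Z => cos (a * u z)).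
Proof. by move=> mu'; apply: bmeas_cos; apply: measurable_funM. Qed.

Let bmult (V u : Z -> R) g a : bmeas V -> measurable_fun setT u -> bmeas g ->
  bmeas (fun z => V z * g (u z) * cos (a * u z)).
Proof. by move=> bV mu' bg; apply: bmeasM; [apply: bmeasM => //; exact: bmeas_comp|exact: mcos]. Qed.

Lemma cos_agreeD g h : cos_agree g -> cos_agree h -> cos_agree (fun t => g t + h t).
Proof.
move=> [bg ag] [bh ah]; split; first exact: bmeasD.
have key V u a : bmeas V -> measurable_fun setT u ->
    Ex mu (fun z => V z * (g (u z) + h (u z)) * cos (a * u z)) =
    Ex mu (fun z => V z * g (u z) * cos (a * u z)) + Ex mu (fun z => V z * h (u z) * cos (a * u z)).
  move=> bV mu'; rewrite -ExD; [|exact/bmeas_integrable/bmult..].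
  by apply: eq_Ex => z; rewrite mulrDr mulrDl.
by move=> a; rewrite !key// ag ah.
Qed.

Lemma cos_agreeZ (c : R) g : cos_agree g -> cos_agree (fun t => c * g t).
Proof.
move=> [bg ag]; split; first exact: bmeasZ.
have key V u a : bmeas V -> measurable_fun setT u ->
    Ex mu (fun z => V z * (c * g (u z)) * cos (a * u z)) =
    c * Ex mu (fun z => V z * g (u z) * cos (a * u z)).
  move=> bV mu'; rewrite -ExZ; last exact/bmeas_integrable/bmult.
  by apply: eq_Ex => z; ring.
by move=> a; rewrite !key// ag.
Qed.

Lemma cos_agreeM (b : R) g : cos_agree g -> cos_agree (fun t => g t * cos (b * t)).
Proof.
move=> [bg ag]; split.
  by apply: bmeasM => //; apply: bmeas_cos; apply: measurable_funM.
have key V u a : bmeas V -> measurable_fun setT u ->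
    Ex mu (fun z => V z * (g (u z) * cos (b * u z)) * cos (a * u z)) =
    2^-1 * Ex mu (fun z => V z * g (u z) * cos ((a + b) * u z)) +
    2^-1 * Ex mu (fun z => V z * g (u z) * cos ((a - b) * u z)).
  move=> bV mu'; rewrite -!ExZ; [|exact/bmeas_integrable/bmult..].
  rewrite -ExD; [|exact/bmeas_integrable/bmeasZ/bmult..].
  by apply: eq_Ex => z; rewrite mulrDl mulrBl cosD cosB; field.
by move=> a; rewrite !key// !ag.
Qed.

Lemma cos_agree_poly (b : R) g (p : {poly R}) : cos_agree g ->
  cos_agree (fun t => g t * p.[cos (b * t)]).
Proof.
move=> ag; elim/poly_ind: p => [|p c ih].
  have := cos_agreeZ 0 ag; congr cos_agree; apply/funext => t.
  by rewrite horner0 mulr0 mul0r.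
have := cos_agreeD (cos_agreeM b ih) (cos_agreeZ c ag); congr cos_agree; apply/funext => t.
by rewrite !hornerE; ring.
Qed.

Lemma cos_agree_lim (g_ : nat -> R -> R) g (M : R) : (forall n, cos_agree (g_ n)) ->
  (forall n t, `|g_ n t| <= M) -> (forall t, g_ n t @[n --> \oo] --> g t) -> cos_agree g.
Proof.
move=> ag gM gg.
have bg : bmeas g.
  split.
    apply: (@measurable_fun_cvg _ _ _ _ g_) => // n; by have [[]] := ag n.
  exists M => t; have : `|g_ n t| @[n --> \oo] --> `|g t| by apply: cvg_norm; exact: gg.
  by move=> /cvgr_to_le; apply; exact: nearW.
split=> // a.
have key V u : bmeas V -> measurable_fun setT u ->
    Ex mu (fun z => V z * g_ n (u z) * cos (a * u z)) @[n --> \oo] -->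
    Ex mu (fun z => V z * g (u z) * cos (a * u z)).
  move=> bV mu'; have [_ [N VN]] := bV.
  apply: (@Ex_cvg _ _ _ _ _ _ (N * M)).
  - by move=> n; have [] := bmult a bV mu' (ag n).1.
  - move=> n z; rewrite !normrM -[leRHS]mulr1 ler_pM ?mulr_ge0 ?cos_max//.
    by rewrite ler_pM.
  - by move=> z; apply: cvgM; [apply: cvgM => //; exact: cvg_cst|exact: cvg_cst].
have k1 := key _ _ bW mx; have k2 := key _ _ bW' my.
apply: (cvg_unique _ k1); first exact: norm_hausdorff.
by move: k2; under eq_fun do rewrite -(ag _).2.
Qed.

Lemma cos_agree_step (b : R) g : cos_agree g ->
  cos_agree (fun t => g t * (0 <= cos (b * t))%R%:R).
Proof.
move=> ag; have [_ [M gM]] := ag.1.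
apply: (@cos_agree_lim (fun n t => g t * (step_poly n).[cos (b * t)]) _ M).
- by move=> n; exact: cos_agree_poly.
- move=> n t; rewrite normrM -[leRHS]mulr1 ler_pM//; exact: step_poly_cos_bound.
- by move=> t; apply: cvgM; [exact: cvg_cst|exact: cvg_step_poly_cos].
Qed.

Lemma cos_agree_interval (s : R) : 0 < s -> cos_agree (fun=> 1) ->
  cos_agree (fun t => (`|t| <= s)%R%:R).
Proof.
move=> s0 a1.
pose J k t : R := \prod_(j < k) ((0 <= cos (pi / (2 * s) / 2 ^+ j * t))%R%:R : R).
apply: (@cos_agree_lim J _ 1).
- elim=> [|k ih].
    by move: a1; congr cos_agree; apply/funext => t; rewrite /J big_ord0.
  have := cos_agree_step (pi / (2 * s) / 2 ^+ k) ih.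
  by congr cos_agree; apply/funext => t; rewrite /J big_ord_recr.
- move=> k t; rewrite /J normr_prod; apply: prodr_ile1 => j _.
  by rewrite normr_ge0 ger0_norm// lern1 leq_b1.
- by move=> t; exact: cvg_prod_cos_halving.
Qed.

End one_coordinate.

Lemma measurable_lincomb (x : nat -> Z -> R) (a : nat -> R) k :
  (forall i, measurable_fun setT (x i)) ->
  measurable_fun setT (fun z => \sum_(i < k) a i * x i z).
Proof.
move=> mx; elim: k => [|k ih].
  by under eq_fun do rewrite big_ord0; exact: measurable_cst.
by under eq_fun do rewrite big_ord_recr/=; apply: measurable_funD => //; exact: measurable_funM.
Qed.

(* Sines are not needed: the box is symmetric in each coordinate, so its indicator is a limit of
   polynomials in cosines. *)
Lemma cramer_wold_box (x y : nat -> Z -> R) (s : R) k :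
  (forall i, measurable_fun setT (x i)) -> (forall i, measurable_fun setT (y i)) ->
  0 < s -> forall W W' : Z -> R, bmeas W -> bmeas W' ->
  (forall a : nat -> R, Ex mu (fun z => W z * cos (\sum_(i < k) a i * x i z)) =
                        Ex mu (fun z => W' z * cos (\sum_(i < k) a i * y i z))) ->
  Ex mu (fun z => W z * \prod_(i < k) (`|x i z| <= s)%R%:R) =
  Ex mu (fun z => W' z * \prod_(i < k) (`|y i z| <= s)%R%:R).
Proof.
move=> mx my s0.
have bI (u : Z -> R) : measurable_fun setT u -> bmeas (fun z => (`|u z| <= s)%R%:R : R).
  move=> mu'.
  have -> : (fun z => (`|u z| <= s)%R%:R : R) = \1_(u @^-1` `[- s, s]).
    apply/funext => z; rewrite indicE; congr (nat_of_bool _)%:R.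
    by apply/idP/idP; rewrite inE /= in_itv/= -ler_norml.
  by apply: bmeas_indic; rewrite -[X in measurable X]setTI; exact: mu'.
elim: k => [|k ih] W W' bW bW' H.
  have := H (fun=> 0); congr (_ = _); apply: eq_Ex => z;
    by rewrite !big_ord0 cos0.
under eq_Ex do rewrite big_ord_recr/= mulrCA mulrC.
under [RHS]eq_Ex do rewrite big_ord_recr/= mulrCA mulrC.
(* The indicator of the last coordinate joins the weights. The cosine moments in [k] coordinates
   under the new weights come from [cos_agree_interval] at frequency 0. *)
have {}ih := ih (fun z => W z * (`|x k z| <= s)%R%:R) (fun z => W' z * (`|y k z| <= s)%R%:R).
rewrite (_ : Ex mu _ = Ex mu (fun z => W z * (`|x k z| <= s)%R%:R * \prod_(i < k) (`|x i z| <= s)%R%:R));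
  last by apply: eq_Ex => z; ring.
rewrite ih; [by apply: eq_Ex => z; ring|exact: bmeasM (bW) (bI _ (mx k))|
  exact: bmeasM (bW') (bI _ (my k))|move=> a].
pose S (u : nat -> Z -> R) z := \sum_(i < k) a i * u i z.
have mS u : (forall i, measurable_fun setT (u i)) -> measurable_fun setT (S u).
  exact: measurable_lincomb.
have [|||_ /(_ 0)] := @cos_agree_interval (x k) (y k) (fun z => W z * cos (S x z))
    (fun z => W' z * cos (S y z)) (mx k) (my k) _ _ s s0.
- by apply: bmeasM => //; apply: bmeas_cos; exact: mS.
- by apply: bmeasM => //; apply: bmeas_cos; exact: mS.
- split=> [|b]; first exact: bmeas_cst.
  (* The product of [cos (S u z)] and [cos (b * u k z)] is half the sum of the cosines of the
     combinations with last coefficient [b] and [- b]: two instances of [H]. *)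
  have key V u : bmeas V -> (forall i, measurable_fun setT (u i)) ->
      Ex mu (fun z => V z * cos (S u z) * 1 * cos (b * u k z)) =
      2^-1 * Ex mu (fun z => V z * cos (\sum_(i < k.+1) (if i == k :> nat then b else a i) * u i z)) +
      2^-1 * Ex mu (fun z => V z * cos (\sum_(i < k.+1) (if i == k :> nat then - b else a i) * u i z)).
    move=> bV mu'.
    have bb (c : R) : bmeas (fun z => V z *
        cos (\sum_(i < k.+1) (if i == k :> nat then c else a i) * u i z)).
      apply: bmeasM => //; apply: bmeas_cos.
      exact: (measurable_lincomb (fun i => if i == k then c else a i)).
    rewrite -!ExZ; [|exact/bmeas_integrable/bb..].
    rewrite -ExD; [|exact/bmeas_integrable/bmeasZ/bb..].
    apply: eq_Ex => z; rewrite !big_ord_recr/= eqxx.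
    have E c : \sum_(i < k) (if i == k :> nat then c else a i) * u i z = S u z.
      by apply: eq_bigr => i _; rewrite ltn_eqF.
    by rewrite !E mulNr cosD cosB; field.
  by rewrite !key// (H (fun i => if i == k then b else a i)) (H (fun i => if i == k then - b else a i)).
- have E V u : Ex mu (fun z => V z * cos (S u z) * (`|u k z| <= s)%R%:R * cos (0 * u k z)) =
      Ex mu (fun z => V z * (`|u k z| <= s)%R%:R * cos (\sum_(i < k) a i * u i z)).
    by apply: eq_Ex => z; rewrite mul0r cos0 /S; ring.
  by rewrite !E.
Qed.

End cramer_wold.

(** * Gaussian laws on the real line *)

Section density.
Local Open Scope ereal_scope.
Context d (T : measurableType d) (R : realType).
Variables (mu nu : {measure set T -> \bar R}) (p : T -> R).
Hypotheses (p0 : forall x, (0 <= p x)%R) (mp : measurable_fun setT p).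
Hypothesis nuE : forall A, measurable A -> nu A = \int[mu]_(x in A) (p x)%:E.

Import HBNNSimple.

Let integral_density_nnsfun (f : {nnsfun T >-> R}) :
  \int[nu]_x (f x)%:E = \int[mu]_x ((f x)%:E * (p x)%:E).
Proof.
under [LHS]eq_integral do rewrite fimfunE -fsumEFin//.
rewrite [LHS]ge0_integral_fsum//; last 2 first.
  - by move=> r; exact/measurable_EFinP/measurableT_comp.
  - by move=> n x _; rewrite EFinM nnfun_muleindic_ge0.
under [RHS]eq_integral.
  move=> x xD; rewrite fimfunE -fsumEFin// ge0_mule_fsuml; last first.
    by move=> r; rewrite EFinM nnfun_muleindic_ge0.
  over.
rewrite [RHS]ge0_integral_fsum//; last 2 first.
  - move=> r; apply: emeasurable_funM; last exact/measurable_EFinP.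
    by apply/measurable_EFinP/measurableT_comp.
  - by move=> n x _; apply: mule_ge0; [rewrite EFinM nnfun_muleindic_ge0|rewrite lee_fin].
apply: eq_fsbigr => r _.
transitivity (r%:E * nu (f @^-1` [set r])).
  by rewrite integralZl_indic_nnsfun// integral_indic// setIT.
rewrite nuE//.
under [RHS]eq_integral do rewrite EFinM -muleA.
have [r0|r0] := leP 0%R r; last first.
  have fr : f @^-1` [set r] = set0.
    apply/seteqP; split => x //= fxr.
    by have : (0 <= f x)%R by []; rewrite [f x]fxr leNgt r0.
  rewrite fr integral_set0 mule0.
  under eq_integral do rewrite indic0 mul0e mule0.
  by rewrite integral0.
rewrite ge0_integralZl//.
- congr (_ * _); rewrite [LHS]integral_mkcond; apply: eq_integral => x _.
  by rewrite patchE indicE; case: (_ \in _); rewrite ?mul1e ?mul0e.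
- by apply: emeasurable_funM; apply/measurable_EFinP.
- by move=> x _; rewrite mule_ge0// lee_fin.
Qed.

Lemma ge0_integral_density (f : T -> \bar R) :
  measurable_fun setT f -> (forall x, 0 <= f x) ->
  \int[nu]_x f x = \int[mu]_x (f x * (p x)%:E).
Proof.
move=> mf f0.
pose f_ := nnsfun_approx measurableT mf.
transitivity (lim (\int[nu]_x (f_ n x)%:E @[n --> \oo])).
  rewrite -monotone_convergence//=.
  - apply: eq_integral => ? /[!inE] xD; apply/esym/cvg_lim => //=.
    exact: cvg_nnsfun_approx.
  - by move=> n; exact/measurable_EFinP/measurable_funTS.
  - by move=> n ? _; rewrite lee_fin.
  - by move=> ? _ ? ? mn; rewrite lee_fin; exact/lefP/nd_nnsfun_approx.
rewrite [RHS](_ : _ = lim (\int[mu]_x ((f_ n x)%:E * (p x)%:E) @[n --> \oo])); last first.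
  rewrite -monotone_convergence//=.
  - apply: eq_integral => x /[!inE] xD; apply/esym/cvg_lim => //.
    by apply: cvgeZr => //; exact: cvg_nnsfun_approx.
  - by move=> n; apply: emeasurable_funM; apply/measurable_EFinP => //; exact/measurable_funTS.
  - by move=> n ? _; rewrite mule_ge0// lee_fin.
  - by move=> x _ a b ab; rewrite lee_wpmul2r// lee_fin//; exact/lefP/nd_nnsfun_approx.
by apply: congr_lim; apply/funext => n; exact: integral_density_nnsfun.
Qed.

End density.

Section gaussian.
Context {R : realType}.
Local Notation mu := (@lebesgue_measure R).
Implicit Types (c x : R).

Lemma ge0_integral_image d d' (T : measurableType d) (T' : measurableType d')
    (m : {measure set T -> \bar R}) (nu : {measure set T' -> \bar R}) (X : {mfun T >-> T'})
    (f : T' -> \bar R) :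
  (forall A, measurable A -> nu A = m (X @^-1` A)) ->
  measurable_fun setT f -> (forall y, 0 <= f y)%E ->
  (\int[nu]_y f y = \int[m]_w f (X w))%E.
Proof.
move=> nuE mf f0; transitivity (\int[pushforward m X]_y f y)%E.
  by apply: eq_measure_integral => A mA _; exact: nuE.
by rewrite ge0_integral_pushforward.
Qed.

(** By uniqueness of Lebesgue measure, only half-open intervals have to be compared. *)
Lemma lebesgue_measure_scale (X : {mfun measurableTypeR R >-> measurableTypeR R})
    (c : {nonneg R}) (A : set R) : (forall x, X x = c%:num * x) -> 0 < c%:num ->
  measurable A -> mu A = mscale c mu (X @^-1` A).
Proof.
move=> Xc c0 mA.
apply: (@lebesgue_measure_unique R (pushforward (mscale c mu) X)) => // _ [[a b]] _ <-.
suff : mu `]a, b]%classic = (c%:num%:E * mu (X @^-1` `]a, b]%classic))%E by [].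
have -> : X @^-1` `]a, b]%classic = `]c%:num^-1 * a, c%:num^-1 * b]%classic.
  apply/seteqP; split => x /=; rewrite !in_itv/= Xc => /andP[ax xb]; apply/andP; split.
  - by rewrite ltr_pdivrMl.
  - by rewrite ler_pdivlMl.
  - by move: ax; rewrite ltr_pdivrMl.
  - by move: xb; rewrite ler_pdivlMl.
rewrite !lebesgue_measure_itv/= !lte_fin ltr_pM2l ?invr_gt0//.
case: ifPn => _; last by rewrite mule0.
by rewrite -!EFinB -EFinM -mulrBr mulrA mulfV ?mul1r// gt_eqF.
Qed.

Lemma ge0_integral_scale c (f : R -> \bar R) : 0 < c ->
  measurable_fun setT f -> (forall x, 0 <= f x)%E ->
  (\int[mu]_x f x = c%:E * \int[mu]_x f (c * x)%R)%E.
Proof.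
move=> c0 mf f0.
have mc : measurable_fun setT (fun x : measurableTypeR R => c * x : measurableTypeR R).
  exact: measurable_funM.
pose cM := HB.pack_for {mfun measurableTypeR R >-> measurableTypeR R} (fun x : R => c * x)
  (isMeasurableFun.Build _ _ _ _ _ mc).
rewrite (@ge0_integral_image _ _ _ _ (mscale (NngNum (ltW c0)) mu) mu cM)//; last first.
  by move=> A mA; exact: lebesgue_measure_scale.
by rewrite ge0_integral_mscale//; exact: (measurableT_comp mf mc).
Qed.

Lemma ge0_integral_normal (s : R) (f : R -> \bar R) : measurable_fun setT f ->
  (forall x, 0 <= f x)%E ->
  (\int[normal_prob 0 s]_x f x = \int[mu]_x (f x * (normal_pdf 0 s x)%:E))%E.
Proof.
move=> mf f0; apply: ge0_integral_density => //.
- by move=> x; exact: normal_pdf_ge0.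
- exact: measurable_normal_pdf.
Qed.

Lemma normal_pdf_scale (s x : R) : 0 < s -> s * normal_pdf 0 s (s * x) = normal_pdf 0 1 x.
Proof.
move=> s0; rewrite !normal_pdfE ?gt_eqF// /normal_peak /normal_fun !subr0 expr1n.
rewrite mulrA; congr (_ * _).
  rewrite mul1r -mulrnAr sqrtrM ?sqr_ge0// sqrtr_sqr gtr0_norm// invfM mulrA.
  by rewrite mulfV ?mul1r// gt_eqF.
congr expR; rewrite exprMn !mulNr; congr (- _).
by rewrite -(mulr_natr (s ^+ 2)) invfM mulrACA mulfV ?mul1r// sqrf_eq0 gt_eqF.
Qed.

Lemma ge0_integral_normal_scale (s : R) (f : R -> \bar R) : 0 < s ->
  measurable_fun setT f -> (forall x, 0 <= f x)%E ->
  (\int[normal_prob 0 s]_x f x = \int[N01]_x f (s * x)%R)%E.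
Proof.
move=> s0 mf f0; rewrite ge0_integral_normal// (ge0_integral_scale s0)//; last 2 first.
- apply: emeasurable_funM => //; apply/measurable_EFinP; exact: measurable_normal_pdf.
- by move=> x; rewrite mule_ge0// lee_fin normal_pdf_ge0.
rewrite [RHS]ge0_integral_normal//; last by apply: measurableT_comp => //; exact: measurable_funM.
rewrite -ge0_integralZl//; last 3 first.
- apply: emeasurable_funM.
    by apply: measurableT_comp => //; exact: measurable_funM.
  apply/measurable_EFinP; apply: measurableT_comp; first exact: measurable_normal_pdf.
  exact: measurable_funM.
- by move=> x _; rewrite mule_ge0// lee_fin normal_pdf_ge0.
- by rewrite lee_fin ltW.
by apply: eq_integral => x _; rewrite muleCA -EFinM normal_pdf_scale.
Qed.

(** The law is given by its integrals, as that of [s] times a standard normal variable. This covers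
    the point mass [s = 0] together with [s > 0], and extended values allow unbounded [f] without
    integrability conditions. *)
Definition gauss_law d (Om : measurableType d) (Q : probability Om R) (X : Om -> R) (s : R) :=
  [/\ measurable_fun setT X, 0 <= s &
  forall f : R -> \bar R, measurable_fun setT f -> (forall x, 0 <= f x)%E ->
    (\int[Q]_w f (X w) = \int[N01]_x f (s * x)%R)%E].

Lemma centered_gaussian_law d (Om : measurableType d) (Q : probability Om R) (X : Om -> R) :
  centered_gaussian Q X -> exists s, gauss_law Q X s.
Proof.
move=> [mX [s [s0 QX]]]; exists s; split=> // f mf f0.
pose XM := HB.pack_for {mfun Om >-> R} X (isMeasurableFun.Build _ _ _ _ _ mX).
have [s_eq0|sn0] := eqVneq s 0.
  rewrite s_eq0 in QX *.
  rewrite -(@ge0_integral_image _ _ _ _ Q (dirac (0 : R)) XM)//; last first.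
    by move=> A mA; rewrite /= QX// eqxx.
  rewrite integral_dirac// diracT mul1e.
  under eq_integral do rewrite mul0r.
  by rewrite integral_cst// [X in (_ * X)%E](@probability_setT _ _ _ (normal_prob _ _)) mule1.
have mX' : measurable_fun setT (X : Om -> measurableTypeR R) by exact: mX.
pose XM' := HB.pack_for {mfun Om >-> measurableTypeR R} X (isMeasurableFun.Build _ _ _ _ _ mX').
transitivity (\int[normal_prob 0 s]_x f x)%E.
  apply/esym; apply: (@ge0_integral_image _ _ _ _ Q (normal_prob 0 s) XM' f) => //.
  by move=> A mA; rewrite /= QX// (negbTE sn0).
by apply: ge0_integral_normal_scale => //; rewrite lt_neqAle eq_sym sn0.
Qed.

End gaussian.

(** * Integration by parts and the characteristic function of the standard normal law *)

Section normal_moments.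
Context {R : realType}.
Local Notation mu := (@lebesgue_measure R).
Local Notation phi := (@normal_pdf R 0 1).
Implicit Types (x l : R).

Lemma std_normal_pdfE x : phi x = normal_peak 1 * expR (- (x ^+ 2 / 2)).
Proof. by rewrite normal_pdfE ?oner_neq0// /normal_fun subr0 expr1n mulNr. Qed.

(** The right side is a multiple of the density of variance 2, hence an integrable majorant for the
    integrands below. *)
Lemma expR_normal_pdf x :
  expR (x ^+ 2 / 4) * phi x = Num.sqrt 2 * normal_pdf 0 (Num.sqrt 2) x.
Proof.
have s0 : 0 < Num.sqrt 2 :> R by rewrite sqrtr_gt0.
rewrite std_normal_pdfE normal_pdfE ?gt_eqF// /normal_fun subr0 sqr_sqrtr//.
rewrite mulrCA -expRD mulrA; congr (_ * expR _); last by field.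
rewrite /normal_peak expr1n mul1r sqr_sqrtr//.
rewrite -mulrnAr (sqrtrM (pi *+ 2)) ?ler0n// invfM mulrA mulfV ?mul1r// gt_eqF//.
Qed.

Lemma normr_le_expR_sqr x : `|x| <= expR (x ^+ 2 / 4).
Proof.
apply: le_trans (expR_ge1Dx _); rewrite -real_normK ?num_real//.
have := sqr_ge0 (`|x| / 2 - 1); lra.
Qed.

Lemma sqr_le_expR_sqr x : x ^+ 2 <= 4 * expR (x ^+ 2 / 4).
Proof. by have := expR_ge1Dx (x ^+ 2 / 4); lra. Qed.

Lemma expR_sqr_ge1 x : 1 <= expR (x ^+ 2 / 4).
Proof. by rewrite -expR0 ler_expR divr_ge0// sqr_ge0. Qed.

Lemma integrable_normal_dom (h : R -> R) (C : R) : measurable_fun setT h ->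
  (forall x, `|h x| <= C * expR (x ^+ 2 / 4)) ->
  mu.-integrable setT (EFin \o (fun x => h x * phi x)).
Proof.
move=> mh hC.
have ig : mu.-integrable setT (fun x => ((C * Num.sqrt 2)%:E * (normal_pdf 0 (Num.sqrt 2) x)%:E)%E).
  by apply: integrableZl => //; exact: integrable_normal_pdf.
apply: (le_integrable _ _ _ ig) => //.
  by apply/measurable_EFinP; apply: measurable_funM => //; exact: measurable_normal_pdf.
move=> x _ /=; rewrite lee_fin normrM (ger0_norm (normal_pdf_ge0 _ _ _)).
rewrite -mulrA -expR_normal_pdf mulrA; apply: le_trans (ler_norm _).
by rewrite ler_wpM2r// normal_pdf_ge0.
Qed.

Lemma continuous_std_pdf : continuous phi.
Proof. by apply: continuous_normal_pdf; exact: oner_neq0. Qed.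

Lemma is_derive_std_pdf x : is_derive x 1 phi (- x * phi x).
Proof.
have -> : phi = (fun y => normal_peak 1 * expR (- (y ^+ 2 / 2))).
  by apply/funext => y; exact: std_normal_pdfE.
have h1 : is_derive x 1 (fun y : R => - (y ^+ 2 / 2)) (- x).
  have -> : (fun y : R => - (y ^+ 2 / 2)) = (fun y => - 2^-1 *: (y ^+ 2)).
    by apply/funext => y; rewrite /GRing.scale/=; ring.
  by apply: is_derive_eq; rewrite /GRing.scale/= !mulr1; field.
have h2 := is_derive1_comp (is_derive_expR _) h1.
have h3 := is_deriveZ (normal_peak 1) h2.
apply: (is_derive_eq h3); rewrite /GRing.scale/=; ring.
Qed.

Lemma cvg_Rintegral_symitv (h : R -> R) : mu.-integrable setT (EFin \o h) ->
  \int[mu]_(x in `[- n%:R, n%:R]) h x @[n --> \oo] --> \int[mu]_x h x.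
Proof.
move=> ih; have /integrableP[/measurable_EFinP mh _] := ih.
have := @dominated_convergence _ _ _ mu setT measurableT
  (fun n => EFin \o (h \_ `[- n%:R, n%:R])) (EFin \o h) (abse \o (EFin \o h)).
case=> //.
- move=> n; apply/measurable_EFinP/(measurable_restrictT _ _).1 => //.
  exact: measurable_funTS.
- exact/measurable_EFinP.
- apply: aeW => x _; apply: cvg_near_cst.
  near=> n; rewrite /= patchE mem_set//= in_itv/= -ler_norml.
  by near: n; exact: nbhs_infty_ger.
- exact: integrable_abse.
- apply: aeW => x n _ /=; rewrite lee_fin patchE.
  by case: ifP; rewrite ?normr0.
move=> _ _ H.
have fin : (\int[mu]_x (h x)%:E)%E \is a fin_num by exact: integrable_fin_num.
have H2 : (\int[mu]_x ((h \_ `[- n%:R, n%:R]) x)%:E)%E @[n --> \oo] --> (\int[mu]_x h x)%:E.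
  by rewrite /Rintegral fineK.
apply: cvg_trans (fine_cvg H2); apply: near_eq_cvg; apply: nearW => n /=.
by rewrite /Rintegral [in RHS]integral_mkcond; congr fine; apply: eq_integral => x _; rewrite !patchE; case: ifP.
Unshelve. all: by end_near. Qed.

Lemma derivable_oo_LRcontinuousT (F f : R -> R) a b :
  (forall x, is_derive x 1 F (f x)) -> derivable_oo_LRcontinuous F a b.
Proof.
move=> dF.
have cF x : F z @[z --> x] --> F x.
  by apply: differentiable_continuous; apply/derivable1_diffP; exact: (@ex_derive _ _ _ _ _ _ _ (dF x)).
split=> [x _||]; first exact: (@ex_derive _ _ _ _ _ _ _ (dF x)).
- exact: cvg_at_right_filter.
- exact: cvg_at_left_filter.
Qed.

(** Integration by parts on [[- n, n]], as [phi] has derivative [- x * phi x]. The boundary terms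
    are of order [1 / n] because [x ^+ 2 * phi x] is bounded. The growth condition on [u] covers
    both the sine and the identity. *)
Lemma stein (u u' : R -> R) (K : R) :
  (forall x, is_derive x 1 u (u' x)) -> continuous u' ->
  (forall x, `|u x| <= 1 + `|x|) -> (forall x, `|u' x| <= K) ->
  \int[mu]_x (x * u x * phi x) = \int[mu]_x (u' x * phi x).
Proof.
move=> du cu' ub u'b.
have cu : continuous u.
  move=> x; apply: differentiable_continuous; apply/derivable1_diffP.
  exact: (@ex_derive _ _ _ _ _ _ _ (du x)).
have mphi := @measurable_normal_pdf R 0 1.
have i1 : mu.-integrable setT (EFin \o (fun x => x * u x * phi x)).
  apply: (@integrable_normal_dom _ 5).
    by apply: measurable_funM => //; exact: continuous_measurable_fun.
  move=> x; rewrite normrM; have := ub x; have := sqr_le_expR_sqr x.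
  rewrite -(real_normK (num_real x)) => h1; have := normr_le_expR_sqr x.
  rewrite -(real_normK (num_real x)) => h2 h3.
  have := ler_wpM2l (normr_ge0 x) h3; lra.
have i2 : mu.-integrable setT (EFin \o (fun x => u' x * phi x)).
  apply: (@integrable_normal_dom _ K); first exact: continuous_measurable_fun.
  move=> x; have := expR_sqr_ge1 x; have := u'b x; have := normr_ge0 (u' x) => h0 h1 h2.
  by apply: le_trans h1 _; rewrite ler_peMr// (le_trans h0).
have parts (n : nat) : (0 < n)%N ->
    \int[mu]_(x in `[- n%:R, n%:R]) (x * u x * phi x) =
    u (- n%:R) * phi (- n%:R) - u n%:R * phi n%:R + \int[mu]_(x in `[- n%:R, n%:R]) (u' x * phi x).
  move=> n0; have nn : - n%:R < n%:R :> R by have : 0 < n%:R :> R; [rewrite ltr0n|lra].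
  have dG x : is_derive x 1 (fun y => - phi y) (x * phi x).
    by have := is_deriveN (is_derive_std_pdf x); rewrite mulNr opprK.
  have cg : continuous (fun x : R => x * phi x).
    by move=> x; apply: cvgM; [exact: cvg_id|exact: continuous_std_pdf].
  have e1 : {in `]- n%:R, n%:R[, u^`()%classic =1 u'}.
    by move=> x _; rewrite derive1E; exact: (@derive_val _ _ _ _ _ _ _ (du x)).
  have e2 : {in `]- n%:R, n%:R[, (fun y => - phi y)^`()%classic =1 (fun x => x * phi x)}.
    by move=> x _; rewrite derive1E; exact: (@derive_val _ _ _ _ _ _ _ (dG x)).
  have := @Rintegration_by_parts R u (fun y => - phi y) u' (fun x => x * phi x) _ _ nn
    (continuous_subspaceT cu') (derivable_oo_LRcontinuousT _ _ du) e1
    (continuous_subspaceT cg) (derivable_oo_LRcontinuousT _ _ dG) e2.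
  rewrite (_ : (fun x => u x * (x * phi x)) = (fun x => x * u x * phi x)); last first.
    by apply/funext => x; ring.
  move=> ->.
  rewrite (_ : (fun x => u' x * - phi x) = (fun x => -1 * (u' x * phi x))); last first.
    by apply/funext => x; ring.
  rewrite RintegralZl//; first by ring.
  exact: integrableS i2.
(* The factor 8 is the 4 of [sqr_le_expR_sqr] times the bound 2 for the [Num.sqrt 2] of
   [expR_normal_pdf]. *)
pose K0 := 8 * normal_peak (Num.sqrt 2 : R).
have K0_ge0 : 0 <= K0 by rewrite mulr_ge0// normal_peak_ge0.
have bnd (n : nat) x : (0 < n)%N -> `|x| = n%:R -> `|u x * phi x| <= 4 * K0 * n%:R^-1.
  move=> n0 xn.
  have n1 : 1 <= n%:R :> R by rewrite ler1n.
  have s2 : 0 <= Num.sqrt (2 : R) <= 2.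
    rewrite sqrtr_ge0/= -[leRHS]ger0_norm// -sqrtr_sqr ler_sqrt//; lra.
  have h1 : n%:R ^+ 2 * phi x <= K0.
    rewrite -xn real_normK ?num_real//.
    apply: (@le_trans _ _ (4 * expR (x ^+ 2 / 4) * phi x)).
      by rewrite ler_wpM2r ?normal_pdf_ge0// sqr_le_expR_sqr.
    rewrite -mulrA expR_normal_pdf /K0.
    have := @normal_pdf_ub R 0 (Num.sqrt 2) x (lt0r_neq0 (_ : 0 < Num.sqrt 2)).
    rewrite sqrtr_gt0 ltr0n => /(_ isT) h; move/andP: s2 => [s20 s22].
    have p0 := normal_pdf_ge0 0 (Num.sqrt 2) x.
    have p1 := normal_peak_ge0 (Num.sqrt 2 : R); nra.
  rewrite normrM (ger0_norm (normal_pdf_ge0 _ _ _)).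
  rewrite ler_pdivlMr ?ltr0n//.
  have := ub x; rewrite xn => hu; have p0 := normal_pdf_ge0 0 1 x.
  have hn : n%:R ^+ 2 = n%:R * n%:R :> R by rewrite expr2.
  apply: (@le_trans _ _ ((1 + n%:R) * phi x * n%:R)).
    by rewrite ler_wpM2r// ler_wpM2r.
  nra.
have c1 := cvg_Rintegral_symitv i1; have c2 := cvg_Rintegral_symitv i2.
have b1 : u (- n%:R) * phi (- n%:R) - u n%:R * phi n%:R @[n --> \oo] --> (0 : R).
  have z : 8 * K0 * n%:R^-1 @[n --> \oo] --> (0 : R).
    rewrite -[X in _ --> X](mulr0 (8 * K0)); apply: cvgM; first exact: cvg_cst.
    by apply/gtr0_cvgV0; [near=> n; rewrite ltr0n; near: n; exact: nbhs_infty_gt|exact: cvgr_idn].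
  apply: norm_cvg0; apply: (@squeeze_cvgr _ _ _ _ (fun=> 0) _ _ _ _ (cvg_cst _) z).
  near=> n; rewrite normr_ge0/=.
  have n0 : (0 < n)%N by near: n; exact: nbhs_infty_gt.
  apply: le_trans (ler_normB _ _) _.
  have := @bnd n n%:R n0 (normr_nat _ _); have := @bnd n (- n%:R) n0; rewrite normrN normr_nat => /(_ erefl).
  lra.
have c3 : u (- n%:R) * phi (- n%:R) - u n%:R * phi n%:R +
    \int[mu]_(x in `[- n%:R, n%:R]) (u' x * phi x) @[n --> \oo] --> \int[mu]_x (u' x * phi x).
  by rewrite -[X in _ --> X]add0r; exact: cvgD.
apply: (cvg_unique _ c1); first exact: norm_hausdorff.
apply: cvg_trans c3; apply: near_eq_cvg; near=> n.
by apply/esym/parts; near: n; exact: nbhs_infty_gt.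
Unshelve. all: by end_near. Qed.

Lemma std_pdf_integral1 : \int[mu]_x phi x = 1.
Proof. by rewrite /Rintegral integral_normal_pdf. Qed.

Definition std_char l : R := \int[mu]_x (cos (l * x) * phi x).

(** Differentiation under the integral produces minus the integral of [x * sin (l * x) * phi x], and
    [stein] for the sine brings back the cosine. *)
Lemma is_derive_std_char l : is_derive l 1 std_char (- l * std_char l).
Proof.
have mphi := @measurable_normal_pdf R 0 1.
pose f (l x : R) : R := cos (l * x) * phi x.
have df (a x : R) : is_derive a 1 (f ^~ x) (- x * sin (a * x) * phi x).
  have h1 : is_derive a 1 (fun a : R => a * x) x.
    have -> : (fun a : R => a * x) = (fun a => x *: a) by apply/funext => b; rewrite /GRing.scale/= mulrC.
    by apply: is_derive_eq; rewrite /GRing.scale/= mulr1.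
  have h2 := is_derive1_comp (is_derive_cos _) h1.
  have h3 := is_deriveZ (phi x) h2.
  have -> : f ^~ x = phi x *: (cos \o (fun a : R => a * x)).
    by apply/funext => b; rewrite /f /= mulrC.
  by apply: (is_derive_eq h3); rewrite /GRing.scale/=; ring.
have d1f a x : partial1of2 f a x = - x * sin (a * x) * phi x.
  by rewrite partial1of2E; exact: (@derive_val _ _ _ _ _ _ _ (df a x)).
have la : (`]l - 1, l + 1[%classic : set R) l by rewrite /= in_itv/=; lra.
have mcos a : measurable_fun setT (fun x : R => cos (a * x)).
  by have [] := @bmeas_cos _ _ _ (fun x : R => a * x) (measurable_funM (measurable_cst _) (@measurable_id _ _ _)).
have intf (a : R) : mu.-integrable setT (EFin \o f a).
  apply: (@integrable_normal_dom _ 1) => // x.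
  by rewrite mul1r (le_trans (cos_max _))// expR_sqr_ge1.
have G0 x : 0 <= `|x| * phi x by rewrite mulr_ge0// normal_pdf_ge0.
have intG : mu.-integrable setT (EFin \o (fun x : R => `|x| * phi x)).
  apply: (@integrable_normal_dom _ 1) => [|x]; first exact: normr_measurable.
  by rewrite normr_id mul1r normr_le_expR_sqr.
have Gub (a x : R) : `|partial1of2 f a x| <= `|x| * phi x.
  rewrite d1f !normrM normrN (ger0_norm (normal_pdf_ge0 _ _ _)) ler_wpM2r ?normal_pdf_ge0//.
  by rewrite ler_piMr// sin_max.
have D := @derivable_under_integral _ _ _ mu f setT measurableT l _ _ la
   (fun a _ => intf a) (fun a x _ _ => @ex_derive _ _ _ _ _ _ _ (df a x)) _ G0 intG
   (fun a x _ _ => Gub a x).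
have V := @differentiation_under_integral _ _ _ mu f setT measurableT l _ _ la
   (fun a _ => intf a) (fun a x _ _ => @ex_derive _ _ _ _ _ _ _ (df a x)) _ G0 intG
   (fun a x _ _ => Gub a x).
apply: DeriveDef; first exact: D.
rewrite -derive1E V.
have ds x : is_derive x 1 (fun x => sin (l * x)) (l * cos (l * x)).
  have h1 : is_derive x 1 (fun a : R => l * a) l.
    have -> : (fun a : R => l * a) = (fun a => l *: a) by [].
    by apply: is_derive_eq; rewrite /GRing.scale/= mulr1.
  have h2 := is_derive1_comp (is_derive_sin _) h1.
  by apply: (is_derive_eq h2); ring.
have cl : continuous (fun x : R => l * cos (l * x)).
  move=> x; apply: cvgM; first exact: cvg_cst.
  apply: (@continuous_comp _ _ _ (fun x : R => l * x) cos); last exact: continuous_cos.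
  by apply: cvgM; [exact: cvg_cst|exact: cvg_id].
have := @stein (fun x => sin (l * x)) (fun x => l * cos (l * x)) `|l| ds cl _ _.
rewrite (_ : (fun x => partial1of2 f l x) = (fun x => -1 * (x * sin (l * x) * phi x))); last first.
  by apply/funext => x; rewrite d1f; ring.
rewrite RintegralZl//; last first.
  apply: (@integrable_normal_dom _ 1) => [|x].
    apply: measurable_funM => //.
    by have [] := @bmeas_sin _ _ _ (fun x : R => l * x) (measurable_funM (measurable_cst _) (@measurable_id _ _ _)).
  rewrite mul1r normrM; apply: le_trans (normr_le_expR_sqr x).
  by rewrite ler_piMr// sin_max.
move=> ->.
- rewrite (_ : (fun x => l * cos (l * x) * phi x) = (fun x => l * (cos (l * x) * phi x))); last first.
    by apply/funext => x; ring.
  by rewrite RintegralZl//; [rewrite mulN1r mulNr|exact: intf].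
- by move=> x; apply: le_trans (sin_max _) _; rewrite lerDl.
- by move=> x; rewrite normrM ler_piMr// cos_max.
Qed.

(** The differential equation makes [h] constant, and [h 0] is the total mass 1. *)
Lemma std_charE l : std_char l = expR (- (l ^+ 2 / 2)).
Proof.
pose h (a : R) := std_char a * expR (a ^+ 2 / 2).
have dh (a : R) : is_derive a 1 h 0.
  have h1 : is_derive a 1 (fun y : R => y ^+ 2 / 2) a.
    have -> : (fun y : R => y ^+ 2 / 2) = (fun y => 2^-1 *: (y ^+ 2)).
      by apply/funext => y; rewrite /GRing.scale/= mulrC.
    by apply: is_derive_eq; rewrite /GRing.scale/= !mulr1; field.
  have h2 := is_derive1_comp (is_derive_expR _) h1.
  have h3 := is_deriveM (is_derive_std_char a) h2.
  by apply: (is_derive_eq h3); rewrite /GRing.scale/=; ring.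
have := is_derive_0_is_cst l 0 dh.
rewrite /h expr0n/= mul0r expR0 mulr1 {2}/std_char.
under [X in _ = X -> _]eq_Rintegral do rewrite mul0r cos0 mul1r.
rewrite std_pdf_integral1 => e.
by rewrite expRN -[LHS](mulfK (x := expR (l ^+ 2 / 2))) ?e ?mul1r// gt_eqF// expR_gt0.
Qed.

End normal_moments.

(** * Cosine, sine and second moments of centred Gaussian variables *)

Section gaussian_variables.
Context {R : realType}.
Local Notation mu := (@lebesgue_measure R).
Local Notation phi := (@normal_pdf R 0 1).

Lemma ge0_integral_reflect (f : R -> \bar R) : measurable_fun setT f ->
  (forall x, 0 <= f x)%E -> (\int[mu]_x f x = \int[mu]_x f (- x)%R)%E.
Proof.
move=> mf f0.
have mN : measurable_fun setT (-%R : measurableTypeR R -> measurableTypeR R) by [].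
pose N := HB.pack_for {mfun measurableTypeR R >-> measurableTypeR R} (-%R : R -> R)
  (isMeasurableFun.Build _ _ _ _ _ mN).
apply: (@ge0_integral_image _ _ _ _ _ mu mu N f) => // A mA.
exact: (esym (lebesgue_measureN mA)).
Qed.

Lemma measurable_mulr (l : R) : measurable_fun setT (fun x : R => l * x).
Proof. exact: measurable_funM. Qed.

Lemma Ex_N01_density (g : R -> R) : measurable_fun setT g -> (forall x, `|g x| <= 1) ->
  Ex N01 g = \int[mu]_x (g x * phi x).
Proof.
move=> mg g1.
have bg : @bmeas R _ (measurableTypeR R) g by split => //; exists 1.
have ig : mu.-integrable setT (EFin \o (fun x => g x * phi x)).
  apply: (@integrable_normal_dom _ _ 1) => // x; apply: le_trans (g1 x) _.
  by rewrite mul1r expR_sqr_ge1.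
have ip : mu.-integrable setT (EFin \o phi) by exact: integrable_normal_pdf.
(* The density formula is for nonnegative integrands; [g] is shifted by 1, and the shift is
   cancelled at the end. *)
have E : (\int[N01]_x (1 + g x)%:E = \int[mu]_x ((1 + g x)%:E * (phi x)%:E))%E.
  apply: (@ge0_integral_normal R 1 (fun x => (1 + g x)%:E)).
    by apply/measurable_EFinP; exact: measurable_funD.
  by move=> x; rewrite lee_fin; have := g1 x; rewrite ler_norml; lra.
have E1 : Ex N01 (fun x => 1 + g x) = 1 + Ex N01 g.
  rewrite ExD ?Ex_cst//; apply: bmeas_integrable => //; exact: bmeas_cst.
have E2 : fine (\int[mu]_x ((1 + g x)%:E * (phi x)%:E)) = 1 + \int[mu]_x (g x * phi x).
  transitivity (\int[mu]_x phi x + \int[mu]_x (g x * phi x)); last by rewrite std_pdf_integral1.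
  rewrite -RintegralD// /Rintegral; congr fine.
  by apply: eq_integral => x _; rewrite -EFinM mulrDl mul1r.
by move: E1; rewrite {1}/Ex E E2 => /addrI.
Qed.

Lemma Ex_N01_cos (l : R) : Ex N01 (fun x => cos (l * x)) = expR (- (l ^+ 2 / 2)).
Proof.
rewrite Ex_N01_density; [exact: std_charE| |by move=> x; exact: cos_max].
by have [] := @bmeas_cos _ _ _ (fun x : R => l * x) (measurable_mulr l).
Qed.

(** The density is even, so reflection identifies the expectation with its opposite; adding 1 keeps
    the integrands nonnegative. *)
Lemma Ex_N01_sin (l : R) : Ex N01 (fun x => sin (l * x)) = 0.
Proof.
have ms (a : R) : measurable_fun setT (fun x : R => sin (a * x)).
  by have [] := @bmeas_sin _ _ _ (fun x : R => a * x) (measurable_mulr a).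
have bs (a : R) : @bmeas R _ (measurableTypeR R) (fun x => sin (a * x)).
  by split; [exact: ms|exists 1 => x; exact: sin_max].
have s0 (a x : R) : (0 <= (1 + sin (a * x))%:E)%E.
  by rewrite lee_fin; have := sin_geN1 (a * x); lra.
have m1 (a : R) : measurable_fun setT (fun x : R => (1 + sin (a * x))%:E).
  by apply/measurable_EFinP; exact: measurable_funD.
have E : (\int[N01]_x (1 + sin (l * x))%:E = \int[N01]_x (1 + sin (- l * x))%:E)%E.
  rewrite (@ge0_integral_normal R 1 _ (m1 l) (s0 l)).
  rewrite (@ge0_integral_normal R 1 _ (m1 (- l)) (s0 (- l))).
  rewrite ge0_integral_reflect.
  - apply: eq_integral => x _; rewrite mulrN mulNr; congr (_ * _%:E)%E.
    by rewrite !std_normal_pdfE sqrrN.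
  - apply: emeasurable_funM; first exact: m1.
    by apply/measurable_EFinP; exact: measurable_normal_pdf.
  - by move=> x; rewrite mule_ge0// ?s0// lee_fin normal_pdf_ge0.
have : Ex N01 (fun x => 1 + sin (l * x)) = Ex N01 (fun x => 1 + sin (- l * x)).
  by rewrite /Ex E.
rewrite !ExD; [|exact/bmeas_integrable/bmeas_cst|exact/bmeas_integrable/bs
               |exact/bmeas_integrable/bmeas_cst|exact/bmeas_integrable/bs].
rewrite (_ : (fun x => sin (- l * x)) = (fun x => -1 * sin (l * x))); last first.
  by apply/funext => x; rewrite mulN1r mulNr sinN.
rewrite ExZ; last exact/bmeas_integrable/bs.
by move=> /addrI; lra.
Qed.

Lemma integral_N01_sqr : (\int[N01]_x ((x : R) ^+ 2)%:E = 1)%E.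
Proof.
rewrite (@ge0_integral_normal R 1 (fun x => (x ^+ 2)%:E)); last 2 first.
- by apply/measurable_EFinP; exact: measurable_funX.
- by move=> x; rewrite lee_fin sqr_ge0.
have i2 : mu.-integrable setT (EFin \o (fun x : R => x ^+ 2 * phi x)).
  apply: (@integrable_normal_dom _ _ 4); first exact: measurable_funX.
  by move=> x; rewrite ger0_norm ?sqr_ge0// sqr_le_expR_sqr.
have := @stein R id (fun=> 1) 1 _ _ _ _.
under eq_integral do rewrite -EFinM.
move=> H; rewrite -(fineK (integrable_fin_num measurableT i2)); congr EFin.
have {}H := H _ _ _ _.
transitivity (\int[mu]_x (x * x * phi x)).
  by congr fine; apply: eq_integral => x _; rewrite expr2.
rewrite H.
- by under eq_Rintegral do rewrite mul1r; exact: std_pdf_integral1.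
- by move=> x; exact: cvg_cst.
- by move=> x; rewrite lerDr.
- by move=> x; rewrite normr1.
Qed.

Context d (Om : measurableType d) (Q : probability Om R).

Lemma gauss_law_sqr X s : gauss_law Q X s -> (\int[Q]_w (X w ^+ 2)%:E = (s ^+ 2)%:E)%E.
Proof.
move=> [mX s0 /(_ (fun x => (x ^+ 2)%:E))->]; last 2 first.
- by apply/measurable_EFinP; exact: measurable_funX.
- by move=> x; rewrite lee_fin sqr_ge0.
under eq_integral do rewrite exprMn EFinM.
rewrite ge0_integralZl//.
- by rewrite integral_N01_sqr mule1.
- by apply/measurable_EFinP; exact: measurable_funX.
- by move=> x _; rewrite lee_fin sqr_ge0.
- by rewrite lee_fin sqr_ge0.
Qed.

Lemma gauss_law_Ex_sqr X s : gauss_law Q X s -> Ex Q (fun w => X w ^+ 2) = s ^+ 2.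
Proof. by move=> g; rewrite /Ex (gauss_law_sqr g). Qed.

Lemma gauss_law_integrable_sqr X s : gauss_law Q X s ->
  Q.-integrable setT (EFin \o (fun w => X w ^+ 2)).
Proof.
move=> g; have [mX _ _] := g; apply/integrableP; split.
  by apply/measurable_EFinP; exact: measurable_funX.
under eq_integral do rewrite /= ger0_norm ?sqr_ge0//.
by rewrite (gauss_law_sqr g) ltry.
Qed.

Lemma gauss_law_Ex X s (g : R -> R) : gauss_law Q X s -> bmeas g ->
  Ex Q (fun w => g (X w)) = Ex N01 (fun x => g (s * x)).
Proof.
move=> [mX s0 H] [mg [M gM]].
have b1 : bmeas (fun w => g (X w)) by split; [exact: measurableT_comp|exists M].
have b2 : @bmeas R _ (measurableTypeR R) (fun x => g (s * x)).
  split; last by exists M.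
  exact: (measurableT_comp mg (measurable_mulr s)).
have : Ex Q (fun w => M + g (X w)) = Ex N01 (fun x => M + g (s * x)).
  rewrite /Ex (H (fun x => (M + g x)%:E))//.
    by apply/measurable_EFinP; exact: measurable_funD.
  by move=> x; rewrite lee_fin; have := gM x; rewrite ler_norml; lra.
rewrite !ExD; [|exact/bmeas_integrable/bmeas_cst|exact/bmeas_integrable
               |exact/bmeas_integrable/bmeas_cst|exact/bmeas_integrable].
by rewrite !Ex_cst => /addrI.
Qed.

(** The variance is kept as a second moment: for linear combinations it is a quadratic form in the
    coefficients, to which the parallelogram identity applies. *)
Lemma gauss_law_cos X s : gauss_law Q X s ->
  Ex Q (fun w => cos (X w)) = expR (- (Ex Q (fun w => X w ^+ 2) / 2)).
Proof.
move=> g; rewrite (gauss_law_Ex_sqr g) -Ex_N01_cos (gauss_law_Ex (g := cos) g)//.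
by apply: (@bmeas_cos _ _ _ (fun x : R => x)).
Qed.

Lemma gauss_law_sin X s : gauss_law Q X s -> Ex Q (fun w => sin (X w)) = 0.
Proof.
move=> g; rewrite (gauss_law_Ex (g := sin) g) ?Ex_N01_sin//.
by apply: (@bmeas_sin _ _ _ (fun x : R => x)).
Qed.

End gaussian_variables.

(** * Fernique's theorem *)

Section gaussian_sequence.
Context {R : realType} d (Om : measurableType d) (Q : probability Om R).
Variable G : nat -> Om -> R.
Hypothesis mG : forall i, measurable_fun setT (G i).
Hypothesis gG : forall k (a : nat -> R),
  exists s, gauss_law Q (fun w => \sum_(i < k) a i * G i w) s.

Let Z := (Om * Om)%type.
Let mu : probability Z R := (Q \x Q)%E.
Let r2 : R := (Num.sqrt 2)^-1.
Let L k (a : nat -> R) w := \sum_(i < k) a i * G i w.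
Let A i (w : Z) : R := r2 * (G i w.1 - G i w.2).
Let B i (w : Z) : R := r2 * (G i w.1 + G i w.2).

Let mL k a : measurable_fun setT (L k a).
Proof. exact: measurable_lincomb. Qed.

Let mfst i : measurable_fun setT (fun w : Z => G i w.1).
Proof. exact: measurableT_comp. Qed.

Let msnd i : measurable_fun setT (fun w : Z => G i w.2).
Proof. exact: measurableT_comp. Qed.

Let mA i : measurable_fun setT (A i).
Proof. by apply: measurable_funM => //; exact: measurable_funB. Qed.

Let mB i : measurable_fun setT (B i).
Proof. by apply: measurable_funM => //; exact: measurable_funD. Qed.

Let r2r2 : r2 * r2 = 2^-1.
Proof. by rewrite -invfM -expr2 sqr_sqrtr. Qed.

Let cos_pair k (a b : nat -> R) : Ex mu (fun w => cos (L k a w.1 + L k b w.2)) =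
  expR (- ((Ex Q (fun w => L k a w ^+ 2) + Ex Q (fun w => L k b w ^+ 2)) / 2)).
Proof.
have [sa ga] := gG k a; have [sb gb] := gG k b.
have bc c : bmeas (fun w => cos (L k c w)) by exact: bmeas_cos.
have bs c : bmeas (fun w => sin (L k c w)) by exact: bmeas_sin.
rewrite (_ : (fun w : Z => _) = (fun w : Z => cos (L k a w.1) * cos (L k b w.2) +
    (-1) * (sin (L k a w.1) * sin (L k b w.2)))); last first.
  by apply/funext => w; rewrite cosD; ring.
have b1 : bmeas (fun w : Z => cos (L k a w.1) * cos (L k b w.2)).
  by apply: bmeasM; [exact: (bmeas_fst (bc a))|exact: (bmeas_snd (bc b))].
have b2 : bmeas (fun w : Z => sin (L k a w.1) * sin (L k b w.2)).
  by apply: bmeasM; [exact: (bmeas_fst (bs a))|exact: (bmeas_snd (bs b))].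
rewrite ExD; [|exact: bmeas_integrable|exact/bmeas_integrable/bmeasZ].
rewrite ExZ; last exact: bmeas_integrable.
rewrite (Ex_prod Q (bc a) (bc b)) (Ex_prod Q (bs a) (bs b)).
rewrite (gauss_law_cos ga) (gauss_law_cos gb) (gauss_law_sin ga) mul0r mulr0 addr0.
by rewrite -expRD; congr expR; rewrite /L; ring.
Qed.

(** [c] and [e] are the rotated coefficients. By the parallelogram identity the variances of the two
    independent parts have the same sum before and after the rotation. *)
Let rotation k (a b : nat -> R) :
  Ex mu (fun w => cos (\sum_(i < k) a i * A i w + \sum_(i < k) b i * B i w)) =
  Ex mu (fun w => cos (\sum_(i < k) a i * G i w.1 + \sum_(i < k) b i * G i w.2)).
Proof.
pose c i := r2 * (a i + b i); pose e i := r2 * (b i - a i).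
rewrite (_ : (fun w => cos (\sum_(i < k) a i * A i w + _)) =
    (fun w : Z => cos (L k c w.1 + L k e w.2))); last first.
  apply/funext => w; congr cos; rewrite /L -!big_split; apply: eq_bigr => i _.
  by rewrite /A /B /c /e /=; ring.
rewrite cos_pair -[RHS]/(Ex mu (fun w => cos (L k a w.1 + L k b w.2))) cos_pair.
have isq f : Q.-integrable setT (EFin \o (fun w => L k f w ^+ 2)).
  by have [s gs] := gG k f; exact: gauss_law_integrable_sqr gs.
rewrite -!ExD//; congr expR; congr (- (_ / _)); apply: eq_Ex => w.
have -> : L k c w = r2 * (L k a w + L k b w).
  by rewrite /L -big_split big_distrr; apply: eq_bigr => i _; rewrite /c /=; ring.
have -> : L k e w = r2 * (L k b w - L k a w).
  by rewrite /L -sumrB big_distrr; apply: eq_bigr => i _; rewrite /e /=; ring.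
rewrite !exprMn (_ : r2 ^+ 2 = 2^-1); first by field.
by rewrite expr2.
Qed.

Definition box (V : Type) k (x : nat -> V -> R) (s : R) (w : V) : R :=
  \prod_(i < k) (`|x i w| <= s)%R%:R.

Lemma box_le1 (V : Type) k (x : nat -> V -> R) s w : 0 <= box k x s w <= 1.
Proof.
rewrite /box; apply/andP; split; first by apply: prodr_ge0.
by apply: prodr_ile1 => i _; rewrite ler0n lern1 leq_b1.
Qed.

Lemma boxE (V : Type) k (x : nat -> V -> R) s w :
  box k x s w = [forall i : 'I_k, `|x i w| <= s]%:R.
Proof.
rewrite /box; case: forallP => [h|h]; first by apply: big1 => i _; rewrite h.
have [i hi] : exists i : 'I_k, ~~ (`|x i w| <= s)%R.
  by apply/existsP; rewrite -negb_forall; apply/forallP.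
by rewrite (bigD1 i)//= (negbTE hi) mul0r.
Qed.

Lemma bmeas_box d' (V : measurableType d') k (x : nat -> V -> R) s :
  (forall i, measurable_fun setT (x i)) -> bmeas (box k x s).
Proof.
move=> mx; split; last first.
  by exists 1 => w; have /andP[h1 h2] := box_le1 k x s w; rewrite ger0_norm.
elim: k => [|k ih].
  by rewrite /box; under eq_fun do rewrite big_ord0; exact: measurable_cst.
rewrite /box; under eq_fun do rewrite big_ord_recr/=; apply: measurable_funM => //.
have -> : (fun z => (`|x k z| <= s)%R%:R : R) = \1_(x k @^-1` `[- s, s]).
  apply/funext => z; rewrite indicE; congr (nat_of_bool _)%:R.
  by apply/idP/idP; rewrite inE /= in_itv/= -ler_norml.
by apply: measurable_indic; rewrite -[X in measurable X]setTI; exact: mx.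
Qed.

(** Boxes are reached one family at a time: here [A], with a cosine in [B] as weight; [box_pair]
    then treats [B] with the box of [A] as weight. *)
Let box_cos k (b : nat -> R) s : 0 < s ->
  Ex mu (fun w => cos (\sum_(i < k) b i * B i w) * box k A s w) =
  Ex mu (fun w => cos (\sum_(i < k) b i * G i w.2) * box k G s w.1).
Proof.
move=> s0.
apply: (@cramer_wold_box _ _ _ mu A (fun i w => G i w.1) s k mA mfst s0).
- exact/bmeas_cos/measurable_lincomb.
- by apply: bmeas_cos; apply: (@measurable_lincomb _ _ _ (fun i w => G i w.2) b k msnd).
move=> a.
have key (x y : nat -> Z -> R) : (forall i, measurable_fun setT (x i)) ->
    (forall i, measurable_fun setT (y i)) ->
    Ex mu (fun w => cos (\sum_(i < k) b i * y i w) * cos (\sum_(i < k) a i * x i w)) =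
    2^-1 * Ex mu (fun w => cos (\sum_(i < k) a i * x i w + \sum_(i < k) b i * y i w)) +
    2^-1 * Ex mu (fun w => cos (\sum_(i < k) a i * x i w + \sum_(i < k) - b i * y i w)).
  move=> mx my.
  have bb (c : nat -> R) : bmeas (fun w => cos (\sum_(i < k) a i * x i w + \sum_(i < k) c i * y i w)).
    by apply: bmeas_cos; apply: measurable_funD; exact: measurable_lincomb.
  have b1 := bb b; have b2 := bb (fun i => - b i).
  rewrite -(ExZ _ (bmeas_integrable mu b1)) -(ExZ _ (bmeas_integrable mu b2)).
  rewrite -(ExD (bmeas_integrable mu (bmeasZ _ b1)) (bmeas_integrable mu (bmeasZ _ b2))).
  apply: eq_Ex => w.
  have -> : \sum_(i < k) - b i * y i w = - \sum_(i < k) b i * y i w.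
    by rewrite -sumrN; apply: eq_bigr => i _; rewrite mulNr.
  by rewrite cosD cosB; field.
rewrite (key A B mA mB) (key (fun i w => G i w.1) (fun i w => G i w.2) mfst msnd).
by rewrite rotation (rotation k a (fun i => - b i)).
Qed.

Let box_pair k s t : 0 < s -> 0 < t ->
  Ex mu (fun w => box k A s w * box k B t w) = Ex Q (box k G s) * Ex Q (box k G t).
Proof.
move=> s0 t0; rewrite -(Ex_prod Q (bmeas_box k s mG) (bmeas_box k t mG)).
apply: (@cramer_wold_box _ _ _ mu B (fun i w => G i w.2) t k mB msnd t0).
- exact: bmeas_box.
- exact: (bmeas_fst (bmeas_box k s mG)).
move=> b; rewrite (_ : Ex mu _ = Ex mu (fun w => cos (\sum_(i < k) b i * B i w) * box k A s w)).
  by rewrite box_cos//; apply: eq_Ex => w; rewrite mulrC.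
by apply: eq_Ex => w; rewrite mulrC.
Qed.

Let box_A k s : 0 < s -> Ex mu (box k A s) = Ex Q (box k G s).
Proof.
move=> s0; rewrite -(Ex_diag_fst Q (bmeas_box k s mG)).
have := @box_cos k (fun=> 0) s s0; congr (_ = _); apply: eq_Ex => w;
  by rewrite big1 ?cos0 ?mul1r// => i _; rewrite mul0r.
Qed.

(** The left side is the mass of the pairs with every [A i] at most [s] and some [B i] above [t] in
    absolute value. For that [i], the values of [G i] at the two independent points are [A i + B i]
    and [B i - A i] divided by the root of 2, and both exceed the threshold. *)
Lemma fernique_box k s t : 0 < s -> 0 < t ->
  Ex Q (box k G s) * (1 - Ex Q (box k G t)) <=
  (1 - Ex Q (box k G ((t - s) / Num.sqrt 2))) ^+ 2.
Proof.
move=> s0 t0; set u := (t - s) / _.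
have bA := bmeas_box k s mA; have bB := bmeas_box k t mB.
have bG := bmeas_box k u mG.
have bN : bmeas (fun w => 1 + (-1) * box k G u w).
  by apply: bmeasD; [exact: bmeas_cst|exact: bmeasZ].
have EN : Ex Q (fun w => 1 + (-1) * box k G u w) = 1 - Ex Q (box k G u).
  rewrite ExD; [|exact/bmeas_integrable/bmeas_cst|exact/bmeas_integrable/bmeasZ].
  by rewrite Ex_cst ExZ ?mulN1r//; exact: bmeas_integrable.
rewrite -EN expr2 -(Ex_prod Q bN bN).
have -> : Ex Q (box k G s) * (1 - Ex Q (box k G t)) =
    Ex mu (fun w => box k A s w + (-1) * (box k A s w * box k B t w)).
  rewrite ExD; [|exact: bmeas_integrable|exact/bmeas_integrable/bmeasZ/bmeasM].
  rewrite ExZ; last exact/bmeas_integrable/bmeasM.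
  by rewrite box_pair// box_A//; ring.
apply: le_Ex.
- by apply: bmeas_integrable; apply: bmeasD => //; exact/bmeasZ/bmeasM.
- by apply: bmeas_integrable; apply: bmeasM; [exact: (bmeas_fst bN)|exact: (bmeas_snd bN)].
move=> w.
have /andP[a0 a1] := box_le1 k A s w; have /andP[b0 b1] := box_le1 k B t w.
have /andP[c0 c1] := box_le1 k G u w.1; have /andP[e0 e1] := box_le1 k G u w.2.
have [hA|hA] := boolP [forall i : 'I_k, `|A i w| <= s]; last first.
  by rewrite !(boxE k A) (negbTE hA) mul0r mulr0 addr0; apply: mulr_ge0; lra.
have [hB|hB] := boolP [forall i : 'I_k, `|B i w| <= t].
  by rewrite !(boxE k A) !(boxE k B) hA hB mulr1 mulN1r subrr; apply: mulr_ge0; lra.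
move: hB; rewrite negb_forall => /existsP[i]; rewrite -ltNge => hi.
have hAi : `|A i w| <= s by move/forallP: hA.
have s2 : 0 < Num.sqrt 2 :> R by rewrite sqrtr_gt0.
have G1 : u < `|G i w.1|.
  have -> : G i w.1 = r2 * (A i w + B i w).
    have -> : r2 * (A i w + B i w) = r2 * r2 * (2 * G i w.1) by rewrite /A /B; ring.
    by rewrite r2r2 mulrA mulVf ?mul1r.
  rewrite /u mulrC normrM (gtr0_norm (_ : 0 < r2)) ?invr_gt0// ltr_pM2l ?invr_gt0//.
  by have := ler_normB (A i w + B i w) (A i w); rewrite addrAC subrr add0r; lra.
have G2 : u < `|G i w.2|.
  have -> : G i w.2 = r2 * (B i w - A i w).
    have -> : r2 * (B i w - A i w) = r2 * r2 * (2 * G i w.2) by rewrite /A /B; ring.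
    by rewrite r2r2 mulrA mulVf ?mul1r.
  rewrite /u mulrC normrM (gtr0_norm (_ : 0 < r2)) ?invr_gt0// ltr_pM2l ?invr_gt0//.
  by have := ler_normD (B i w - A i w) (A i w); rewrite subrK; lra.
have n1 : [forall j : 'I_k, `|G j w.1| <= u] = false.
  by apply/negbTE; rewrite negb_forall; apply/existsP; exists i; rewrite -ltNge.
have n2 : [forall j : 'I_k, `|G j w.2| <= u] = false.
  by apply/negbTE; rewrite negb_forall; apply/existsP; exists i; rewrite -ltNge.
rewrite (boxE k G u w.1) (boxE k G u w.2) n1 n2 mulr0 addr0 mulr1.
by have := mulr_ge0 a0 b0; lra.
Qed.

Variable X : Om -> R.
Hypothesis XG : forall w (s : R), (X w <= s) <-> (forall i, `|G i w| <= s).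

Lemma cvg_Ex_box s : Ex Q (box k G s) @[k --> \oo] --> Ex Q (fun w => (X w <= s)%R%:R).
Proof.
apply: (@Ex_cvg _ _ _ _ _ _ 1).
- by move=> k; have [] := bmeas_box k s mG.
- by move=> k w; have /andP[h0 h1] := box_le1 k G s w; rewrite ger0_norm.
move=> w; apply: cvg_near_cst; have [h|h] := boolP (X w <= s).
  apply: nearW => k; rewrite boxE; congr (nat_of_bool _)%:R; apply/forallP => i.
  exact: (XG w s).1.
have [i hi] : exists i, ~~ (`|G i w| <= s).
  apply/not_existsP => H; move/negP: h; apply; apply/XG => i.
  by apply/negPn/negP => hi; exact: (H i).
near=> k; rewrite boxE; congr (nat_of_bool _)%:R.
have ik : (i < k)%N by near: k; exact: nbhs_infty_gt.
by apply/negbTE; rewrite negb_forall; apply/existsP; exists (Ordinal ik).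
Unshelve. all: by end_near. Qed.

Lemma fernique_inequality s t : 0 < s -> 0 < t ->
  Ex Q (fun w => (X w <= s)%R%:R) * (1 - Ex Q (fun w => (X w <= t)%R%:R)) <=
  (1 - Ex Q (fun w => (X w <= (t - s) / Num.sqrt 2)%R%:R)) ^+ 2.
Proof.
move=> s0 t0.
have c1 : Ex Q (box k G s) * (1 - Ex Q (box k G t)) @[k --> \oo] -->
    Ex Q (fun w => (X w <= s)%R%:R) * (1 - Ex Q (fun w => (X w <= t)%R%:R)).
  apply: cvgM; first exact: cvg_Ex_box.
  by apply: cvgB; [exact: cvg_cst|exact: cvg_Ex_box].
have c2 u : 1 - Ex Q (box k G u) @[k --> \oo] --> 1 - Ex Q (fun w => (X w <= u)%R%:R).
  by apply: cvgB; [exact: cvg_cst|exact: cvg_Ex_box].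
have c3 u : (1 - Ex Q (box k G u)) * (1 - Ex Q (box k G u)) @[k --> \oo] -->
    (1 - Ex Q (fun w => (X w <= u)%R%:R)) * (1 - Ex Q (fun w => (X w <= u)%R%:R)).
  by apply: cvgM; exact: c2.
rewrite expr2; apply: (ler_cvg_to c1 (c3 _)).
by apply: nearW => k; rewrite -expr2; exact: fernique_box.
Qed.

End gaussian_sequence.

(** The inequality [1 + x <= expR x] at [x = - 2^-1] gives [expR 2^-1 <= 2]. *)
Lemma expR1_le4 {R : realType} : expR 1 <= 4 :> R.
Proof.
have h := expR_ge1Dx (- 2^-1 : R); have e0 := expR_gt0 (2^-1 : R).
have e1 : expR (2^-1 : R) * expR (- 2^-1) = 1 by rewrite -expRD subrr expR0.
have -> : expR 1 = expR 2^-1 * expR 2^-1 :> R by rewrite -expRD; congr expR; field.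
nra.
Qed.

(** * Iteration of Fernique's inequality and the exponential moment *)

Section exponential_moment.
Context {R : realType} d (Om : measurableType d) (Q : probability Om R).
Variables (X : Om -> R) (r : R).
Hypothesis mX : measurable_fun setT X.
Hypothesis X0 : forall w, 0 <= X w.
Hypothesis r0 : 0 < r.
Hypothesis X2 : (\int[Q]_w (X w ^+ 2)%:E <= (r ^+ 2)%:E)%E.

Let p s : R := Ex Q (fun w => (X w <= s)%R%:R).
Let J s w : R := (s < X w)%R%:R.
Let c : R := Num.sqrt 2.

Hypothesis fernique : forall s t, 0 < s -> 0 < t ->
  p s * (1 - p t) <= (1 - p ((t - s) / Num.sqrt 2)) ^+ 2.

Let bI s : bmeas (fun w => (X w <= s)%R%:R : R).
Proof.
have -> : (fun w => (X w <= s)%R%:R : R) = \1_(X @^-1` `]-oo, s]).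
  apply/funext => z; rewrite indicE; congr (nat_of_bool _)%:R.
  by apply/idP/idP; rewrite inE /= in_itv.
by apply: bmeas_indic; rewrite -[X in measurable X]setTI; exact: mX.
Qed.

Let JE s : J s = (fun w => 1 + (-1) * (X w <= s)%R%:R).
Proof.
apply/funext => w; rewrite /J ltNge; case: (X w <= s) => /=; by rewrite ?mulr1 ?mulr0 ?subrr ?addr0.
Qed.

Let bJ s : bmeas (J s).
Proof. by rewrite JE; apply: bmeasD; [exact: bmeas_cst|exact/bmeasZ/bI]. Qed.

Let ExJ s : Ex Q (J s) = 1 - p s.
Proof.
rewrite JE ExD; [|exact/bmeas_integrable/bmeas_cst|exact/bmeas_integrable/bmeasZ/bI].
by rewrite Ex_cst ExZ ?mulN1r//; exact/bmeas_integrable/bI.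
Qed.

Let J0 s w : 0 <= J s w. Proof. exact: ler0n. Qed.

Lemma integral_Ex (f : Om -> R) : bmeas f -> (\int[Q]_w (f w)%:E = (Ex Q f)%:E)%E.
Proof.
move=> bf; rewrite /Ex fineK//; apply: integrable_fin_num => //; exact: bmeas_integrable.
Qed.

Let q_ge0 s : 0 <= 1 - p s.
Proof. by rewrite -ExJ; exact: Ex_ge0. Qed.

(** Markov's inequality for the square. The value 1/16 starts [tail] at 1/8 and leaves
    [p (4 * r) >= 1/2] for the iteration. *)
Let q4 : 1 - p (4 * r) <= 16^-1.
Proof.
have h : (((4 * r) ^+ 2 * (1 - p (4 * r)))%:E <= (r ^+ 2)%:E)%E.
  apply: le_trans X2; rewrite -ExJ -ExZ; last exact/bmeas_integrable/bJ.
  rewrite -integral_Ex; last exact: bmeasZ.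
  apply: ge0_le_integral => //.
  - by move=> w _; rewrite lee_fin mulr_ge0// sqr_ge0.
  - by apply/measurable_EFinP; have [] := bmeasZ ((4 * r) ^+ 2) (bJ (4 * r)).
  - by apply/measurable_EFinP; exact: measurable_funX.
  move=> w _; rewrite lee_fin /J; have [h|h] := ltP (4 * r) (X w); last by rewrite mulr0 sqr_ge0.
  by rewrite mulr1 lerXn2r ?nnegrE ?mulr_ge0 ?(ltW r0) ?(ltW h).
move: h; rewrite lee_fin exprMn => h.
have r2 : 0 < r ^+ 2 by rewrite exprn_gt0.
have := q_ge0 (4 * r); move: h; move: (1 - p (4 * r)) => q h q0; nra.
Qed.

(* Chosen so that Fernique's inequality at [4 * r] and [level k.+1] bounds the tail at [level k.+1]
   by twice the square of the tail at [level k]. *)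
Fixpoint level k : R := if k is j.+1 then c * level j + 4 * r else 4 * r.

Let c2 : c ^+ 2 = 2. Proof. by rewrite sqr_sqrtr. Qed.
Let c0 : 0 < c. Proof. by rewrite sqrtr_gt0. Qed.
Let c43 : 4 / 3 <= c.
Proof. by have := c2; have := c0; nra. Qed.

(** The recursion preserves a bound of this form as soon as [3 * c >= 4], whence [c43]. The squares
    of the levels thus grow like [2 ^+ k], at the same pace as the exponent in [tail]. *)
Let level_ub k : level k <= 4 * r * (4 * c ^+ k - 3).
Proof.
elim: k => [|k ih] /=; first by rewrite expr0; have := r0; lra.
have h := ler_wpM2l (ltW c0) ih; apply: le_trans (lerD h (lexx _)) _.
rewrite exprS; have : 0 <= (c - 4 / 3) * r by rewrite mulr_ge0 ?(ltW r0)// subr_ge0.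
by nra.
Qed.

Let level_lb k : 4 * r * k.+1%:R <= level k.
Proof.
elim: k => [|k ih] /=; first by rewrite mulr1.
have l0 : 0 <= level k by apply: le_trans ih; rewrite !mulr_ge0// ltW.
rewrite -[k.+2%:R]natr1 mulrDr mulr1 lerD2r (le_trans ih)// ler_peMl//.
by have := c43; lra.
Qed.

Let level_gt0 k : 0 < level k.
Proof. by apply: lt_le_trans (level_lb k); rewrite !mulr_gt0. Qed.

Let level_sqr k : level k ^+ 2 <= 256 * r ^+ 2 * 2 ^+ k.
Proof.
have h : level k <= 16 * r * c ^+ k.
  by apply: le_trans (level_ub k) _; have := r0; lra.
apply: (@le_trans _ _ ((16 * r * c ^+ k) ^+ 2)).
  by rewrite lerXn2r// nnegrE ?(ltW (level_gt0 k))// (le_trans (ltW (level_gt0 k))).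
rewrite exprMn -exprM mulnC exprM c2 exprMn le_eqVlt; apply/orP; left; apply/eqP; ring.
Qed.

(** Dividing Fernique's inequality by [p (4 * r) >= 1/2] shows that twice the tail is at most
    squared at each level. *)
Let tail k : 2 * (1 - p (level k)) <= 8^-1 ^+ (2 ^ k).
Proof.
elim: k => [|k ih] /=; first by rewrite expn0 expr1; have := q4; lra.
have := @fernique (4 * r) (level k.+1) (mulr_gt0 _ r0) (level_gt0 _).
rewrite ltr0n => /(_ isT) /=.
rewrite addrK [X in X / _]mulrC mulfK ?gt_eqF// => h.
have q0 := q_ge0 (c * level k + 4 * r); have q1 := q_ge0 (level k); have q2 := q4.
have h2 : 1 - p (c * level k + 4 * r) <= 2 * (1 - p (level k)) ^+ 2 by nra.
rewrite expnS mulnC exprM expr2.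
apply: (@le_trans _ _ ((2 * (1 - p (level k))) * (2 * (1 - p (level k))))).
  by move: h2; rewrite expr2; lra.
by rewrite ler_pM// mulr_ge0.
Qed.

(** A majorant by layers: the exponential to be integrated is at most [expR 1] up to [level 0], and
    at most [expR (2 ^ k)%:R] between [level k] and [level k.+1]. *)
Let h n w : R := expR 1 + \sum_(k < n) expR (2 ^ k)%:R * J (level k) w.

Let bh n : bmeas (h n).
Proof.
rewrite /h; apply: bmeasD; first exact: bmeas_cst.
elim: n => [|n ih].
  by under eq_fun do rewrite big_ord0; exact: bmeas_cst.
by under eq_fun do rewrite big_ord_recr/=; apply: bmeasD => //; exact/bmeasZ/bJ.
Qed.

(** By [tail] and [expR 1 <= 4], layer [n] contributes at most half of [(expR 1 / 8) ^+ (2 ^ n)],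
    hence at most [2^-1 ^+ n.+1]. The right side sums this geometric series from the value 4 at
    [n = 0]. *)
Let Ex_h n : Ex Q (h n) <= 5 - 2^-1 ^+ n.
Proof.
elim: n => [|n ih].
  have -> : h 0 = (fun=> expR 1) by apply/funext => w; rewrite /h big_ord0 addr0.
  by rewrite Ex_cst expr0; have := @expR1_le4 R; lra.
rewrite (_ : Ex Q _ = Ex Q (h n) + expR (2 ^ n)%:R * (1 - p (level n))); last first.
  rewrite -ExJ -ExZ; last exact/bmeas_integrable/bJ.
  rewrite -ExD; [|exact/bmeas_integrable/bh|exact/bmeas_integrable/bmeasZ/bJ].
  by apply: eq_Ex => w; rewrite /h big_ord_recr/= addrA.
have E : expR (2 ^ n)%:R * (2 * (1 - p (level n))) <= 2^-1 ^+ n.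
  apply: (@le_trans _ _ (expR (2 ^ n)%:R * 8^-1 ^+ (2 ^ n))).
    by rewrite ler_wpM2l ?expR_ge0//; exact: tail.
  rewrite -[(2 ^ n)%:R]mulr1 expRM_natl -exprMn.
  apply: (@le_trans _ _ (2^-1 ^+ (2 ^ n))).
    rewrite lerXn2r ?nnegrE ?mulr_ge0 ?expR_ge0 ?invr_ge0//; have := @expR1_le4 R; lra.
  by rewrite ler_iXn2l ?invr_gt0 ?invf_lt1 ?ltr1n// ltnW// ltn_expl.
rewrite exprSr; lra.
Qed.

(* The constant 512 makes the exponent at most [2 ^ n] below [level n.+1]. *)
Let f w : R := expR (X w ^+ 2 / (512 * r ^+ 2)).

Let mf : measurable_fun setT f.
Proof.
apply: measurableT_comp => //; apply: measurable_funM => //; exact: measurable_funX.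
Qed.

Let f_le n w : f w * (X w <= level n)%R%:R <= h n w.
Proof.
have r2 : 0 < r ^+ 2 by rewrite exprn_gt0.
have K0 : 0 < 512 * r ^+ 2 by apply: mulr_gt0.
elim: n => [|n ih].
  rewrite /h big_ord0 addr0; have [Xl|Xl] := leP (X w) (level 0); last by rewrite mulr0 expR_ge0.
  rewrite mulr1 /f ler_expR (ler_pdivrMr _ _ K0) mul1r.
  apply: (@le_trans _ _ ((4 * r) ^+ 2)).
    by rewrite lerXn2r// nnegrE// mulr_ge0// ltW.
  rewrite exprMn; lra.
have hS : h n.+1 w = h n w + expR (2 ^ n)%:R * J (level n) w.
  by rewrite /h big_ord_recr/= addrA.
have tn : 0 <= expR (2 ^ n)%:R * J (level n) w by rewrite mulr_ge0 ?expR_ge0.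
have [Xn|Xn] := leP (X w) (level n).
  have f1 : f w * (X w <= level n.+1)%R%:R <= f w.
    by rewrite ler_piMr ?expR_ge0// lern1 leq_b1.
  by move: ih; rewrite Xn mulr1 hS; lra.
have hn0 : 0 <= h n w.
  by rewrite addr_ge0 ?expR_ge0// sumr_ge0// => i _; rewrite mulr_ge0 ?expR_ge0.
have [Xn1|Xn1] := leP (X w) (level n.+1); last by rewrite mulr0 hS addr_ge0.
rewrite mulr1 hS /J Xn mulr1; apply: (@le_trans _ _ (expR (2 ^ n)%:R)); last by rewrite lerDr.
rewrite /f ler_expR (ler_pdivrMr _ _ K0) natrX.
apply: (@le_trans _ _ (level n.+1 ^+ 2)).
  by rewrite lerXn2r ?nnegrE ?X0 ?(ltW (level_gt0 _)).
apply: le_trans (level_sqr _) _; rewrite [2 ^+ n.+1]exprS le_eqVlt; apply/orP; left; apply/eqP; ring.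
Qed.

Lemma gaussian_exp_moment : (\int[Q]_w (expR (X w ^+ 2 / (512 * r ^+ 2)))%:E <= 5%:E)%E.
Proof.
pose g n w := (f w * (X w <= level n)%R%:R)%:E : \bar R.
have mg n : measurable_fun setT (g n).
  by apply/measurable_EFinP; apply: measurable_funM => //; have [] := bI (level n).
have level_nd : {homo level : m n / (m <= n)%N >-> m <= n}.
  apply: homo_leq => [x|y x z|k] /=; [exact: lexx|exact: le_trans|].
  apply: (@le_trans _ _ (c * level k)); last by rewrite lerDl mulr_ge0// ltW.
  by rewrite ler_peMl ?(ltW (level_gt0 _))//; have := c43; lra.
have -> : (\int[Q]_w (expR (X w ^+ 2 / (512 * r ^+ 2)))%:E = \int[Q]_w (limn (g^~ w)))%E.
  apply: eq_integral => w _; apply/esym/cvg_lim => //.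
  apply: cvg_near_cst; near=> n; rewrite /g.
  suff -> : X w <= level n by rewrite mulr1.
  apply: le_trans (level_lb n).
  rewrite -ler_pdivrMl ?mulr_gt0//.
  apply: (@le_trans _ _ n%:R); last by rewrite ler_nat.
  by near: n; exact: nbhs_infty_ger.
rewrite monotone_convergence//.
- apply: lime_le.
    apply: ereal_nondecreasing_is_cvgn => m n mn; apply: ge0_le_integral => //.
    - by move=> w _; rewrite lee_fin mulr_ge0 ?expR_ge0.
    - move=> w _; rewrite lee_fin ler_wpM2l ?expR_ge0// ler_nat.
      by case: (leP (X w) (level m)) => //= h1; rewrite (le_trans h1 (level_nd _ _ mn)).
  apply: nearW => n; apply: (@le_trans _ _ (\int[Q]_w (h n w)%:E)%E).
    apply: ge0_le_integral => //.
    - by move=> w _; rewrite lee_fin mulr_ge0 ?expR_ge0.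
    - by apply/measurable_EFinP; have [] := bh n.
    - by move=> w _; rewrite lee_fin; exact: f_le.
  rewrite integral_Ex// lee_fin; apply: le_trans (Ex_h n) _.
  by rewrite gerBl exprn_ge0// invr_ge0.
- by move=> n w _; rewrite lee_fin mulr_ge0 ?expR_ge0.
- move=> w _ m n mn; rewrite lee_fin ler_wpM2l ?expR_ge0// ler_nat.
  by case: (leP (X w) (level m)) => //= h1; rewrite (le_trans h1 (level_nd _ _ mn)).
Unshelve. all: by end_near. Qed.

End exponential_moment.

(** * Borel functions on normed spaces *)

Section borel.
Context {R : realType}.

Lemma sigma_algebra_borel (F : topologicalType) : sigma_algebra setT (@borel_sets F).
Proof. exact: smallest_sigma_algebra. Qed.

Lemma borel_open (F : topologicalType) (U : set F) : open U -> borel_sets U.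
Proof. exact: sub_sigma_algebra. Qed.

Lemma borel_preimage (F H : topologicalType) (h : F -> H) (B : set H) :
  continuous h -> borel_sets B -> borel_sets (h @^-1` B).
Proof.
move=> ch; apply: (@smallest_sub _ (sigma_algebra setT) [set U | open U]
  [set B | borel_sets (h @^-1` B)]); last first.
  by move=> U oU; apply: borel_open; move/continuousP : ch; exact.
have [b0 bC bU] := sigma_algebra_borel F; split => [|A bA|A bA] /=.
- by rewrite preimage_set0.
- by rewrite setTD preimage_setC -setTD; exact: bC.
- by rewrite preimage_bigcup; exact: bU.
Qed.

(** Half-open intervals generate the measurable sets, and each is the complement of the union of a
    closed and an open half-line. *)
Lemma borel_of_measurable (A : set R) : measurable A -> borel_sets A.
Proof.
have [b0 bC bU] := sigma_algebra_borel R.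
apply: (@smallest_sub _ (sigma_algebra setT) (@ocitv R)) => //.
move=> _ [[a b] _ <-] /=.
have -> : `]a, b]%classic = ~` (`]-oo, a]%classic `|` `]b, +oo[%classic) :> set R.
  rewrite setCU setCitvl setCitvr; apply/seteqP; split => x /=; rewrite !in_itv/= ?andbT.
    by move=> /andP[].
  by move=> [-> ->].
rewrite -setTD; apply: (bC).
have -> : `]-oo, a]%classic `|` `]b, +oo[%classic =
    \bigcup_n (if n is 0%N then `]-oo, a]%classic else `]b, +oo[%classic) :> set R.
  apply/seteqP; split => [x [xa|xb]|x [[|n] _ h]].
  - by exists 0%N.
  - by exists 1%N.
  - by left.
  - by right.
apply: bU => -[|_]; last by apply: borel_open; exact: interval_open.
rewrite -setCitvr -setTD; apply: bC; apply: borel_open; exact: interval_open.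
Qed.

Lemma measurable_of_borel (A : set R) : borel_sets A -> measurable A.
Proof.
apply: (@smallest_sub _ (sigma_algebra setT) [set U | open U]); last first.
  by move=> U oU; exact: open_measurable.
split => [|B mB|B mB]; [exact: measurable0|exact: measurableD|exact: bigcupT_measurable].
Qed.

Lemma borel_fun_continuous (F : topologicalType) (h : F -> R) : continuous h -> borel_fun h.
Proof. by move=> ch A mA; apply: borel_preimage => //; exact: borel_of_measurable. Qed.

Lemma borel_fun_comp (F H : topologicalType) (h : F -> H) (g : H -> R) :
  continuous h -> borel_fun g -> borel_fun (g \o h).
Proof. by move=> ch bg A mA; rewrite comp_preimage; apply: borel_preimage => //; exact: bg. Qed.

Lemma borel_fun_post (F : topologicalType) (g : F -> R) (h : R -> R) :
  borel_fun g -> measurable_fun setT h -> borel_fun (h \o g).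
Proof.
move=> bg mh A mA; rewrite comp_preimage; apply: bg.
by rewrite -[X in measurable X]setTI; exact: mh.
Qed.

Lemma measurable_random_element d (Om : measurableType d) (F : topologicalType)
    (X : Om -> F) (g : F -> R) :
  random_element X -> borel_fun g -> measurable_fun setT (fun w => g (X w)).
Proof.
move=> rX bg _ A mA; rewrite setTI.
by have := rX _ (bg A mA).
Qed.

Lemma gaussian_norm_exp_moment (E : normedModType R) (T : set E) d (Om : measurableType d)
    (Q : probability Om R) (xi : E -> Om -> E) (t : E) (r : R) :
  separable E -> gaussian_process T Q xi -> T t -> 0 < r ->
  (\int[Q]_w (`|xi t w| ^+ 2)%:E <= (r ^+ 2)%:E)%E ->
  (\int[Q]_w (expR (`|xi t w| ^+ 2 / (512 * r ^+ 2)))%:E <= 5%:E)%E.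
Proof.
move=> sE [rX gP] Tt r0 X2.
have [u [uball unorm]] := separable_norming sE.
pose G i w := u i (xi t w).
have lincomb k (a : nat -> R) : centered_gaussian Q (fun w => \sum_(i < k) a i * G i w).
  (* A combination of functionals of the single variable [xi t] is one of values of the process at
     [k] equal times. *)
  apply: (gP k (fun=> t) (fun i x => a i * u i x)) => // i; have [ul ub] := uball i.
  split=> [b x y|]; first by rewrite ul; ring.
  by exists `|a i| => x; rewrite normrM ler_wpM2l.
have gG k (a : nat -> R) : exists s, gauss_law Q (fun w => \sum_(i < k) a i * G i w) s.
  exact: centered_gaussian_law.
have mG i : measurable_fun setT (G i).
  have [+ _] := lincomb i.+1 (fun j => (j == i)%:R).
  apply: eq_measurable_fun => w _.
  rewrite big_ord_recr/= eqxx mul1r big1 ?add0r// => j _.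
  by rewrite ltn_eqF ?mul0r.
have mX : measurable_fun setT (fun w => `|xi t w|).
  apply: measurable_random_element; first exact: rX.
  by apply: borel_fun_continuous; exact: norm_continuous.
apply: (@gaussian_exp_moment R d Om Q (fun w => `|xi t w|)) => // s s' s0 s'0.
by apply: (@fernique_inequality _ _ _ Q G) => // w c; exact: unorm.
Qed.

End borel.

(** * Orlicz norms *)

Section orlicz.
Context {R : realType} (psi : R -> R).
Hypothesis Ppsi : Psi_class psi.

Lemma psi_ge0 u : 0 <= psi u. Proof. by have [_ [_ [h _]]] := Ppsi. Qed.
Lemma psi0 : psi 0 = 0. Proof. by have [_ [_ [_ [h _]]]] := Ppsi. Qed.
Lemma psi_nd x y : 0 <= x -> x <= y -> psi x <= psi y.
Proof. by have [_ [_ [_ [_ [h _]]]]] := Ppsi; exact: h. Qed.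
Lemma psi_convex x y t : 0 <= t <= 1 -> psi (t * x + (1 - t) * y) <= t * psi x + (1 - t) * psi y.
Proof. by have [_ [h _]] := Ppsi; exact: h. Qed.
Lemma psi_convex0 t x : 0 <= t <= 1 -> psi (t * x) <= t * psi x.
Proof. by move=> t01; have := psi_convex x 0 t01; rewrite psi0 !mulr0 !addr0. Qed.

(** [u0] solves [c'' * (expR u0 - 1) = 1]. *)
Lemma psi_small : exists2 u0 : R, 0 < u0 & psi u0 <= 1.
Proof.
have [_ [_ [_ [_ [_ [c' [c'' [c'0 [c''0 h]]]]]]]]] := Ppsi.
exists (ln (1 + c''^-1)); first by rewrite ln_gt0// ltrDl invr_gt0.
have u0 : 0 <= ln (1 + c''^-1) by rewrite ln_ge0// lerDl invr_ge0 ltW.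
apply: le_trans (h _ u0).2 _; rewrite lnK; last by rewrite posrE addr_gt0// invr_gt0.
by rewrite addrAC subrr add0r mulfV// gt_eqF.
Qed.

Section lpsi.
Context d (Om : measurableType d) (P : probability Om R).
Implicit Types (h : Om -> R).

Lemma measurable_psi h (c : R) : measurable_fun setT h -> 0 < c ->
  measurable_fun setT (fun w => (psi (`|h w| / c))%:E).
Proof.
move=> mh c0; apply/measurable_EFinP.
(* [psi] is monotone on the nonnegative reals only; precomposed with the maximum with 0 it is
   monotone everywhere, hence measurable. *)
have -> : (fun w => psi (`|h w| / c)) = (fun x => psi (Num.max x 0)) \o (fun w => `|h w| / c).
  by apply/funext => w /=; rewrite max_l// divr_ge0// ltW.
apply: measurableT_comp.
  apply: nondecreasing_measurable => // x y xy; apply: psi_nd; first by rewrite le_max lexx orbT.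
  by rewrite ge_max !le_max xy lexx orbT.
by apply: measurable_funM => //; exact: measurableT_comp.
Qed.

(** The infimum of the empty set is 0, so without an admissible constant [Lpsi] vanishes and
    comparisons may fail. Admissible constants serve as witnesses of finiteness. *)
Definition psi_adm h (c : R) : Prop :=
  0 < c /\ (\int[P]_w (psi (`|h w| / c))%:E <= 1)%E.

Lemma Lpsi_has_lb h : has_lbound [set c | psi_adm h c].
Proof. by exists 0 => c [c0 _]; exact: ltW. Qed.

Lemma Lpsi_ge0 h : 0 <= Lpsi psi P h.
Proof.
rewrite /Lpsi; set S := [set _ | _].
have [[c Sc]|S0] := pselect (exists c, S c); last first.
  suff -> : S = set0 by rewrite inf0.
  by apply/seteqP; split => c // Sc; apply: S0; exists c.
by apply: lb_le_inf; [exists c|move=> x [x0 _]; exact: ltW].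
Qed.

Lemma Lpsi_le h c : psi_adm h c -> Lpsi psi P h <= c.
Proof. by move=> a; apply: ge_inf => //; exact: Lpsi_has_lb. Qed.

Lemma Lpsi_adherent h c (e : R) : psi_adm h c -> 0 < e ->
  exists2 c', psi_adm h c' & c' < Lpsi psi P h + e.
Proof.
move=> a e0; apply: inf_adherent => //; split; [by exists c|exact: Lpsi_has_lb].
Qed.

Lemma psi_int_le h1 h2 (c1 c2 : R) : measurable_fun setT h1 -> measurable_fun setT h2 ->
  0 < c1 -> 0 < c2 -> (forall w, psi (`|h1 w| / c1) <= psi (`|h2 w| / c2)) ->
  (\int[P]_w (psi (`|h1 w| / c1))%:E <= \int[P]_w (psi (`|h2 w| / c2))%:E)%E.
Proof.
move=> m1 m2 c10 c20 hh; apply: ge0_le_integral => //.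
- by move=> w _; rewrite lee_fin psi_ge0.
- exact: measurable_psi.
- exact: measurable_psi.
- by move=> w _; rewrite lee_fin.
Qed.

Lemma psi_adm_le h1 h2 a : measurable_fun setT h1 -> measurable_fun setT h2 ->
  (forall w, `|h1 w| <= `|h2 w|) -> psi_adm h2 a -> psi_adm h1 a.
Proof.
move=> m1 m2 hh [a0 ha]; split => //; apply: le_trans ha; apply: psi_int_le => // w.
by apply: psi_nd; [rewrite divr_ge0// ltW|rewrite ler_pM2r ?invr_gt0].
Qed.

Lemma psi_adm_scale h (k a : R) : 0 < k -> psi_adm h a -> psi_adm (fun w => k * h w) (k * a).
Proof.
move=> k0 [a0 ha]; split; first exact: mulr_gt0.
apply: le_trans ha; rewrite le_eqVlt; apply/orP; left; apply/eqP.
apply: eq_integral => w _; congr (psi _)%:E.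
by rewrite normrM (gtr0_norm k0) invfM mulrACA mulfV ?mul1r// gt_eqF.
Qed.

Lemma Lpsi_scale h (k : R) : 0 < k -> Lpsi psi P (fun w => k * h w) = k * Lpsi psi P h.
Proof.
move=> k0.
have half (g : Om -> R) (l : R) : 0 < l -> (exists c, psi_adm g c) ->
    Lpsi psi P (fun w => l * g w) <= l * Lpsi psi P g.
  move=> l0 [c gc]; rewrite -ler_pdivrMl//; apply/ler_addgt0Pr => e e0.
  have [c' gc' c'e] := Lpsi_adherent gc e0.
  by apply: le_trans (ltW c'e); rewrite ler_pdivrMl//; exact/Lpsi_le/psi_adm_scale.
have back c : psi_adm (fun w => k * h w) c -> psi_adm h (k^-1 * c).
  move=> a; have := @psi_adm_scale _ k^-1 c; rewrite invr_gt0 => /(_ _ k0 a).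
  by congr psi_adm; apply/funext => w; rewrite mulrA mulVf ?mul1r// gt_eqF.
have [[c hc]|h0] := pselect (exists c, psi_adm h c).
  apply/eqP; rewrite eq_le half//=; last by exists c.
  have := @half (fun w => k * h w) k^-1; rewrite invr_gt0 => /(_ k0).
  rewrite ler_pdivlMl// => H.
  rewrite (_ : (fun w => k^-1 * (k * h w)) = h) in H.
    by apply: H; exists (k * c); exact: psi_adm_scale.
  by apply/funext => w; rewrite mulrA mulVf ?mul1r// gt_eqF.
have e1 : Lpsi psi P h = 0.
  rewrite /Lpsi (_ : [set _ | _] = set0) ?inf0//.
  by apply/seteqP; split => c // hc; apply: h0; exists c.
rewrite e1 mulr0 /Lpsi (_ : [set _ | _] = set0) ?inf0//.
by apply/seteqP; split => c // hc; apply: h0; exists (k^-1 * c); exact: back.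
Qed.

(** [(x + y) / (a + b)] is the convex combination of [x / a] and [y / b] with weights [a / (a + b)]
    and [b / (a + b)]. *)
Lemma psi_adm_add h1 h2 h3 a b : measurable_fun setT h1 ->
  measurable_fun setT h2 -> measurable_fun setT h3 ->
  (forall w, `|h1 w| <= `|h2 w| + `|h3 w|) ->
  psi_adm h2 a -> psi_adm h3 b -> psi_adm h1 (a + b).
Proof.
move=> m1 m2 m3 hh [a0 ha] [b0 hb]; have ab0 : 0 < a + b by exact: addr_gt0.
split=> //; pose t := a / (a + b).
have t01 : 0 <= t <= 1.
  by rewrite /t divr_ge0 ?(ltW a0) ?(ltW ab0)//= ler_pdivrMr// mul1r lerDl ltW.
have tb : 1 - t = b / (a + b).
  by rewrite /t -[X in X - _](mulfV (lt0r_neq0 ab0)) -mulrBl addrAC subrr add0r.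
have [t0 t1] := andP t01.
apply: (@le_trans _ _ (\int[P]_w (t%:E * (psi (`|h2 w| / a))%:E + (1 - t)%:E * (psi (`|h3 w| / b))%:E))%E).
  apply: ge0_le_integral => //.
  - by move=> w _; rewrite lee_fin psi_ge0.
  - exact: measurable_psi.
  - by apply: emeasurable_funD; apply: emeasurable_funM => //; exact: measurable_psi.
  move=> w _; rewrite -!EFinM -EFinD lee_fin; apply: le_trans (psi_convex _ _ t01).
  apply: psi_nd; first by rewrite divr_ge0// ltW.
  have -> : t * (`|h2 w| / a) + (1 - t) * (`|h3 w| / b) = (`|h2 w| + `|h3 w|) / (a + b).
    by rewrite tb /t; field; rewrite ?lt0r_neq0.
  by rewrite ler_pM2r ?invr_gt0.
rewrite ge0_integralD//; last 4 first.
- by move=> w _; rewrite mule_ge0// lee_fin ?psi_ge0.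
- by apply: emeasurable_funM => //; exact: measurable_psi.
- by move=> w _; rewrite mule_ge0// lee_fin ?psi_ge0// subr_ge0.
- by apply: emeasurable_funM => //; exact: measurable_psi.
rewrite !ge0_integralZl//;
  do ?[exact: measurable_psi | by move=> w _; rewrite lee_fin psi_ge0 | by rewrite lee_fin subr_ge0].
apply: (@le_trans _ _ (t%:E * 1 + (1 - t)%:E * 1)%E).
  by apply: leeD; apply: lee_wpmul2l; rewrite ?lee_fin ?subr_ge0.
by rewrite !mule1 -EFinD lee_fin addrC subrK.
Qed.

Lemma Lpsi_triangle h1 h2 h3 a b : measurable_fun setT h1 ->
  measurable_fun setT h2 -> measurable_fun setT h3 ->
  (forall w, `|h1 w| <= `|h2 w| + `|h3 w|) ->
  psi_adm h2 a -> psi_adm h3 b -> Lpsi psi P h1 <= Lpsi psi P h2 + Lpsi psi P h3.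
Proof.
move=> m1 m2 m3 hh ha hb; apply/ler_addgt0Pr => e e0.
have e2 : 0 < e / 2 by rewrite divr_gt0.
have [a' ha' a'e] := Lpsi_adherent ha e2; have [b' hb' b'e] := Lpsi_adherent hb e2.
by apply: le_trans (Lpsi_le (psi_adm_add m1 m2 m3 hh ha' hb')) _; lra.
Qed.

Lemma psi_adm_bounded h (M : R) : measurable_fun setT h -> (forall w, `|h w| <= M) ->
  exists c, psi_adm h c.
Proof.
move=> mh hM; have [u0 u00 pu0] := psi_small.
have M0 : 0 < `|M| + 1 by rewrite ltr_wpDl.
have c0 : 0 < (`|M| + 1) / u0 by rewrite divr_gt0.
exists ((`|M| + 1) / u0); split => //.
apply: (@le_trans _ _ (\int[P]_w (cst 1%:E w))%E); last first.
  by rewrite integral_cst// [X in (_ * X)%E](@probability_setT _ _ _ P) mule1.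
apply: ge0_le_integral => //.
- by move=> w _; rewrite lee_fin psi_ge0.
- exact: measurable_psi.
move=> w _; rewrite lee_fin; apply: le_trans pu0; apply: psi_nd; first by rewrite divr_ge0// ltW.
rewrite ler_pdivrMr// mulrCA mulfV ?gt_eqF// mulr1.
by apply: le_trans (hM w) _; apply: le_trans (ler_norm _) _; rewrite lerDl.
Qed.

Lemma psi_tilde_ge0 u : 0 <= psi_tilde psi u.
Proof.
rewrite /psi_tilde invr_ge0 /psi_inv; set S := [set _ | _].
have [[c Sc]|S0] := pselect (exists c, S c /\ has_ubound S); last first.
  rewrite sup_out// => -[[c Sc] bS]; apply: S0; by exists c.
by apply: le_trans (ub_le_sup Sc.2 Sc.1); exact: Sc.1.1.
Qed.

Lemma psi_inv_has_ub (v : R) : has_ubound [set u : R | 0 <= u /\ psi u <= v].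
Proof.
have [_ [_ [_ [_ [_ [c' [c'' [c'0 [c''0 h]]]]]]]]] := Ppsi.
exists (v / c') => u [u0 uv]; rewrite ler_pdivlMr// mulrC.
exact: le_trans (h _ u0).1 uv.
Qed.

Lemma psi_inv1_gt0 : 0 < psi_inv psi 1.
Proof.
have [u0 u00 pu0] := psi_small; apply: (lt_le_trans u00).
by apply: ub_le_sup; [exact: psi_inv_has_ub|split => //; exact: ltW].
Qed.

Lemma psi_inv_nd (v w : R) : 0 <= v -> v <= w -> psi_inv psi v <= psi_inv psi w.
Proof.
move=> v0 vw; apply: ge_sup; first by exists 0; split; rewrite ?psi0.
move=> u [u0 uv]; apply: ub_le_sup; first exact: psi_inv_has_ub.
by split => //; exact: le_trans uv vw.
Qed.

(** By monotonicity [psi_tilde psi p <= psi_tilde psi 1]. The product of the square roots yields the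
    exponent 1/2 of the tail term in (i). *)
Lemma psi_tilde_le_sqrt (p : R) : 0 <= p <= 1 ->
  psi_tilde psi p <= Num.sqrt (psi_tilde psi 1) * Num.sqrt (psi_tilde psi p).
Proof.
move=> /andP[p0 p1].
have h : psi_tilde psi p <= psi_tilde psi 1.
  move: p0; rewrite le_eqVlt => /orP[/eqP<-|p0].
    (* Here [0^-1 = 0], and [psi u >= c' * u] leaves 0 as the only [u >= 0] with [psi u <= 0];
       inverting 0 once more gives 0. *)
    have -> : psi_tilde psi 0 = 0.
      rewrite /psi_tilde invr0 (_ : psi_inv psi 0 = 0) ?invr0//.
      apply/eqP; rewrite eq_le; apply/andP; split.
        apply: ge_sup; first by exists 0; split; rewrite ?psi0.
        have [_ [_ [_ [_ [_ [c' [c'' [c'0 [c''0 h]]]]]]]]] := Ppsi.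
        move=> u [u0 hu]; have := le_trans (h _ u0).1 hu.
        by rewrite pmulr_rle0.
      by apply: ub_le_sup; [exact: psi_inv_has_ub|split; rewrite ?psi0].
    exact: psi_tilde_ge0.
  rewrite /psi_tilde invr1 lef_pV2 ?posrE; first by apply: psi_inv_nd => //; rewrite invf_ge1.
    by apply: lt_le_trans psi_inv1_gt0 _; apply: psi_inv_nd => //; rewrite invf_ge1.
  exact: psi_inv1_gt0.
rewrite -sqrtrM ?psi_tilde_ge0//.
rewrite -[leLHS]ger0_norm ?psi_tilde_ge0// -sqrtr_sqr ler_sqrt ?mulr_ge0 ?psi_tilde_ge0//.
by rewrite expr2 ler_wpM2r ?psi_tilde_ge0.
Qed.

(** The integral for the constant [c] is [psi c^-1 * p], so [c] is admissible when
    [psi c^-1 <= p^-1]. This holds for every [c] above [psi_tilde psi p]; the slack [e] avoids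
    evaluating [psi] at the supremum that defines [psi_inv]. *)
Lemma Lpsi_indic (B : set Om) : measurable B ->
  Lpsi psi P \1_B <= psi_tilde psi (fine (P B)).
Proof.
move=> mB; set p := fine (P B).
have pE : P B = p%:E by rewrite /p fineK// fin_num_measure.
have p0 : 0 <= p by rewrite /p fine_ge0.
have p1 : p <= 1 by rewrite -lee_fin -pE probability_le1.
have intE (c : R) : 0 < c -> (\int[P]_w (psi (`|\1_B w| / c))%:E = (psi (c^-1) * p)%:E)%E.
  move=> c0; transitivity (\int[P]_w ((psi c^-1)%:E * (\1_B w)%:E))%E.
    apply: eq_integral => w _; rewrite indicE; case: (w \in B) => /=.
      by rewrite normr1 mul1r mule1.
    by rewrite normr0 mul0r psi0 mule0.
  have mI : measurable_fun setT (fun w => (\1_B w : R)%:E).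
    by apply/measurable_EFinP; exact: measurable_indic.
  have k0 : (0 <= (psi c^-1)%:E)%E by rewrite lee_fin psi_ge0.
  by rewrite ge0_integralZl// integral_indic// setIT [X in (_ * X)%E]pE EFinM.
apply/ler_addgt0Pr => e e0; have [p_eq0|pn0] := eqVneq p 0.
  apply: (@le_trans _ _ e); last by rewrite lerDr psi_tilde_ge0.
  by apply: Lpsi_le; split=> //; rewrite intE// p_eq0 mulr0 lee_fin.
have {}p0 : 0 < p by rewrite lt_neqAle eq_sym pn0.
have q0 : 0 < psi_inv psi p^-1.
  by apply: lt_le_trans psi_inv1_gt0 _; apply: psi_inv_nd => //; rewrite invf_ge1.
have c0 : 0 < psi_tilde psi p + e by rewrite ltr_wpDl ?psi_tilde_ge0.
apply: Lpsi_le; split=> //; rewrite intE// lee_fin -ler_pdivlMr// div1r leNgt.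
apply/negP => hp; have : psi_inv psi p^-1 <= (psi_tilde psi p + e)^-1.
  apply: ge_sup; first by exists 0; split; rewrite ?psi0// invr_ge0 ltW.
  move=> u [u0 hu]; rewrite leNgt; apply/negP => cu.
  have : psi (psi_tilde psi p + e)^-1 <= psi u by apply: psi_nd; rewrite ?invr_ge0 ltW.
  by rewrite leNgt (le_lt_trans hu hp).
by apply/negP; rewrite -ltNge invf_plt ?posrE// ltrDl.
Qed.

(** For [c >= 1], convexity and [psi 0 = 0] give [psi (Y / c) <= psi Y / c], at most
    [c'' * expR Y / c]. Its integral is at most 1 for [c = 1 + c'' * M], where the summand 1 ensures
    [c >= 1]. *)
Lemma psi_adm_exp_moment (Y : Om -> R) (M : R) : measurable_fun setT Y ->
  (forall w, 0 <= Y w) -> 0 < M -> (\int[P]_w (expR (Y w))%:E <= M%:E)%E ->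
  forall c'' : R, 0 < c'' -> (forall u, 0 <= u -> psi u <= c'' * (expR u - 1)) ->
  psi_adm Y (1 + c'' * M).
Proof.
move=> mY Y0 M0 hM c'' c''0 hc.
have c0 : 0 < 1 + c'' * M by rewrite ltr_wpDr// mulr_ge0// ltW.
have c1 : 0 <= (1 + c'' * M)^-1 <= 1.
  by rewrite invr_ge0 (ltW c0)/= invf_le1// lerDl mulr_ge0// ltW.
have [c10 _] := andP c1.
have mE : measurable_fun setT (fun w => (expR (Y w))%:E).
  by apply/measurable_EFinP; exact: measurableT_comp.
split=> //.
apply: (@le_trans _ _ (\int[P]_w (((1 + c'' * M)^-1 * c'')%:E * (expR (Y w))%:E))%E).
  apply: ge0_le_integral => //.
  - by move=> w _; rewrite lee_fin psi_ge0.
  - exact: measurable_psi.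
  - by apply: emeasurable_funM.
  move=> w _; rewrite -EFinM lee_fin ger0_norm// mulrC.
  apply: le_trans (psi_convex0 _ c1) _; rewrite -mulrA ler_wpM2l//.
  by apply: le_trans (hc _ (Y0 w)) _; rewrite ler_wpM2l ?(ltW c''0)//; lra.
rewrite ge0_integralZl//; last by rewrite lee_fin mulr_ge0// ltW.
apply: (@le_trans _ _ (((1 + c'' * M)^-1 * c'')%:E * M%:E)%E).
  by apply: lee_wpmul2l => //; rewrite lee_fin mulr_ge0// ltW.
by rewrite -EFinM lee_fin -mulrA mulrC ler_pdivrMr// mul1r lerDr.
Qed.

End lpsi.

Lemma Lpsi_gauss_law d (Om : measurableType d) (Q : probability Om R) (X : Om -> R) s :
  gauss_law Q X s -> Lpsi psi Q X = s * Lpsi psi N01 (fun x => x).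
Proof.
move=> [mX s0 H].
have E : Lpsi psi Q X = Lpsi psi N01 (fun x => s * x).
  rewrite /Lpsi; congr inf; apply/seteqP; split => c /= [c0 hc]; split => //.
    rewrite -(H (fun x => (psi (`|x| / c))%:E))//.
      exact: (@measurable_psi _ _ (fun x : R => x)).
    by move=> x; rewrite lee_fin psi_ge0.
  rewrite (H (fun x => (psi (`|x| / c))%:E))//.
    exact: (@measurable_psi _ _ (fun x : R => x)).
  by move=> x; rewrite lee_fin psi_ge0.
rewrite E; move: s0; rewrite le_eqVlt => /orP[/eqP<-|s0]; last exact: Lpsi_scale.
rewrite mul0r; apply/eqP; rewrite eq_le Lpsi_ge0 andbT.
apply/ler_addgt0Pr => e e0; rewrite add0r; apply: Lpsi_le; split=> //.
under eq_integral do rewrite mul0r normr0 mul0r psi0.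
by rewrite integral0.
Qed.

End orlicz.

(** * Taylor expansion and test functions *)

Section smooth.
Context {R : realType} {E : normedModType R}.
Implicit Types (f : E -> R) (Theta U : set E) (x y t h : E) (delta rho : R).

Lemma enlarge_self Theta delta t : 0 < delta -> Theta t -> enlarge Theta delta t.
Proof. by move=> d0 Tt; exists t => //; rewrite subrr normr0. Qed.

Lemma enlarge_add Theta delta t y : Theta t -> `|y| < delta -> enlarge Theta delta (t + y).
Proof. by move=> Tt yd; exists t => //; rewrite addrAC subrr add0r. Qed.

Lemma enlarge_sub Theta (d1 d2 : R) : d1 <= d2 -> enlarge Theta d1 `<=` enlarge Theta d2.
Proof. by move=> d12 x [t Tt h]; exists t => //; exact: lt_le_trans h d12. Qed.

Lemma enlarge_nbhs Theta delta x : enlarge Theta delta x -> nbhs x (enlarge Theta delta).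
Proof.
move=> [t Tt xt]; have e0 : 0 < delta - `|x - t| by rewrite subr_gt0.
apply/nbhs_ballP; exists (delta - `|x - t|) => //= y.
rewrite -ball_normE /ball_/= => xy; exists t => //.
have := ler_distD x y t; rewrite (distrC y x); lra.
Qed.

Lemma diff_lip_le f U x h : nbhs x U -> lip_on U 1 f -> differentiable f x ->
  `|'d f x h| <= `|h|.
Proof.
move=> xU lf df; rewrite -deriveE//.
have /cvg_ex[l fl] : derivable f x h by exact: diff_derivable.
have Dl : 'D_h f x = l by exact: cvg_lim fl.
have fl' : `|a^-1 *: ((f \o shift x) (a *: h) - f x)| @[a --> 0^'] --> `|l| by exact: cvg_norm.
rewrite Dl; apply: (cvgr_to_le fl').
have xU' : \forall a \near (0 : R), U (a *: h + x).
  have c : a *: h + x @[a --> (0 : R)] --> x.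
    rewrite -[X in _ --> X]add0r -[X in X + x](scale0r h).
    by apply: cvgD; [apply: cvgZr_tmp; exact: cvg_id|exact: cvg_cst].
  exact: c.
near=> a.
have a0 : a != 0 by near: a; exact: nbhs_dnbhs_neq.
rewrite normrM normfV ler_pdivrMl ?normr_gt0// -normrZ.
have Ua : U (a *: h + x) by near: a; exact: nbhs_dnbhs.
have := lf (a *: h + x) x Ua (nbhs_singleton xU).
by rewrite addrK powRr1.
Unshelve. all: by end_near. Qed.

Lemma derive_along f t y (c : R) : differentiable f (t + c *: y) ->
  is_derive c 1 (fun s : R => f (t + s *: y)) ('d f (t + c *: y) y).
Proof.
move=> df; rewrite -deriveE//.
have dy : derivable f (t + c *: y) y by exact: diff_derivable.
have e : (fun a : R => a^-1 *: (((fun s : R => f (t + s *: y)) \o shift c) (a *: 1) - f (t + c *: y)))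
  = (fun a : R => a^-1 *: ((f \o shift (t + c *: y)) (a *: y) - f (t + c *: y))).
  apply/funext => a; congr (_ *: (f _ - _)); rewrite /= scalerDl /GRing.scale/= mulr1.
  by rewrite addrCA.
by split; rewrite /derivable /derive e.
Qed.

(** Mean value theorem on the segment from [t] to [t + y], which stays in the enlargement because
    [t] lies in [Theta]. *)
Lemma taylor_remainder f Theta delta rho t y : 0 < rho -> Theta t -> `|y| < delta ->
  diff_on (enlarge Theta delta) f -> dlip_on (enlarge Theta delta) rho f ->
  `|f (t + y) - f t - 'd f t y| <= `|y| `^ (1 + rho).
Proof.
move=> rho0 Tt yd df dl.
have inU (c : R) : 0 <= c <= 1 -> enlarge Theta delta (t + c *: y).
  move=> /andP[c0 c1]; apply: enlarge_add => //; apply: le_lt_trans yd.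
  by rewrite normrZ ger0_norm// ler_piMl.
have dg (c : R) : 0 <= c <= 1 ->
    is_derive c 1 (fun s : R => f (t + s *: y)) ('d f (t + c *: y) y).
  by move=> c01; apply: derive_along; exact/df/inU.
have [||c c01] := @MVT _ (fun s : R => f (t + s *: y)) (fun c => 'd f (t + c *: y) y) 0 1 ltr01.
- by move=> c; rewrite in_itv/= => /andP[c0 c1]; apply: dg; rewrite !ltW.
- apply: derivable_within_continuous => c; rewrite in_itv/= => c01.
  exact: (@ex_derive _ _ _ _ _ _ _ (dg c c01)).
rewrite scale1r scale0r addr0 subr0 mulr1 => ->.
move: c01; rewrite in_itv/= => /andP[c0 c1].
have c01 : 0 <= c <= 1 by rewrite !ltW.
have tU : enlarge Theta delta t by have := inU 0; rewrite scale0r addr0; apply; rewrite lexx ler01.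
apply: le_trans (dl _ _ (inU _ c01) tU y) _.
rewrite addrAC subrr add0r powRD; last by apply/implyP => /eqP; lra.
rewrite powRr1// mulrC ler_wpM2l// ge0_ler_powR ?nnegrE ?(ltW rho0)//.
by rewrite normrZ ger0_norm ?(ltW c0)// ler_piMl// ltW.
Qed.

(** Outside the ball the linear term is not small; this divides it between the indicator and the
    power. *)
Lemma normr_le_powR (z rho : R) : 0 <= z -> 0 < rho -> z <= 1 + z `^ (1 + rho).
Proof.
move=> z0 rho0; have p0 := powR_ge0 z (1 + rho).
have [z1|z1] := leP z 1; first lra.
have : z `^ 1 <= z `^ (1 + rho) by apply: ler_powR; [exact: ltW|rewrite lerDl ltW].
rewrite powRr1//; lra.
Qed.

Lemma powR_le_sqr (z rho : R) : 0 <= z -> 0 < rho <= 1 -> z `^ (1 + rho) <= 1 + z ^+ 2.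
Proof.
move=> z0 /andP[rho0 rho1].
have [z1|z1] := leP z 1.
  apply: (@le_trans _ _ 1); last by rewrite lerDl sqr_ge0.
  apply: (@le_trans _ _ (1 `^ (1 + rho))); last by rewrite powR1.
  by rewrite ge0_ler_powR ?nnegrE//; lra.
apply: (@le_trans _ _ (z ^+ 2)); last by rewrite lerDr.
by rewrite -powR_mulrn//; apply: ler_powR; [exact: ltW|lra].
Qed.

(** Serves for a rate [r0] that may be 0, by which one cannot divide: estimates for all larger [r]
    pass to [r0] by continuity of the power. *)
Lemma le_of_powR_near (A B C r0 s : R) : 0 <= r0 -> 0 < s -> 0 < C ->
  (forall r, r0 < r -> A <= C * r `^ s + B) -> A <= C * r0 `^ s + B.
Proof.
move=> r00 s0 C0 h; apply/ler_addgt0Pr => e e0.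
have p0 := powR_ge0 r0 s; have eC : 0 < e / C by rewrite divr_gt0.
pose r := (r0 `^ s + e / C) `^ s^-1.
have rs : r `^ s = r0 `^ s + e / C.
  by rewrite /r -powRrM mulVf ?gt_eqF// powRr1// addr_ge0// ltW.
have r0r : r0 < r.
  rewrite ltNge; apply/negP => rr.
  have : r `^ s <= r0 `^ s by rewrite ge0_ler_powR ?nnegrE ?powR_ge0// ltW.
  by rewrite rs; lra.
have := h r r0r; rewrite rs mulrDr [C * (e / C)]mulrC divfK ?gt_eqF//; lra.
Qed.

End smooth.

(** * Test functions built from the functional *)

Section test_functions.
Context {R : realType} {E : normedModType R}.
Implicit Types (f : E -> R) (Theta : set E) (t : E) (delta rho : R).

Lemma Cs_ball_unfold (U : set E) rho f : 0 < rho -> Cs_ball U (1 + rho) f ->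
  [/\ borel_fun f, forall x, `|f x| <= 1, diff_on U f, lip_on U 1 f & dlip_on U rho f].
Proof.
move=> rho0 [[bf f1] [_]]; rewrite /C0s_le1 (_ : (1 + rho <= 1) = false); last first.
  by apply/negP; lra.
by rewrite addrAC subrr add0r => -[df [lf dlf]].
Qed.

(** The factor 1/2 is for the uniform bound, as the increment is bounded by 2; the Hoelder bounds
    only improve. *)
Lemma Cs_ball_half_increment Theta (d1 d2 : R) rho f t : 0 < rho -> d1 <= d2 ->
  Cs_ball (enlarge Theta d2) (1 + rho) f ->
  Cs_ball (enlarge Theta d1) (1 + rho) (fun x => 2^-1 * (f x - f t)).
Proof.
move=> rho0 d12 /(Cs_ball_unfold rho0)[bf f1 df lf dlf].
pose g x := 2^-1 * (f x - f t).
have g1 x : `|g x| <= 1.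
  rewrite /g normrM ger0_norm ?invr_ge0// ler_pdivrMl// mulr1.
  by apply: le_trans (ler_normB _ _) _; have := f1 x; have := f1 t; lra.
have sub := @enlarge_sub _ _ Theta _ _ d12.
have dg x : enlarge Theta d1 x -> differentiable g x /\ forall h, 'd g x h = 2^-1 * 'd f x h.
  move=> xU; have dfx := df _ (sub _ xU).
  have ge : g = 2^-1 \*: (f - cst (f t)) by apply/funext.
  have dfc : differentiable (f - cst (f t)) x by exact: differentiableB.
  split; first by rewrite ge; exact: differentiableZ.
  move=> h; rewrite -deriveE; last by rewrite ge; exact: differentiableZ.
  rewrite ge deriveZ ?deriveB//; [|exact: diff_derivable..].
  by rewrite derive_cst subr0 deriveE.
split; first split => //.
  apply: (@borel_fun_post _ _ f (fun z => 2^-1 * (z - f t))) => //.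
  by apply: measurable_funM => //; exact: measurable_funB.
split; first by move=> x _; exact: g1.
rewrite /C0s_le1 (_ : (1 + rho <= 1) = false); last by apply/negP; lra.
rewrite addrAC subrr add0r; split; first by move=> x /dg[].
split => [x y xU yU|x y xU yU h].
  have -> : 2^-1 * (f x - f t) - 2^-1 * (f y - f t) = 2^-1 * (f x - f y) by ring.
  rewrite normrM ger0_norm ?invr_ge0//.
  apply: le_trans (lf _ _ (sub _ xU) (sub _ yU)); rewrite ler_piMl//; lra.
rewrite -/g (dg x xU).2 (dg y yU).2 -mulrBr normrM ger0_norm ?invr_ge0//.
apply: le_trans (dlf _ _ (sub _ xU) (sub _ yU) h); rewrite ler_piMl//; lra.
Qed.

Lemma C0s_le1_lip (s' : R) (phi : R -> R) : 1 <= s' -> C0s_le1 setT s' phi ->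
  forall a b, `|phi a - phi b| <= `|a - b|.
Proof.
move=> s1; rewrite /C0s_le1; case: ifPn => [s'1 lp a b|_ [_ [lp _]] a b].
  have := lp a b I I; rewrite (_ : s' = 1) ?powRr1//.
  by apply/eqP; rewrite eq_le s'1.
by have := lp a b I I; rewrite powRr1.
Qed.

(** Lowers the Hoelder exponent from [rho] to [s' - 1]. Below 1 a smaller exponent gives a larger
    power; above 1 the bound 2 takes over. *)
Lemma scaled_rate_le (z sn rho s' : R) : 1 <= sn -> 0 < s' - 1 <= rho -> 0 <= z ->
  Num.min 2 ((z / sn) `^ rho) <= 2 * z `^ (s' - 1).
Proof.
move=> sn1 /andP[s0 s1] z0.
have sn0 : 0 < sn by exact: lt_le_trans sn1.
have zs : z / sn <= z by rewrite ler_pdivrMr// ler_peMr.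
have zs0 : 0 <= z / sn by rewrite divr_ge0// ltW.
have p0 := powR_ge0 z (s' - 1).
have [z1|z1] := leP (z / sn) 1.
  apply: (@le_trans _ _ ((z / sn) `^ rho)); first by rewrite ge_min lexx orbT.
  apply: (@le_trans _ _ (z `^ (s' - 1))); last lra.
  apply: (@le_trans _ _ ((z / sn) `^ (s' - 1))).
    move: zs0; rewrite le_eqVlt => /orP[/eqP<-|zs0].
      by rewrite !powR0// gt_eqF// (lt_le_trans s0).
    by apply: ger_powR => //; rewrite zs0.
  by rewrite ge0_ler_powR ?nnegrE ?(ltW s0).
apply: (@le_trans _ _ 2); first by rewrite ge_min lexx.
rewrite ler_peMr//.
apply: (@le_trans _ _ (1 `^ (s' - 1))); first by rewrite powR1.
by rewrite ge0_ler_powR ?nnegrE ?(ltW s0)// (le_trans (ltW z1)).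
Qed.

(* The increment of [f] rescaled at rate [1 / sn] is again Hoelder, with a constant at most 3:
   [|f'(t + x / sn) - f'(t + y / sn)|] is at most both 2 and [(|x - y| / sn) `^ rho]. *)
Lemma C0s_ball_rescaled Theta delta rho f t (sn s' d1 : R) (phi : R -> R) :
  0 < rho <= 1 -> 1 <= sn -> 1 <= s' <= 1 + rho -> Theta t -> d1 <= delta ->
  Cs_ball (enlarge Theta delta) (1 + rho) f -> Cs_ball setT s' phi ->
  C0s_ball (origin_ball (d1 * sn) : set E) s'
    (fun x => 3^-1 * phi (sn * (f (t + sn^-1 *: x) - f t))).
Proof.
move=> /andP[rho0 rho1] sn1 /andP[s'1 s'2] Tt d1d fB [[bphi phi1] [_ phiC]].
have [bf f1 df lf dlf] := Cs_ball_unfold rho0 fB.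
have sn0 : 0 < sn by exact: lt_le_trans sn1.
have philip := C0s_le1_lip s'1 phiC.
pose u x := t + sn^-1 *: x.
pose F x := sn * (f (u x) - f t).
pose g x := 3^-1 * phi (F x).
have cu : continuous u.
  by move=> x; apply: cvgD; [exact: cvg_cst|apply: cvgZl_tmp; exact: cvg_id].
have uB x y : `|u x - u y| = sn^-1 * `|x - y|.
  by rewrite /u opprD addrACA subrr add0r -scalerBr normrZ gtr0_norm ?invr_gt0.
have uU x : origin_ball (d1 * sn) x -> enlarge Theta delta (u x).
  move=> xb; apply: enlarge_add => //; apply: lt_le_trans d1d.
  by rewrite normrZ gtr0_norm ?invr_gt0// ltr_pdivrMl// mulrC.
have Flip x y : origin_ball (d1 * sn) x -> origin_ball (d1 * sn) y -> `|F x - F y| <= `|x - y|.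
  move=> xb yb; have -> : F x - F y = sn * (f (u x) - f (u y)) by rewrite /F; ring.
  rewrite normrM gtr0_norm// -ler_pdivlMl// -uB.
  by have := lf _ _ (uU _ xb) (uU _ yb); rewrite powRr1.
have glip x y : origin_ball (d1 * sn) x -> origin_ball (d1 * sn) y -> `|g x - g y| <= `|x - y|.
  move=> xb yb; rewrite /g -mulrBr normrM ger0_norm ?invr_ge0//.
  have := philip (F x) (F y); have := Flip x y xb yb; have := normr_ge0 (phi (F x) - phi (F y)).
  lra.
split; first split.
- apply: (@borel_fun_post _ _ (f \o u) (fun z => 3^-1 * phi (sn * (z - f t)))).
    exact: borel_fun_comp.
  apply: measurable_funM => //.
  have mphi : measurable_fun setT phi.
    by move=> _ A mA; rewrite setTI; apply: measurable_of_borel; exact: bphi.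
  apply: (measurableT_comp mphi); apply: measurable_funM => //; exact: measurable_funB.
- move=> x; rewrite -/(F x) normrM ger0_norm ?invr_ge0//.
  by have := phi1 (F x); lra.
rewrite /C0s_le1; case: ifPn => [s1|s1].
  move=> x y xb yb; rewrite (_ : s' = 1); first by rewrite powRr1//; exact: glip.
  by apply/eqP; rewrite eq_le s1.
move: phiC; rewrite /C0s_le1 (negbTE s1) => -[dphi [lphi dlphi]].
have s'0 : 0 < s' - 1 by rewrite subr_gt0 ltNge.
have dF x : origin_ball (d1 * sn) x ->
    differentiable F x /\ forall h, 'd F x h = 'd f (u x) h.
  move=> xb; have dfu := df _ (uU _ xb).
  have du : is_diff x u ( *:%R sn^-1).
    have -> : u = cst t + sn^-1 \*: id by apply/funext.
    apply: is_diff_eq; apply/funext => h; rewrite /= /GRing.add /= /GRing.scale /=.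
    by rewrite add0r.
  have dfc : differentiable (f \o u) x.
    by apply: differentiable_comp.
  have Fe : F = sn \*: ((f \o u) - cst (f t)) by apply/funext.
  have d2 : differentiable ((f \o u) - cst (f t)) x by exact: differentiableB.
  split; first by rewrite Fe; exact: differentiableZ.
  move=> h; rewrite -deriveE; last by rewrite Fe; exact: differentiableZ.
  rewrite Fe deriveZ ?deriveB//; [|exact: diff_derivable..].
  rewrite derive_cst subr0 deriveE// diff_comp//= diff_val.
  by rewrite linearZ /= /GRing.scale/= mulrA mulfV ?mul1r// gt_eqF.
have dg x : origin_ball (d1 * sn) x ->
    differentiable g x /\ forall h, 'd g x h = 3^-1 * 'd phi (F x) ('d f (u x) h).
  move=> xb; have [dFx dFE] := dF x xb; have dphiF := dphi (F x) I.
  have ge : g = 3^-1 \*: (phi \o F) by apply/funext.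
  have dc : differentiable (phi \o F) x by exact: differentiable_comp.
  split; first by rewrite ge; exact: differentiableZ.
  move=> h; rewrite -deriveE; last by rewrite ge; exact: differentiableZ.
  rewrite ge deriveZ; last exact: diff_derivable.
  by rewrite deriveE// diff_comp//= dFE.
split; first by move=> x /dg[].
split; first by move=> x y xb yb; rewrite powRr1//; exact: glip.
move=> x y xb yb h; rewrite -/F -/g (dg x xb).2 (dg y yb).2.
set dx := 'd f (u x) h; set dy := 'd f (u y) h.
have opn (z : E) : origin_ball (d1 * sn) z -> `|'d f (u z) h| <= `|h|.
  move=> zb; apply: (@diff_lip_le _ _ f (enlarge Theta delta)) => //.
  - by apply: enlarge_nbhs; exact: uU.
  - by apply: df; exact: uU.
have dxh : `|dx| <= `|h| by exact: opn.
have dyh : `|dy| <= `|h| by exact: opn.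
have h1 : `|'d phi (F x) dx - 'd phi (F y) dx| <= `|x - y| `^ (s' - 1) * `|h|.
  apply: le_trans (dlphi (F x) (F y) I I dx) _.
  by apply: ler_pM => //; rewrite ?powR_ge0// ge0_ler_powR ?nnegrE ?(ltW s'0)//; exact: Flip.
have h2 : `|'d phi (F y) dx - 'd phi (F y) dy| <= `|dx - dy|.
  rewrite -linearB; apply: (@diff_lip_le _ _ phi setT) => //.
    exact: filterT.
  exact: dphi.
have h3 : `|dx - dy| <= Num.min 2 ((`|x - y| / sn) `^ rho) * `|h|.
  rewrite /Num.min; case: ifPn => _.
    by apply: le_trans (ler_normB _ _) _; lra.
  by have := dlf _ _ (uU _ xb) (uU _ yb) h; rewrite uB [sn^-1 * _]mulrC.
have h4 := @scaled_rate_le `|x - y| sn rho s' sn1.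
have h5 : Num.min 2 ((`|x - y| / sn) `^ rho) * `|h| <= 2 * `|x - y| `^ (s' - 1) * `|h|.
  rewrite ler_wpM2r//; apply: h4 => //; rewrite s'0/=; lra.
rewrite -mulrBr normrM ger0_norm ?invr_ge0//.
(* The variation of the derivative of [phi] contributes 1 and that of [f] contributes 2; the factor
   [3^-1] compensates the sum. *)
have -> : 'd phi (F x) dx - 'd phi (F y) dy =
    ('d phi (F x) dx - 'd phi (F y) dx) + ('d phi (F y) dx - 'd phi (F y) dy).
  by rewrite addrA subrK.
have := ler_normD ('d phi (F x) dx - 'd phi (F y) dx) ('d phi (F y) dx - 'd phi (F y) dy).
rewrite ler_pdivrMl//; lra.
Qed.

End test_functions.

(** * The remainder of the linear approximation *)

Section gaussian_remainder.
Context {R : realType} {E : normedModType R} d (Om : measurableType d) (Q : probability Om R).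
Implicit Types (Theta : set E) (t : E).

(** The bound by [c1 * n] makes the supremum finite, so that [fine] returns its true value. *)
Lemma setting_fin_v (Theta : set E) delta (xi : E -> Om -> E) t (c1 n : R) :
  0 < delta -> Theta t ->
  (v_xi Q (xi_conv Theta delta xi) Theta <= (c1 * n)%:E)%E ->
  (\int[Q]_w (`|xi t w| ^+ 2)%:E <=
    (fine (v_xi Q (xi_conv Theta delta xi) Theta))%:E)%E /\
  0 <= fine (v_xi Q (xi_conv Theta delta xi) Theta).
Proof.
move=> d0 Tt vle; set v := v_xi _ _ _.
have h : (\int[Q]_w (`|xi t w| ^+ 2)%:E <= v)%E.
  apply: ereal_sup_ubound; exists t => //; apply: eq_integral => w _.
  by rewrite /xi_conv asboolT//; exact: enlarge_self.
have v0 : (0 <= v)%E.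
  by apply: le_trans h; apply: integral_ge0 => w _; rewrite lee_fin sqr_ge0.
by rewrite fineK ?fine_ge0// ge0_fin_numE// (le_lt_trans vle)// ltry.
Qed.

(** Inside the ball this is Taylor's bound. Outside, the increment is at most 2 and the linear term
    at most 1 plus the power, whence the 3. *)
Lemma increment_remainder (f : E -> R) Theta delta rho (sn : R) t (x : E) :
  0 < rho -> 0 < delta -> 0 < sn -> Theta t ->
  Cs_ball (enlarge Theta delta) (1 + rho) f ->
  `|f (t + sn^-1 *: x) - f t - sn^-1 * 'd f t x| <=
  3 * (2^-1 * delta * sn <= `|x|)%R%:R + (sn^-1 * `|x|) `^ (1 + rho).
Proof.
move=> rho0 d0 sn0 Tt /(Cs_ball_unfold rho0)[_ f1 df lf dlf].
have nx : `|sn^-1 *: x| = sn^-1 * `|x| by rewrite normrZ gtr0_norm ?invr_gt0.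
have dE : sn^-1 * 'd f t x = 'd f t (sn^-1 *: x) by rewrite linearZ.
have [xd|xd] := ltP `|sn^-1 *: x| delta.
  rewrite dE; apply: le_trans (taylor_remainder rho0 Tt xd df dlf) _.
  by rewrite nx lerDr mulr_ge0.
have -> : 2^-1 * delta * sn <= `|x|.
  move: xd; rewrite nx ler_pdivlMl// => xd; apply: le_trans xd; rewrite mulrC ler_wpM2l ?(ltW sn0)//; lra.
have tU := enlarge_self d0 Tt.
have h1 : `|sn^-1 * 'd f t x| <= sn^-1 * `|x|.
  rewrite dE -nx; apply: (@diff_lip_le _ _ f (enlarge Theta delta)) => //.
    exact: enlarge_nbhs.
  exact: df.
have z0 : 0 <= sn^-1 * `|x| by rewrite mulr_ge0// invr_ge0 ltW.
have h2 := normr_le_powR z0 rho0.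
apply: le_trans (ler_normB _ _) _.
have := ler_normB (f (t + sn^-1 *: x)) (f t).
by have := f1 (t + sn^-1 *: x); have := f1 t; rewrite mulr1; lra.
Qed.

Lemma gauss_law_diff (T : set E) (xi : E -> Om -> E) (f : E -> R) Theta delta rho t :
  0 < rho -> 0 < delta -> Theta t -> T t -> gaussian_process T Q xi ->
  Cs_ball (enlarge Theta delta) (1 + rho) f ->
  exists s, gauss_law Q (fun w => 'd f t (xi t w)) s.
Proof.
move=> rho0 d0 Tt TTt [_ gP] /(Cs_ball_unfold rho0)[_ _ df lf _].
have := gP 1%N (fun=> t) (fun=> 'd f t).
have tU := enlarge_self d0 Tt.
case=> //.
  move=> _; split; first by move=> a x y; rewrite linearP.
  exists 1 => x; rewrite mul1r; apply: (@diff_lip_le _ _ f (enlarge Theta delta)) => //.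
    exact: enlarge_nbhs.
  exact: df.
move=> mL hL; apply: centered_gaussian_law; split.
  by apply: eq_measurable_fun mL => w _; rewrite big_ord1.
move: hL => [s [s0 hs]]; exists s; split=> // A mA; rewrite -hs//; congr (Q _).
by apply/seteqP; split => w /=; rewrite big_ord1.
Qed.

Lemma sigma_fE (xi : E -> Om -> E) (f : E -> R) t s :
  gauss_law Q (fun w => 'd f t (xi t w)) s -> sigma_f Q xi f t = s.
Proof.
move=> g; rewrite /sigma_f (gauss_law_Ex_sqr g) sqrtr_sqr ger0_norm//.
by have [] := g.
Qed.

Context (T : set E) (xi : E -> Om -> E) (t : E) (sn v rho : R).
Hypotheses (sE : separable E) (gP : gaussian_process T Q xi) (Tt : T t).
Hypotheses (sn0 : 0 < sn) (v0 : 0 <= v) (rho01 : 0 < rho <= 1).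
Hypothesis X2 : (\int[Q]_w (`|xi t w| ^+ 2)%:E <= v%:E)%E.

Let rate : R := Num.sqrt (v / sn ^+ 2).
Let Y w : R := (sn^-1 * `|xi t w|) `^ (1 + rho).

Lemma measurable_norm_xi : measurable_fun setT (fun w => `|xi t w|).
Proof.
apply: measurable_random_element; first exact: gP.1.
by apply: borel_fun_continuous; exact: norm_continuous.
Qed.

Lemma measurable_remainder : measurable_fun setT Y.
Proof.
apply: (measurableT_comp (@measurable_powR R (1 + rho))).
by apply: measurable_funM => //; exact: measurable_norm_xi.
Qed.

Let X2r r : rate < r -> 0 < r /\ (\int[Q]_w (`|xi t w| ^+ 2)%:E <= ((sn * r) ^+ 2)%:E)%E.
Proof.
move=> rr; have r0 : 0 < r by apply: le_lt_trans rr; exact: sqrtr_ge0.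
split=> //; apply: le_trans X2 _; rewrite lee_fin exprMn -ler_pdivrMl ?exprn_gt0// mulrC.
rewrite -[leLHS]sqr_sqrtr ?divr_ge0 ?sqr_ge0//.
by rewrite lerXn2r ?nnegrE ?sqrtr_ge0 ?(ltW r0)// ltW.
Qed.

Let Y_le r w : 0 < r -> Y w <= r `^ (1 + rho) * (1 + `|xi t w| ^+ 2 / (sn * r) ^+ 2).
Proof.
move=> r0; have z0 : 0 <= `|xi t w| / (sn * r) by rewrite divr_ge0// (ltW (mulr_gt0 sn0 r0)).
have -> : Y w = r `^ (1 + rho) * (`|xi t w| / (sn * r)) `^ (1 + rho).
  rewrite -powRM ?(ltW r0)//; congr (_ `^ _); field.
  by rewrite !gt_eqF.
by rewrite ler_wpM2l ?powR_ge0//; have := powR_le_sqr z0 rho01; rewrite expr_div_n.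
Qed.

Lemma Ex_remainder : Q.-integrable setT (EFin \o Y) /\ Ex Q Y <= 2 * rate `^ (1 + rho).
Proof.
have iX : Q.-integrable setT (EFin \o (fun w => `|xi t w| ^+ 2)).
  apply/integrableP; split.
    by apply/measurable_EFinP; apply: measurable_funX; exact: measurable_norm_xi.
  under eq_integral do rewrite /= ger0_norm ?sqr_ge0//.
  by apply: le_lt_trans X2 _; exact: ltry.
have i1 : Q.-integrable setT (EFin \o (fun=> 1 : R)) by exact/bmeas_integrable/bmeas_cst.
pose D r w : R := r `^ (1 + rho) * (1 + ((sn * r) ^+ 2)^-1 * `|xi t w| ^+ 2).
have iXr r : Q.-integrable setT (EFin \o (fun w => ((sn * r) ^+ 2)^-1 * `|xi t w| ^+ 2)).
  exact: (integrableZl measurableT _ iX).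
have iD1 r : Q.-integrable setT (EFin \o (fun w => 1 + ((sn * r) ^+ 2)^-1 * `|xi t w| ^+ 2)).
  exact: (integrableD measurableT i1 (iXr r)).
have iD r : Q.-integrable setT (EFin \o D r).
  exact: (integrableZl measurableT _ (iD1 r)).
have YD r w : 0 < r -> Y w <= D r w.
  by move=> r0; have := Y_le w r0; rewrite /D [_^-1 * _]mulrC.
have Y0 w : 0 <= Y w by exact: powR_ge0.
have iY : Q.-integrable setT (EFin \o Y).
  apply: (le_integrable _ _ _ (iD (rate + 1))) => //.
    by apply/measurable_EFinP; exact: measurable_remainder.
  have r0 : 0 < rate + 1 by rewrite ltr_wpDl// sqrtr_ge0.
  by move=> w _; rewrite /= lee_fin ger0_norm// (le_trans (YD _ w r0))// ler_norm.
split=> //; rewrite -[leRHS]addr0; apply: le_of_powR_near => //.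
- exact: sqrtr_ge0.
- by move/andP: rho01 => [? _]; lra.
move=> r /X2r[r0 Xr]; rewrite addr0.
apply: (@le_trans _ _ (Ex Q (D r))); first by apply: le_Ex => // w; exact: YD.
rewrite ExZ// mulrC ler_wpM2r ?powR_ge0// ExD// Ex_cst ExZ//.
have h : Ex Q (fun w => `|xi t w| ^+ 2) <= (sn * r) ^+ 2.
  by rewrite -lee_fin /Ex fineK//; exact: integrable_fin_num.
have k0 : 0 < (sn * r) ^+ 2 by rewrite exprn_gt0// mulr_gt0.
have : ((sn * r) ^+ 2)^-1 * Ex Q (fun w => `|xi t w| ^+ 2) <= 1.
  by rewrite ler_pdivrMl// mulr1.
lra.
Qed.

Lemma Lpsi_remainder (psi : R -> R) (c'' : R) : Psi_class psi -> 0 < c'' ->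
  (forall u, 0 <= u -> psi u <= c'' * (expR u - 1)) ->
  (exists c, psi_adm psi Q Y c) /\
  Lpsi psi Q Y <= 512 * (1 + c'' * 20) * rate `^ (1 + rho).
Proof.
move=> Ppsi c0 hc; have K1 : 1 <= 512 :> R by rewrite ler1n.
move: (512 : R) K1 (@gaussian_norm_exp_moment R E T d Om Q xi t) => K K1 gauss.
have K0 : 0 < K by exact: lt_le_trans K1.
have mX := measurable_norm_xi.
have k0 : 0 < K * (1 + c'' * 20) by rewrite mulr_gt0// addr_gt0// mulr_gt0.
have adm r : rate < r -> psi_adm psi Q Y (K * (1 + c'' * 20) * r `^ (1 + rho)).
  move=> /X2r[r0 Xr].
  have snr0 : 0 < sn * r by exact: mulr_gt0.
  (* The summand 1 makes [K * Z] dominate the bracket in [Y_le], as [K >= 1]. Its price is a factor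
     [expR 1 <= 4] in the exponential moment, and [4 * 5 = 20]. *)
  pose Z w := 1 + `|xi t w| ^+ 2 / (K * (sn * r) ^+ 2).
  have mZ0 : measurable_fun setT (fun w => `|xi t w| ^+ 2 / (K * (sn * r) ^+ 2)).
    by apply: measurable_funM => //; exact: measurable_funX.
  have mZ : measurable_fun setT Z by exact: measurable_funD.
  have Z0 w : 0 <= `|xi t w| ^+ 2 / (K * (sn * r) ^+ 2).
    by rewrite divr_ge0 ?sqr_ge0// mulr_ge0 ?sqr_ge0// ltW.
  have admZ : psi_adm psi Q Z (1 + c'' * 20).
    apply: psi_adm_exp_moment => //.
    - by move=> w; rewrite addr_ge0.
    - have e4 := @expR1_le4 R.
      under eq_integral do rewrite expRD EFinM.
      rewrite ge0_integralZl//; last first.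
        by apply/measurable_EFinP; exact: measurableT_comp.
      apply: (@le_trans _ _ ((expR 1)%:E * 5%:E)%E).
        apply: lee_wpmul2l; first by rewrite lee_fin expR_ge0.
        exact: (gauss _ sE gP Tt snr0 Xr).
      by rewrite -EFinM lee_fin; lra.
  have c1 : 0 < K * r `^ (1 + rho) by rewrite mulr_gt0// powR_gt0.
  have := psi_adm_scale c1 admZ.
  rewrite (_ : K * r `^ (1 + rho) * (1 + c'' * 20) = K * (1 + c'' * 20) * r `^ (1 + rho)); last by ring.
  apply: psi_adm_le => //.
  - exact: measurable_remainder.
  - by apply: measurable_funM => //.
  move=> w; rewrite !ger0_norm ?mulr_ge0 ?addr_ge0 ?powR_ge0 ?(ltW K0)//.
  apply: le_trans (Y_le w r0) _.
  have -> : K * r `^ (1 + rho) * Z w = r `^ (1 + rho) * (K * Z w) by ring.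
  rewrite ler_wpM2l ?powR_ge0//.
  have -> : K * Z w = K + `|xi t w| ^+ 2 / (sn * r) ^+ 2.
    by rewrite /Z; field; rewrite !gt_eqF.
  have K2 : K <= K * 1 by rewrite mulr1.
  lra.
split.
  exists (K * (1 + c'' * 20) * (rate + 1) `^ (1 + rho)); apply: adm; rewrite ltrDl//.
rewrite -[leRHS]addr0; apply: le_of_powR_near => //.
- exact: sqrtr_ge0.
- by move/andP: rho01 => [? _]; lra.
- by move=> r rr; rewrite addr0; apply: Lpsi_le; exact: adm.
Qed.

End gaussian_remainder.

(** * Arithmetic of the final bounds *)

Section extended_bounds.
Context {R : realType}.
Implicit Types (a b c d e : \bar R).

Lemma esqrt_ge0 a : (0 <= esqrt a)%E.
Proof. by case: a => //= r; rewrite lee_fin sqrtr_ge0. Qed.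

Lemma le_mul_sum4 (A C x c' d' e' : R) b c d e : 0 <= C -> 0 <= c' ->
  (0 <= b)%E -> (c'%:E <= c)%E -> (d'%:E <= d)%E -> (e'%:E <= e)%E ->
  A <= C * (x + d' + e') -> (A%:E <= C%:E * (x%:E + b + c + d + e))%E.
Proof.
move=> C0 c0 b0 cc dd ee h.
apply: (@le_trans _ _ (C%:E * (x%:E + 0%:E + c'%:E + d'%:E + e'%:E))%E).
  rewrite -!EFinD -EFinM lee_fin; apply: le_trans h _; rewrite ler_wpM2l//; lra.
apply: lee_wpmul2l; first by rewrite lee_fin.
by do ?[apply: leeD].
Qed.

Lemma le_mul_sum3 (A C x d' e' : R) b d e : 0 <= C ->
  (0 <= b)%E -> (d'%:E <= d)%E -> (e'%:E <= e)%E ->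
  A <= C * (x + d' + e') -> (A%:E <= C%:E * (x%:E + b + d + e))%E.
Proof.
move=> C0 b0 dd ee h.
apply: (@le_trans _ _ (C%:E * (x%:E + 0%:E + d'%:E + e'%:E))%E).
  by rewrite -!EFinD -EFinM lee_fin addr0.
apply: lee_wpmul2l; first by rewrite lee_fin.
by do ?[apply: leeD].
Qed.

End extended_bounds.

Lemma moment_constant_gt0 {R : realType} (c : R) : 0 < c -> 0 < 512 * (1 + c * 20).
Proof.
move=> c0; have K1 : 1 <= 512 :> R by rewrite ler1n.
move: (512 : R) K1 => K K1; apply: mulr_gt0; first by lra.
by apply: addr_gt0 => //; apply: mulr_gt0.
Qed.

(** Orlicz norms: [x] of the increment, [y] of its linear part, [r] of the remainder, [j] and [w] of
    the indicator and power parts of the remainder. [z] is the power of the rate, [e] the root of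
    [psi_tilde]. *)
Lemma dist_le_remainder {R : realType} (x y r j w i p K e C z : R) :
  x <= y + r -> y <= x + r -> r <= j + w -> j = 3 * i -> i <= p -> p <= K * e ->
  w <= C * z -> `|x - y| <= 3 * (K * e) + C * z.
Proof. by move=> *; rewrite ler_norml; apply/andP; split; lra. Qed.

(** [a] and [b] are the Orlicz norms of the half increment at the estimator and at its Gaussian
    approximation; the factor 2 undoes the halving. *)
Lemma dist_le_sum_rates {R : realType} (a b y K e C z : R) :
  0 <= K -> 0 <= C -> 0 <= e -> 0 <= z -> `|2 * b - y| <= 3 * (K * e) + C * z ->
  `|2 * a - y| <= (2 + C + 3 * K) * (z + `|a - b| + e).
Proof.
move=> K0 C0 e0 z0 h; have ab0 := normr_ge0 (a - b).
have H2 : `|2 * a - 2 * b| = 2 * `|a - b| by rewrite -mulrBr normrM ger0_norm.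
have := ler_distD (2 * b) (2 * a) y; rewrite H2.
have p1 := mulr_ge0 K0 e0; have p2 := mulr_ge0 C0 z0; have p3 := mulr_ge0 K0 z0.
have p4 := mulr_ge0 K0 ab0; have p5 := mulr_ge0 C0 ab0; have p6 := mulr_ge0 C0 e0.
have -> : (2 + C + 3 * K) * (z + `|a - b| + e) = 2 * z + 2 * `|a - b| + 2 * e +
    (C * z + C * `|a - b| + C * e) + 3 * (K * z + K * `|a - b| + K * e) by ring.
lra.
Qed.

Lemma dist_le_sum_tests {R : realType} (a b x y sn m z q p : R) :
  x = 3 * b -> `|x - y| <= sn * m + 2 * q -> 0 <= sn -> m <= 2 * z -> 0 <= z -> q <= p -> 0 <= p ->
  `|3 * a - y| <= 3 * (sn * z + `|a - b| + p).
Proof.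
move=> -> h sn0 mz z0 qp p0.
have H2 : `|3 * a - 3 * b| = 3 * `|a - b| by rewrite -mulrBr normrM ger0_norm.
have := ler_distD (3 * b) (3 * a) y; rewrite H2.
have := ler_wpM2l sn0 mz; have := mulr_ge0 sn0 z0; rewrite mulrCA; lra.
Qed.

(** * The two bounds *)

Section main_bounds.
Context {R : realType} (rho : R) (hrho : 0 < rho <= 1).
Context (E : completeNormedModType R) (T Theta : set E) (delta : R) (n : nat)
  d (Om : measurableType d) (P : E -> probability Om R) (thetahat : Om -> E)
  d' (Om' : measurableType d') (Q : probability Om' R) (xi : E -> Om' -> E).
Hypothesis S : setting T Theta delta n P thetahat Q xi.
Let Thd := enlarge Theta delta.
Let xc := xi_conv Theta delta xi.
Let sn : R := Num.sqrt n%:R.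
Hypothesis vle : (v_xi Q xc Theta <= (1 * n%:R)%:E)%E.
Let rate : R := Num.sqrt (fine (v_xi Q xc Theta) / n%:R).
Variables (f : E -> R) (t : E).
Hypotheses (fB : Cs_ball Thd (1 + rho) f) (Tt : Theta t).

Let rho0 : 0 < rho. Proof. by case/andP: hrho. Qed.
Let d0 : 0 < delta. Proof. by have [_ [_ []]] := S. Qed.
Let n0 : (0 < n)%N. Proof. by have [_ [_ [_ [_ []]]]] := S. Qed.
Let rth : random_element thetahat. Proof. by have [_ [_ [_ [_ [_ []]]]]] := S. Qed.
Let gP : gaussian_process T Q xi. Proof. by have [_ [_ [_ [_ [_ [_ []]]]]]] := S. Qed.
Let tThd : Thd t. Proof. exact: enlarge_self. Qed.
Let TTt : T t. Proof. by have [_ [_ [_ [sub _]]]] := S; exact: sub. Qed.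
Let sn1 : 1 <= sn. Proof. by rewrite -sqrtr1 ler_sqrt ?ler1n. Qed.
Let sn0 : 0 < sn. Proof. exact: lt_le_trans sn1. Qed.
Let sn2 : sn ^+ 2 = n%:R. Proof. by rewrite sqr_sqrtr. Qed.

Let xcE : xc t = xi t.
Proof. by apply/funext => w; rewrite /xc /xi_conv asboolT. Qed.

Let B : set Om' := [set w | 2^-1 * delta * sn <= `|xi t w|].
Let Y w : R := (sn^-1 * `|xi t w|) `^ (1 + rho).
Let D w : R := f (t + sn^-1 *: xi t w) - f t.
Let L w : R := 'd f t (xi t w).

Let mX : measurable_fun setT (fun w => `|xi t w|).
Proof. exact: (measurable_norm_xi t gP). Qed.

Let mB : measurable B.
Proof.
have -> : B = (fun w => `|xi t w|) @^-1` `[2^-1 * delta * sn, +oo[%classic.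
  by apply/seteqP; split => w /=; rewrite in_itv/= andbT.
by rewrite -[X in measurable X]setTI; exact: mX.
Qed.

Let indB w : (2^-1 * delta * sn <= `|xi t w|)%R%:R = \1_B w :> R.
Proof.
by rewrite indicE; congr (nat_of_bool _)%:R; apply/idP/idP; rewrite inE.
Qed.

Let DL w : `|D w - sn^-1 * L w| <= 3 * \1_B w + Y w.
Proof. by rewrite -indB; exact: (increment_remainder _ rho0 d0 sn0 Tt fB). Qed.

Let fbd : [/\ borel_fun f & forall x, `|f x| <= 1].
Proof. by have [] := Cs_ball_unfold rho0 fB. Qed.

Let mD : measurable_fun setT D.
Proof.
have [bf _] := fbd; apply: measurable_funB => //.
apply: (@measurable_random_element _ _ _ _ (xi t) (fun x => f (t + sn^-1 *: x))); first exact: gP.1.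
apply: (@borel_fun_comp _ _ _ (fun x : E => t + sn^-1 *: x) f) => // x.
by apply: cvgD; [exact: cvg_cst|apply: cvgZl_tmp; exact: cvg_id].
Qed.

Let D2 w : `|D w| <= 2.
Proof.
have [_ f1] := fbd; apply: le_trans (ler_normB _ _) _.
by have := f1 (t + sn^-1 *: xi t w); have := f1 t; lra.
Qed.

Let gL : exists s, gauss_law Q L s.
Proof. exact: (gauss_law_diff rho0 d0 Tt TTt gP fB). Qed.

Let v_bound : (\int[Q]_w (`|xi t w| ^+ 2)%:E <= (fine (v_xi Q xc Theta))%:E)%E /\
  0 <= fine (v_xi Q xc Theta).
Proof. exact: (setting_fin_v d0 Tt vle). Qed.

Let rateE : Num.sqrt (fine (v_xi Q xc Theta) / sn ^+ 2) = rate.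
Proof. by rewrite sn2. Qed.

Let QB : set Om' := [set w | 2^-1 * delta * sn <= `|xc t w|].
Let QBE : QB = B. Proof. by rewrite /QB xcE. Qed.

Lemma Lpsi_bound (psi : R -> R) (c'' : R) : Psi_class psi -> 0 < c'' ->
  (forall u, 0 <= u -> psi u <= c'' * (expR u - 1)) ->
    ((`| Lpsi psi (P t) (fun w => f (thetahat w) - f t)
         - sn^-1 * sigma_f Q xc f t * Lpsi psi N01 (fun x => x) |)%:E
     <= (2 + 512 * (1 + c'' * 20) + 3 * Num.sqrt (psi_tilde psi 1))%:E *
        ((rate `^ (1 + rho))%:E
         + (sn^-1)%:E * esqrt (Sigma_sup Q xc Theta) * (rate `^ rho)%:E
         + ereal_sup [set z | exists th g, Thd th /\
              Cs_ball (enlarge Theta (2^-1 * delta)) (1 + rho) g /\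
              z = (`| Ex (P th) (fun w => g (thetahat w))
                      - Ex Q (fun w => g (th + sn^-1 *: xc th w)) |)%:E]
         + ereal_sup [set z | exists th g, Thd th /\
              Cs_ball (enlarge Theta (2^-1 * delta)) (1 + rho) g /\
              z = (`| Lpsi psi (P th) (fun w => g (thetahat w))
                      - Lpsi psi Q (fun w => g (th + sn^-1 *: xc th w)) |)%:E]
         + ereal_sup [set (Num.sqrt (psi_tilde psi
              (fine (Q [set w | 2^-1 * delta * sn <= `|xc th w|]))))%:E
              | th in Theta]))%E.
Proof.
move=> Ppsi c0 hc; have sE : separable E by have [] := S.
have [v1 v2] := v_bound.
have [[cY admY] LY] := Lpsi_remainder sE gP TTt sn0 v2 hrho v1 Ppsi c0 hc.
rewrite rateE in LY.
have C10 := ltW (moment_constant_gt0 c0).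
set C1 := 512 * (1 + c'' * 20) in LY C10 *; clearbody C1.
have [s gLs] := gL; have [mL s0 _] := gLs.
have mI : measurable_fun setT (\1_B : Om' -> R) by exact: measurable_indic.
have mY : measurable_fun setT Y by exact: (measurable_remainder t sn rho gP).
pose J w : R := 3 * \1_B w.
have mJ : measurable_fun setT J by exact: measurable_funM.
pose Rm w := J w + Y w.
have mRm : measurable_fun setT Rm by exact: measurable_funD.
pose L' w := sn^-1 * L w.
have mL' : measurable_fun setT L' by exact: measurable_funM.
have I01 w : 0 <= (\1_B w : R) <= 1 by rewrite indicE ler0n lern1 leq_b1.
have J0 w : 0 <= J w by rewrite mulr_ge0//; have /andP[] := I01 w.
have Y0 w : 0 <= Y w by exact: powR_ge0.
have [cI admI] : exists c, psi_adm psi Q \1_B c.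
  by apply: (psi_adm_bounded Ppsi Q (M := 1)) => // w; have /andP[? ?] := I01 w; rewrite ger0_norm.
have admJ : psi_adm psi Q J (3 * cI) by exact: psi_adm_scale.
have RmJY w : `|Rm w| <= `|J w| + `|Y w| by exact: ler_normD.
have admRm := psi_adm_add Ppsi mRm mJ mY RmJY admJ admY.
have [cD admD] := psi_adm_bounded Ppsi Q mD D2.
have DLR w : `|D w - L' w| <= `|Rm w|.
  by rewrite [`|Rm w|]ger0_norm ?addr_ge0//; exact: DL.
have DLR1 w : `|D w| <= `|L' w| + `|Rm w|.
  by have := DLR w; have := ler_normD (D w - L' w) (L' w); rewrite subrK; lra.
have DLR2 w : `|L' w| <= `|D w| + `|Rm w|.
  by have := DLR w; have := ler_normB (D w) (D w - L' w); rewrite opprB addrCA subrr addr0; lra.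
(* The linear part is unbounded; its admissibility comes from the bounded increment and the
   remainder, which together dominate it. *)
have admL' := psi_adm_add Ppsi mL' mD mRm DLR2 admD admRm.
have T1 := Lpsi_triangle Ppsi mD mL' mRm DLR1 admL' admRm.
have T2 := Lpsi_triangle Ppsi mL' mD mRm DLR2 admD admRm.
have T3 := Lpsi_triangle Ppsi mRm mJ mY RmJY admJ admY.
have EJ : Lpsi psi Q J = 3 * Lpsi psi Q \1_B by exact: Lpsi_scale.
have LI := Lpsi_indic Ppsi Q mB.
have QB01 : 0 <= fine (Q B) <= 1.
  have QBf : Q B \is a fin_num by exact: fin_num_measure.
  by rewrite fine_ge0//= -lee_fin fineK// probability_le1.
have PT := psi_tilde_le_sqrt Ppsi QB01.
have EL : Lpsi psi Q L' = sn^-1 * s * Lpsi psi N01 (fun x => x).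
  by rewrite Lpsi_scale ?invr_gt0// (Lpsi_gauss_law Ppsi gLs) mulrA.
have sg : sigma_f Q xc f t = s.
  rewrite /sigma_f xcE; exact: (sigma_fE gLs).
pose g x := 2^-1 * (f x - f t).
have gB : Cs_ball (enlarge Theta (2^-1 * delta)) (1 + rho) g.
  by apply: (Cs_ball_half_increment t rho0 _ fB); have := d0; lra.
have E1 : Lpsi psi (P t) (fun w => f (thetahat w) - f t) =
    2 * Lpsi psi (P t) (fun w => g (thetahat w)).
  rewrite -Lpsi_scale//; congr Lpsi; apply/funext => w.
  by rewrite /g mulrA mulfV// mul1r.
have E2 : Lpsi psi Q D = 2 * Lpsi psi Q (fun w => g (t + sn^-1 *: xc t w)).
  rewrite -Lpsi_scale//; congr Lpsi; apply/funext => w.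
  by rewrite /g mulrA mulfV// mul1r xcE.
apply: (@le_mul_sum4 R _ _ _
  `|Ex (P t) (fun w => g (thetahat w)) - Ex Q (fun w => g (t + sn^-1 *: xc t w))|
  `|Lpsi psi (P t) (fun w => g (thetahat w)) - Lpsi psi Q (fun w => g (t + sn^-1 *: xc t w))|
  (Num.sqrt (psi_tilde psi (fine (Q QB))))).
- by rewrite !addr_ge0// mulr_ge0// sqrtr_ge0.
- exact: normr_ge0.
- by rewrite !mule_ge0 ?esqrt_ge0// lee_fin ?powR_ge0// invr_ge0 ltW.
- by apply: ereal_sup_ubound; exists t, g.
- by apply: ereal_sup_ubound; exists t, g.
- by apply: ereal_sup_ubound; exists t.
rewrite QBE sg -EL E1.
set a := Lpsi psi (P t) _; set b := Lpsi psi Q (fun w => g _).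
rewrite -/b in E2.
apply: dist_le_sum_rates.
- exact: sqrtr_ge0.
- exact: C10.
- exact: sqrtr_ge0.
- exact: powR_ge0.
rewrite -E2; exact: (dist_le_remainder T1 T2 T3 EJ LI PT LY).
Qed.

Lemma Delta_bound (s' : R) : 1 <= s' <= 1 + rho ->
  (ereal_sup [set z | exists phi : R -> R, Cs_ball setT s' phi /\
        z = (`| Ex (P t) (fun w => phi (sn * (f (thetahat w) - f t)))
                - Ex N01 (fun x => phi (sigma_f Q xc f t * x)) |)%:E]
     <= 3%:E *
        ((sn * rate `^ (1 + rho))%:E
         + esqrt (Sigma_sup Q xc setT) * (rate `^ rho)%:E
         + ereal_sup [set z | exists th g, Thd th /\
              C0s_ball (origin_ball (2^-1 * delta * sn) : set E) s' g /\
              z = (`| Ex (P th) (fun w => g (sn *: (thetahat w - th)))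
                      - Ex Q (fun w => g (xc th w)) |)%:E]
         + sn%:E * ereal_sup [set ((fine (Q [set w | 2^-1 * delta * sn <= `|xc th w|]))
                                   `^ (4^-1))%:E | th in Theta]))%E.
Proof.
move=> s's; apply: ge_ereal_sup => _ [phi [phiB ->]].
have [v1 v2] := v_bound.
have [iY EY] := Ex_remainder gP sn0 v2 hrho v1; rewrite rateE in EY.
have [s gLs] := gL; have [mL s0 _] := gLs.
have [[bphi phi1] [_ phiC]] := phiB.
have mphi : measurable_fun setT phi.
  by move=> _ A mA; rewrite setTI; apply: measurable_of_borel; exact: bphi.
have philip : forall a b, `|phi a - phi b| <= `|a - b|.
  by apply: C0s_le1_lip phiC; case/andP: s's.
have sg : sigma_f Q xc f t = s.
  rewrite /sigma_f xcE; exact: (sigma_fE gLs).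
pose g x := 3^-1 * phi (sn * (f (t + sn^-1 *: x) - f t)).
have gB : C0s_ball (origin_ball (2^-1 * delta * sn) : set E) s' g.
  by apply: (C0s_ball_rescaled hrho sn1 s's Tt _ fB phiB); have := d0; lra.
pose q := fine (Q B).
have QBf : Q B \is a fin_num by exact: fin_num_measure.
have q0 : 0 <= q by rewrite fine_ge0.
have q1 : q <= 1 by rewrite -lee_fin fineK// probability_le1.
apply: (@le_mul_sum3 R _ _ _
  `|Ex (P t) (fun w => g (sn *: (thetahat w - t))) - Ex Q (fun w => g (xc t w))|
  (sn * q `^ (4^-1))).
- by [].
- by rewrite mule_ge0 ?esqrt_ge0// lee_fin powR_ge0.
- by apply: ereal_sup_ubound; exists t, g.
- rewrite EFinM; apply: lee_wpmul2l; first by rewrite lee_fin ltW.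
  by apply: ereal_sup_ubound; exists t => //; rewrite -/QB QBE.
have bphiD : bmeas (fun w => phi (sn * D w)).
  split; last by exists 1 => w; exact: phi1.
  by apply: (measurableT_comp mphi); exact: measurable_funM.
have bphiL : bmeas (fun w => phi (L w)).
  by split; [exact: measurableT_comp|exists 1 => w; exact: phi1].
have E1 : Ex (P t) (fun w => phi (sn * (f (thetahat w) - f t))) =
    3 * Ex (P t) (fun w => g (sn *: (thetahat w - t))).
  have bg : bmeas (fun w => phi (sn * (f (thetahat w) - f t))).
    split; last by exists 1 => w; exact: phi1.
    apply: (measurableT_comp mphi); apply: measurable_funM => //; apply: measurable_funB => //.
    by apply: measurable_random_element => //; case: fbd.
  rewrite (_ : (fun w => g _) = (fun w => 3^-1 * phi (sn * (f (thetahat w) - f t)))).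
    by rewrite ExZ ?mulrA ?mulfV ?mul1r//; exact: bmeas_integrable.
  apply/funext => w; rewrite /g scalerA mulVf ?gt_eqF// scale1r.
  by rewrite [t + _]addrC subrK.
have E2 : Ex Q (fun w => phi (sn * D w)) = 3 * Ex Q (fun w => g (xc t w)).
  rewrite (_ : (fun w => g _) = (fun w => 3^-1 * phi (sn * D w))).
    by rewrite ExZ ?mulrA ?mulfV ?mul1r//; exact: bmeas_integrable.
  by apply/funext => w; rewrite /g xcE.
have E3 : Ex N01 (fun x => phi (sigma_f Q xc f t * x)) = Ex Q (fun w => phi (L w)).
  rewrite sg (gauss_law_Ex (g := phi) gLs)//; split => //; exists 1; exact: phi1.
have diff w : `|phi (sn * D w) - phi (L w)| <= sn * Y w + 2 * \1_B w.
  (* On [B] the bound [phi1] gives 2; elsewhere the indicator vanishes and the Lipschitz property of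
     [phi] leaves [sn * Y]. *)
  have [wB|wB] := pselect (B w).
    have -> : \1_B w = 1 :> R by rewrite indicE mem_set.
    apply: le_trans (ler_normB _ _) _; have := phi1 (L w); have := phi1 (sn * D w).
    have : 0 <= sn * Y w by rewrite mulr_ge0 ?powR_ge0 ?(ltW sn0).
    by move=> h a b; rewrite -[leLHS]add0r mulr1; apply: lerD => //; exact: lerD.
  have -> : \1_B w = 0 :> R by rewrite indicE memNset.
  apply: le_trans (philip _ _) _; rewrite mulr0 addr0.
  have := DL w; rewrite [\1_B w]indicE memNset// mulr0 add0r => h.
  have -> : sn * D w - L w = sn * (D w - sn^-1 * L w).
    by rewrite [RHS]mulrBr (mulrA sn) mulfV ?mul1r ?gt_eqF.
  by rewrite normrM gtr0_norm// ler_pM2l.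
have bI : bmeas (\1_B : Om' -> R) by exact: bmeas_indic.
have i1 : Q.-integrable setT (EFin \o (fun w => sn * Y w)) by exact: (integrableZl measurableT _ iY).
have i2 : Q.-integrable setT (EFin \o (fun w => 2 * \1_B w : R)) by exact/bmeas_integrable/bmeasZ.
have EX : `|Ex Q (fun w => phi (sn * D w)) - Ex Q (fun w => phi (L w))| <= sn * Ex Q Y + 2 * q.
  have -> : Ex Q (fun w => phi (sn * D w)) - Ex Q (fun w => phi (L w)) =
      Ex Q (fun w => phi (sn * D w) + (-1) * phi (L w)).
    rewrite ExD ?ExZ ?mulN1r//; [exact: bmeas_integrable|exact: bmeas_integrable|exact/bmeas_integrable/bmeasZ].
  have bd : bmeas (fun w => phi (sn * D w) + (-1) * phi (L w)) by apply: bmeasD => //; exact: bmeasZ.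
  apply: le_trans (Ex_abs_le (bmeas_integrable _ bd)) _.
  have -> : sn * Ex Q Y + 2 * q = Ex Q (fun w => sn * Y w + 2 * \1_B w).
    by rewrite ExD// !ExZ// ?Ex_indic//; exact: bmeas_integrable.
  apply: le_Ex.
  - exact: (integrable_norm (bmeas_integrable Q bd)).
  - exact: (integrableD measurableT i1 i2).
  - by move=> w; rewrite mulN1r.
(* A probability is at most its fourth root, and [sn >= 1]. *)
have q4 : q <= sn * q `^ (4^-1).
  have h : q <= q `^ (4^-1).
    move: q0; rewrite le_eqVlt => /orP[/eqP<-|qp]; first exact: powR_ge0.
    rewrite -[leLHS]powRr1 ?(ltW qp)//; apply: ger_powR; first by rewrite qp.
    by rewrite invf_le1// ler1n.
  by apply: le_trans h _; rewrite ler_peMl ?powR_ge0.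
rewrite E1 E3.
set a := Ex (P t) _; set b := Ex Q (fun w => g _).
rewrite -/b in E2.
apply: (@dist_le_sum_tests _ a b _ (Ex Q (fun w => phi (L w))) sn (Ex Q Y)
  (rate `^ (1 + rho)) q (sn * q `^ (4^-1)) E2 EX (ltW sn0) EY _ q4).
  exact: powR_ge0.
by rewrite mulr_ge0 ?powR_ge0 ?ltW.
Qed.

End main_bounds.

Theorem theorem2p3 (R : realType) (rho : R) (hrho : 0 < rho <= 1) :
  exists c1 cs : R, 0 < c1 /\ 0 < cs < 1 /\
  (* part (i) *)
  (forall psi : R -> R, Psi_class psi -> exists C : R, 0 < C /\
    forall (E : completeNormedModType R) (T Theta : set E) (delta : R) (n : nat)
      d (Om : measurableType d) (P : E -> probability Om R) (thetahat : Om -> E)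
      d' (Om' : measurableType d') (Q : probability Om' R) (xi : E -> Om' -> E),
    setting T Theta delta n P thetahat Q xi ->
    let Thd := enlarge Theta delta in
    let xc := xi_conv Theta delta xi in
    let sn := Num.sqrt n%:R in
    (v_xi Q xc Theta <= (c1 * n%:R)%:E)%E ->
    let rate := Num.sqrt (fine (v_xi Q xc Theta) / n%:R) in
    let H := Cs_ball (enlarge Theta (cs * delta)) (1 + rho) in
    let tt t w := t + sn^-1 *: xc t w in
    forall (f : E -> R) (t : E), Cs_ball Thd (1 + rho) f -> Theta t ->
    ((`| Lpsi psi (P t) (fun w => f (thetahat w) - f t)
         - sn^-1 * sigma_f Q xc f t * Lpsi psi N01 (fun x => x) |)%:E
     <= C%:E *
        ((rate `^ (1 + rho))%:E
         + (sn^-1)%:E * esqrt (Sigma_sup Q xc Theta) * (rate `^ rho)%:E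
         + ereal_sup [set z | exists th g, Thd th /\ H g /\
              z = (`| Ex (P th) (fun w => g (thetahat w))
                      - Ex Q (fun w => g (tt th w)) |)%:E]
         + ereal_sup [set z | exists th g, Thd th /\ H g /\
              z = (`| Lpsi psi (P th) (fun w => g (thetahat w))
                      - Lpsi psi Q (fun w => g (tt th w)) |)%:E]
         + ereal_sup [set (Num.sqrt (psi_tilde psi
              (fine (Q [set w | cs * delta * sn <= `|xc th w|]))))%:E
              | th in Theta]))%E) /\
  (* part (ii) *)
  (exists C : R, 0 < C /\
    forall (E : completeNormedModType R) (T Theta : set E) (delta : R) (n : nat)
      d (Om : measurableType d) (P : E -> probability Om R) (thetahat : Om -> E)
      d' (Om' : measurableType d') (Q : probability Om' R) (xi : E -> Om' -> E),
    setting T Theta delta n P thetahat Q xi ->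
    let Thd := enlarge Theta delta in
    let xc := xi_conv Theta delta xi in
    let sn := Num.sqrt n%:R in
    (v_xi Q xc Theta <= (c1 * n%:R)%:E)%E ->
    let rate := Num.sqrt (fine (v_xi Q xc Theta) / n%:R) in
    forall s' : R, 1 <= s' <= 1 + rho ->
    let F := C0s_ball (origin_ball (cs * delta * sn) : set E) s' in
    forall (f : E -> R) (t : E), Cs_ball Thd (1 + rho) f -> Theta t ->
    (ereal_sup [set z | exists phi : R -> R, Cs_ball setT s' phi /\
        z = (`| Ex (P t) (fun w => phi (sn * (f (thetahat w) - f t)))
                - Ex N01 (fun x => phi (sigma_f Q xc f t * x)) |)%:E]
     <= C%:E *
        ((sn * rate `^ (1 + rho))%:E
         + esqrt (Sigma_sup Q xc setT) * (rate `^ rho)%:E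
         + ereal_sup [set z | exists th g, Thd th /\ F g /\
              z = (`| Ex (P th) (fun w => g (sn *: (thetahat w - th)))
                      - Ex Q (fun w => g (xc th w)) |)%:E]
         + sn%:E * ereal_sup [set ((fine (Q [set w | cs * delta * sn <= `|xc th w|]))
                                   `^ (4^-1))%:E | th in Theta]))%E).
Proof.
have h2 : 0 < (2^-1 : R) < 1 by lra.
(* [c1] acts through the finiteness of [v_xi], and [cs] through [cs * delta <= delta]. *)
exists 1, 2^-1; split; first exact: ltr01.
split=> //; split.
  move=> psi Ppsi; have [_ [_ [_ [_ [_ [c' [c'' [_ [c0 hc]]]]]]]]] := Ppsi.
  (* The summands stem from the distance over [H], the Orlicz norm of the power remainder, and the
     indicator of the exit from the ball. *)
  exists (2 + 512 * (1 + c'' * 20) + 3 * Num.sqrt (psi_tilde psi 1)); split.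
    have := sqrtr_ge0 (psi_tilde psi 1); have := moment_constant_gt0 c0.
    by move: (512 * _) (Num.sqrt _) => a b a0 b0; lra.
  move=> E T Theta delta n d Om P thetahat d' Om' Q xi S Thd xc sn vle rate H tt f t fB Tt.
  by apply: (Lpsi_bound hrho S vle fB Tt Ppsi c0) => u u0; exact: (hc u u0).2.
exists 3; split=> //.
move=> E T Theta delta n d Om P thetahat d' Om' Q xi S Thd xc sn vle rate s' s's F f t fB Tt.
exact: (Delta_bound hrho S vle fB Tt s's).
Qed.
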